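(* Let $\mathcal K$ be a $K$-category. If $I$ is a weighted branched cover of $\mathcal K$ with trivial stabilizers, and $S$ is a sheaf on $\mathcal K$ satisfying the Patching Axiom, then the sheaf $S^I$ of weighted branched sections of $S$ satisfies the Patching and Averaging axioms.
   Context: Everything takes place over the category of $C^{\infty,\underline1}$ exploded manifolds (in the sense of B. Parker: spaces with a sheaf of $\mathbb C^*\mathfrak t^{\mathbb R}$-valued functions locally modelled on open subsets of $\mathbb R^n\times\mathbf T^m_P$, where $\mathbf T^m_P$ is the set of $\tilde z\in(\mathbb C^*\mathfrak t^{\mathbb R})^m$ whose tropical part lies in the integral affine polytope $P$; smooth manifolds are a full subcategory). The smooth part $\lceil\mathbf B\rceil$ of an exploded manifold $\mathbf B$ is its quotient identifying points not distinguished by continuous $\mathbb R$-valued functions. A stack means a stack over this category, with structure functor $\mathbf F$; an object $\hat f$ is a family parametrized by $\mathbf F(\hat f)$, and $f$ is a curve if $\mathbf F(f)$ is a point. A $K$-category is a full subcategory $\mathcal K$ of a stack $\mathcal K^{st}$ with charts $\hat f_i/G_i$ such that: (1) $\hat f_i$ is a family in $\mathcal K^{st}$, $G_i$ a finite group of automorphisms; (2) $\hat f_i/G_i$ represents a substack of $\mathcal K^{st}$ (a full subcategory containing $\hat f$ iff it contains every curve in $\hat f$); (3) each $\hat f_i$ has fixed dimension, and if $\dim\hat f_i\le\dim\hat f_j$, $\hat f_i\times_{\mathcal K^{st}}\hat f_j\to\hat f_i$ is a $G_j$-fold cover of an open subfamily, and $\hat f_i\times_{\mathcal K^{st}}\hat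 f_j\to\hat f_j$ is a $G_i$-fold cover of a subfamily locally defined by transverse vanishing of $\mathbb R$-valued functions on $\mathbf F(\hat f_j)$; (4) the $\hat f_i$ cover $\mathcal K^{st}$; (5) there are countably many charts and each $\hat f_i$ meets finitely many $\hat f_j$; (6) $\mathcal K$ consists of the families locally isomorphic to some $\hat f_i$. A sheaf on $\mathcal K$ is a contravariant functor to sets restricting to a sheaf on the open subfamilies of each family. A weighted branched cover $I$ of $\mathcal K$ is a contravariant functor with domain a full subcategory $\mathcal O_I\subset\mathcal K^{st}$ such that all $O\in\mathcal O_I$ are connected; if $O_1\in\mathcal K^{st}$ is connected and there is a morphism $O_1\to O_2\in\mathcal O_I$ then $O_1\in\mathcal O_I$; and every family in $\mathcal K$ has an open cover contained in $\mathcal O_I$. Its target is the category of triples $(I(O),\mu,\equiv)$ where $I(O)$ is a finite set, $\mu$ a probability measure on it with every point of positive rational measure, $\equiv$ an equivalence relation on $I(O)$; a morphism $\iota^*:I(O_2)\to I(O_1)$ is a measure preserving map such that $i\equiv j$ if $\iota^*i\equiv\iota^*j$. It is assumed that for any curve $f$ and morphism $f\to O$ in $\mathcal O_I$ there is a neighborhood $U\subset O$ of $f$ with $(I(U),\mu,\equiv)\to(I(f),\mu,\equiv)$ an isomorphism. $i,j\in I(O)$ are separated at $f$ if their images in $I(f)$ are not equivalent. $I$ has trivial stabilizers if, whenever $\psi:\hat f\to\hat f$ is a nontrivial automorphism in $\mathcal K\cap\mathcal O_I$ fixing the image $\lceil f\rceil\in\lceil\mathbf F(\hat f)\rceil$ of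 a curve $f$ in $\hat f$, then for all $i\in I(\hat f)$, $i$ and $\psi^*i$ are separated at $f$. For $\hat f$ in $\mathcal K$, let $\mathcal O_{I,\hat f}$ be the category of families in $\mathcal O_I\cap\mathcal K$ with a given map to $\hat f$. $S^I(\hat f)$ is the set of natural transformations $\nu$ from $I$ to $S$ (as set-valued functors on $\mathcal O_{I,\hat f}$) such that for $O$ in $\mathcal O_{I,\hat f}$ and $i,j\in I(O)$ not separated at $f$, $\nu(i)=\nu(j)$ on a neighborhood of $f$. Pullback along $\hat g\to\hat f$ is via $\mathcal O_{I,\hat g}\to\mathcal O_{I,\hat f}$. $S^I$ is a sheaf on $\mathcal K$. Axioms for a sheaf $T$ on $\mathcal K$. *Patching:* given an open cover $\{O_k\}$ of $\hat f$ and $\theta_k\in T(O_k)$ for all $k$, there exists $\theta\in T(\hat f)$ such that, for any morphism $\hat g\to\hat f$ in $\mathcal K$ and $\theta'\in T(\hat g)$, the pullback of $\theta$ to $\hat g$ is $\theta'$ whenever for all $k$ the sections $\theta'$ and $\theta_k$ have the same pullback to $\hat g\times_{\hat f}O_k$. *Averaging:* given $\theta\in T(\hat f)$ and a finite group $G$ acting on $\hat f$, there is a $G$-invariant $\theta'\in T(\hat f)$ such that for any $G$-equivariant map $\hat f'\to\hat f$ pulling $\theta$ back to a $G$-invariant section, the pullbacks of $\theta$ and $\theta'$ to $\hat f'$ agree. *)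

(* Defs.v *)
(* The reals are a realType R of MathComp-Analysis, the complex numbers are
   R[i] from mathcomp-real-closed. *)
From HB Require Import structures.
From mathcomp Require Import all_boot all_order all_algebra all_fingroup.
From mathcomp Require Import all_classical all_reals all_analysis.
From mathcomp Require Import complex.

Set Implicit Arguments.
Unset Strict Implicit.
Unset Printing Implicit Defensive.

Import Order.TTheory GRing.Theory Num.Theory numFieldNormedType.Exports.

Local Open Scope classical_set_scope.
Local Open Scope ring_scope.

(** * Categories *)

Record category := Category {
  ob :> Type;
  hom : ob -> ob -> Type;
  idm : forall x, hom x x;
  cmp : forall x y z, hom y z -> hom x y -> hom x z;
  cmp_id_l : forall x y (a : hom x y), cmp (idm y) a = a;
  cmp_id_r : forall x y (a : hom x y), cmp a (idm x) = a;
  cmp_assoc : forall x y z t (c : hom z t) (b : hom y z) (a : hom x y),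
    cmp c (cmp b a) = cmp (cmp c b) a }.

Arguments hom {_} _ _.
Arguments idm {_} _.
Notation "g \c f" := (cmp g f) (at level 50, left associativity).

Record functor (C D : category) := Functor {
  fob :> C -> D;
  fmor : forall x y, hom x y -> hom (fob x) (fob y);
  fmor_id : forall x, fmor (idm x) = idm (fob x);
  fmor_cmp : forall x y z (b : hom y z) (a : hom x y),
    fmor (b \c a) = fmor b \c fmor a }.

Arguments fmor {_ _} f {_ _} _.

(* A contravariant functor to sets. *)
Record presheaf (C : category) := Presheaf {
  sec :> C -> Type;
  res : forall x y, hom x y -> sec y -> sec x;
  res_id : forall x (s : sec x), res (idm x) s = s;
  res_cmp : forall x y z (b : hom y z) (a : hom x y) (s : sec z),
    res (b \c a) s = res a (res b s) }.

Arguments res {_} p {_ _} _ _.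

Definition full (C : category) (P : C -> Prop) : category :=
  @Category {x : C | P x} (fun x y => hom (sval x) (sval y))
    (fun x => idm (sval x)) (fun x y z b a => b \c a)
    (fun x y a => cmp_id_l a) (fun x y a => cmp_id_r a)
    (fun x y z t c b a => cmp_assoc c b a).

Definition obj_cast (C : category) (x y : C) (e : x = y) : hom x y :=
  match e in _ = t return hom x t with erefl => idm x end.

Definition is_pullback (C : category) (x y z t : C)
    (a : hom x z) (b : hom y z) (p : hom t x) (q : hom t y) : Prop :=
  a \c p = b \c q /\
  forall (w : C) (p' : hom w x) (q' : hom w y), a \c p' = b \c q' ->
    exists! h : hom w t, p \c h = p' /\ q \c h = q'.

Definition is_product (C : category) (x y t : C)
    (p : hom t x) (q : hom t y) : Prop :=
  forall (w : C) (p' : hom w x) (q' : hom w y),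
    exists! h : hom w t, p \c h = p' /\ q \c h = q'.

Record action_on (C : category) (G : finGroupType) (x : C) := ActionOn {
  act_hom :> G -> hom x x;
  act_hom1 : act_hom 1%g = idm x;
  act_homM : forall g h, act_hom (g * h)%g = act_hom g \c act_hom h }.

(** * Exploded manifolds *)

Section Exploded.
Variable R : realType.

(* The element c t^a of the group C^* t^R is [Ctr] with [coef] c, [expo] a. *)
Record ctr := Ctr { coef : R[i]; expo : R; coef_neq0 : coef != 0 }.

Definition ctr_mul (z w : ctr) : ctr :=
  Ctr (expo z + expo w) (mulf_neq0 (coef_neq0 z) (coef_neq0 w)).

Definition ctr_inv (z : ctr) : ctr :=
  Ctr (- expo z) (invr_neq0 (coef_neq0 z)).

(** ** Abstract exploded spaces *)

(* The sheaf of exploded functions: [efun U f] says that the restriction of f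
   to U is a section over U. *)
Record exploded_space := ExplodedSpace {
  espace :> topologicalType;
  efun : set espace -> set (espace -> ctr);
  efun_ext : forall (U : set espace) f g, {in U, f =1 g} -> efun U f -> efun U g;
  efun_res : forall U V f, open U -> open V -> V `<=` U -> efun U f -> efun V f;
  efun_glue : forall U f, open U ->
    (forall x, U x -> exists V, [/\ open V, V x, V `<=` U & efun V f]) -> efun U f;
  efun_cst : forall U z, open U -> efun U (fun=> z);
  efun_mul : forall U f g, open U -> efun U f -> efun U g ->
    efun U (fun x => ctr_mul (f x) (g x));
  efun_inv : forall U f, open U -> efun U f -> efun U (fun x => ctr_inv (f x)) }.

Record emap (A B : exploded_space) := EMap {
  emap_fun :> A -> B;
  emap_cont : continuous emap_fun;
  emap_pull : forall V g, open V -> efun V g ->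
    efun (emap_fun @^-1` V) (g \o emap_fun) }.

(** ** Local models R^n x T^m_P *)

Definition halfspace (m : nat) := (('I_m -> int) * R)%type.

(* The integral affine function v |-> a + alpha . v for (alpha, a); also the
   tropical part of the monomial t^a z^alpha. *)
Definition aff m (l : halfspace m) (v : 'rV[R]_m) : R :=
  l.2 + \sum_(i < m) (l.1 i)%:~R * v 0 i.

(* Some of the defining inequalities may be strict, as for T^1_(0,l). *)
Definition integral_affine_polytope m (P : set 'rV[R]_m) : Prop :=
  (exists hs : seq (halfspace m * bool),
     P = [set v | forall h, h \in hs ->
                    if h.2 then 0 < aff h.1 v else 0 <= aff h.1 v])
  /\ interior P !=set0.

Definition mpoint (n m : nat) := ('rV[R]_n * ('I_m -> ctr))%type.

Section Model.
Variables n m : nat.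
Implicit Types (p q : mpoint n m) (P : set 'rV[R]_m) (l : halfspace m).

Definition trop p : 'rV[R]_m := \row_i expo (p.2 i).

Definition model P : set (mpoint n m) := [set p | P (trop p)].

Definition mono_coef l p : R[i] := \prod_(i < m) coef (p.2 i) ^ l.1 i.

Definition smooth_monomial P l : Prop := forall v, P v -> 0 <= aff l v.

(* The smooth part of t^a z^alpha: it vanishes where the tropical part is
   positive. *)
Definition mono_val l p : R[i] :=
  if aff l (trop p) == 0 then mono_coef l p else 0.

Definition cabs (z : R[i]) : R := Num.sqrt (complex.Re z ^+ 2 + complex.Im z ^+ 2).

(* The topology of R^n x T^m_P is the coarsest one making the coordinates of
   R^n and the smooth monomials continuous. *)
Definition model_nbhs P p (V : set (mpoint n m)) : Prop :=
  exists (ls : seq (halfspace m)) (e : R),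
    [/\ 0 < e, (forall l, l \in ls -> smooth_monomial P l)
      & forall q, model P q ->
          (forall i, `|q.1 0 i - p.1 0 i| < e) ->
          (forall l, l \in ls -> cabs (mono_val l q - mono_val l p) < e) ->
          V q].

Definition model_open P (U : set (mpoint n m)) : Prop :=
  U `<=` model P /\ forall p, U p -> model_nbhs P p U.

(* Constant coefficient vector fields: v = (a, b) stands for the sum of the
   a_i d/dx_i and of the b_j z_j d/dz_j + their conjugates; its flow at time s
   is (x, z) |-> (x + s a, (e^(s b_j) z_j)_j).  They frame the tangent bundle
   of R^n x T^m_P. *)
Definition vfield := ('rV[R]_n * ('I_m -> R[i]))%type.

Definition cexp (b : R[i]) : R[i] :=
  Complex (expR (complex.Re b) * cos (complex.Im b))
          (expR (complex.Re b) * sin (complex.Im b)).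

Lemma cexp_neq0 b : cexp b != 0.
Proof.
have e0 : expR (complex.Re b) != 0 by rewrite gt_eqF// expR_gt0.
apply/eqP => -[] /eqP; rewrite mulf_eq0 (negbTE e0)/= => /eqP c0.
move=> /eqP; rewrite mulf_eq0 (negbTE e0)/= => /eqP s0.
have := cos2Dsin2 (complex.Im b); rewrite c0 s0 expr0n/= addr0 => /eqP.
by rewrite eq_sym oner_eq0.
Qed.

Definition flow (v : vfield) (s : R) p : mpoint n m :=
  (p.1 + s *: v.1,
   fun i => Ctr (expo (p.2 i))
     (mulf_neq0 (cexp_neq0 (Complex (s * complex.Re (v.2 i)) (s * complex.Im (v.2 i))))
                (coef_neq0 (p.2 i)))).

Definition dir_deriv (v : vfield) (f : mpoint n m -> R) p : R :=
  derive1 (fun s : R => f (flow v s p)) 0.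

Definition dir_derivs (vs : seq vfield) (f : mpoint n m -> R) : mpoint n m -> R :=
  foldr dir_deriv f vs.

(* A stratum of T^m_P is the set of points with tropical part in the relative
   interior of a face of P; it is encoded by any point s of that relative
   interior.  [e_strat s f] is e_S f: the smooth monomials that do not vanish
   on S are kept and those that vanish on S are set to 0.  It is f precomposed
   with (x, z) |-> (x, z t^((s - a) / 2)), a the tropical part of z: a smooth
   monomial has tropical part 0 at (a + s) / 2 iff it does at both a and s. *)
Definition toward (s : 'rV[R]_m) p : mpoint n m :=
  (p.1, fun i => Ctr ((expo (p.2 i) + s 0 i) / 2) (coef_neq0 (p.2 i))).

Definition e_strat (s : 'rV[R]_m) (f : mpoint n m -> R) : mpoint n m -> R :=
  f \o toward s.

(* Delta_S f, the product over S in the collection of (1 - e_S), applied to f. *)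
Definition Delta (ss : seq 'rV[R]_m) (f : mpoint n m -> R) : mpoint n m -> R :=
  foldr (fun s g p => g p - e_strat s g p) f ss.

(* The closure of the stratum of s contains p. *)
Definition stratum_through P (s : 'rV[R]_m) p : Prop :=
  P s /\ forall l, smooth_monomial P l -> 0 < aff l s -> 0 < aff l (trop p).

(* f is C^{infty, _1_} on U: all derivatives D f exist, are continuous, and for
   all delta < 1 and all collections S of strata |Delta_S D f| is locally
   bounded by a multiple of w_S^delta, where w_S is a sum of absolute values of
   smooth monomials vanishing on all the strata of S.  Letting w_S depend on the
   data is harmless: up to local constants all choices are dominated by the one
   made of generators of the ideal of such monomials.  Only strata whose closure
   contains p matter near p, and those outside would force evaluating f
   outside of U. *)
Definition Cinfty1 P (U : set (mpoint n m)) (f : mpoint n m -> R) : Prop :=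
  forall (vs : seq vfield) p, U p ->
  [/\ forall v, derivable (fun s : R => dir_derivs vs f (flow v s p)) 0 1,
      forall e : R, 0 < e ->
        model_nbhs P p [set q | `|dir_derivs vs f q - dir_derivs vs f p| < e]
    & forall (delta : R) (ss : seq 'rV[R]_m), 0 < delta < 1 ->
        (forall s, s \in ss -> stratum_through P s p) ->
        exists (M : R) (ls : seq (halfspace m)),
          (forall l, l \in ls ->
             smooth_monomial P l /\ forall s, s \in ss -> 0 < aff l s) /\
          model_nbhs P p [set q | `|Delta ss (dir_derivs vs f) q|
                           <= M * (\sum_(l <- ls) cabs (mono_val l q)) `^ delta]].

(* Exploded functions on the open set U are locally f t^a z^alpha with f a
   C^*-valued C^{infty, _1_} function. *)
Definition model_efun P (U : set (mpoint n m)) (g : mpoint n m -> ctr) : Prop :=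
  forall p, U p ->
  exists (V : set (mpoint n m)) (l : halfspace m) (f : mpoint n m -> R[i]),
  [/\ model_open P V, V p, V `<=` U,
      Cinfty1 P V (fun q => complex.Re (f q)) /\ Cinfty1 P V (fun q => complex.Im (f q))
    & forall q, V q ->
        coef (g q) = f q * mono_coef l q /\ expo (g q) = aff l (trop q)].

(* phi restricts to an isomorphism from the open subset W of B onto an open
   subset of R^n x T^m_P. *)
Definition is_chart (B : exploded_space) P (W : set B) (phi : B -> mpoint n m) : Prop :=
  [/\ integral_affine_polytope P,
      open W,
      {in W &, injective phi} /\ phi @` W `<=` model P,
      (forall V, V `<=` W -> (open V <-> model_open P (phi @` V)))
    & forall V g, V `<=` W -> open V ->
        (efun V (g \o phi) <-> model_efun P (phi @` V) g)].

End Model.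

(** ** The category of exploded manifolds *)

(* The smooth part of B is required to be Hausdorff and second countable.  The
   open sets of B are the preimages of those of its smooth part, so these are
   conditions on B up to topological indistinguishability. *)
Record exploded_manifold := ExplodedManifold {
  eman :> exploded_space;
  eman_charts : forall b : eman, exists n m (P : set 'rV[R]_m) (W : set eman)
    (phi : eman -> mpoint n m), W b /\ is_chart P W phi;
  eman_countable : @second_countable eman;
  eman_hausdorff : forall (x y : eman) (U : set eman), open U -> U x -> ~ U y ->
    exists V W : set eman, [/\ open V, open W, V x, W y & V `&` W = set0] }.

Lemma emap_eq (A B : exploded_space) (f g : emap A B) : f =1 g -> f = g.
Proof.
case: f => f f1 f2; case: g => g g1 g2 /= /funext fg; subst g.
by rewrite (Prop_irrelevance f1 g1) (Prop_irrelevance f2 g2).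
Qed.

Definition emap_id (A : exploded_space) : emap A A :=
  @EMap A A id (fun x => cvg_id) (fun V g oV gV => gV).

Lemma emap_comp_cont (A B C : exploded_space) (g : emap B C) (f : emap A B) :
  continuous (g \o f).
Proof. by move=> x; apply: continuous_comp; [exact: emap_cont | exact: emap_cont]. Qed.

Lemma emap_comp_pull (A B C : exploded_space) (g : emap B C) (f : emap A B) V h :
  open V -> efun V h -> efun ((g \o f) @^-1` V) (h \o (g \o f)).
Proof.
move=> oV hV; apply: (@emap_pull _ _ f (g @^-1` V) (h \o g)).
  by apply: open_comp => // x _; exact: emap_cont.
exact: emap_pull.
Qed.

Definition emap_comp (A B C : exploded_space) (g : emap B C) (f : emap A B) : emap A C :=
  EMap (@emap_comp_cont A B C g f) (@emap_comp_pull A B C g f).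

Lemma emap_id_l (A B : exploded_space) (f : emap A B) : emap_comp (emap_id B) f = f.
Proof. exact: emap_eq. Qed.

Lemma emap_id_r (A B : exploded_space) (f : emap A B) : emap_comp f (emap_id A) = f.
Proof. exact: emap_eq. Qed.

Lemma emap_compA (A B C D : exploded_space)
    (h : emap C D) (g : emap B C) (f : emap A B) :
  emap_comp h (emap_comp g f) = emap_comp (emap_comp h g) f.
Proof. exact: emap_eq. Qed.

Definition Expl : category :=
  @Category exploded_manifold (fun A B => emap A B) (fun A => emap_id A)
    (fun A B C g f => emap_comp g f)
    (fun A B => @emap_id_l A B) (fun A B => @emap_id_r A B)
    (fun A B C D => @emap_compA A B C D).

(* An isomorphism onto the image with the topology and exploded functions
   induced from B. *)
Definition embedding (A B : exploded_space) (u : emap A B) : Prop :=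
  [/\ injective u,
      (forall U, open U -> exists2 V, open V & U = u @^-1` V)
    & forall U h (x : A), open U -> efun U h -> U x ->
        exists V g, [/\ open V, V (u x), efun V g, u @^-1` V `<=` U
                      & {in u @^-1` V, h =1 g \o u}]].

Definition open_embedding (A B : exploded_space) (u : emap A B) : Prop :=
  embedding u /\ open (range u).

Definition open_cover_by (B : Expl) (J : Type) (A : J -> Expl)
    (u : forall k, hom (A k) B) : Prop :=
  (forall k, open_embedding (u k)) /\ forall b : eman B, exists k a, (u k : emap _ _) a = b.

Definition is_point (A : Expl) : Prop := exists a : eman A, forall b : eman A, b = a.

(* x and y have the same image in the smooth part of A. *)
Definition same_smooth_part (A : exploded_space) (x y : A) : Prop :=
  forall h : A -> R, continuous h -> h x = h y.

Definition has_dim (B : exploded_space) (d : nat) : Prop :=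
  forall b : B, exists n m (P : set 'rV[R]_m) (W : set B) (phi : B -> mpoint n m),
    [/\ W b, is_chart P W phi & (n + 2 * m)%N = d].

(* Near each of its points, the subset N of B is defined by the transverse
   vanishing of real valued functions. *)
Definition locally_transverse_zero_set (B : exploded_space) (N : set B) : Prop :=
  forall b, N b ->
  exists n m (P : set 'rV[R]_m) (W : set B) (phi : B -> mpoint n m)
    (k : nat) (H : 'I_k -> mpoint n m -> R),
  [/\ W b, is_chart P W phi,
      (forall i, Cinfty1 P (phi @` W) (H i)),
      N `&` W = [set x | W x /\ forall i, H i (phi x) = 0]
    & forall x, N x -> W x -> forall c : 'I_k -> R,
        exists v : vfield n m, forall i, dir_deriv v (H i) (phi x) = c i].

(** * Stacks over exploded manifolds *)

(* A category fibred in groupoids in which morphisms and objects glue.  The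
   fibre product of objects over an open cover is described by arrows of the
   total category, all of which are cartesian. *)
Record stack := Stack {
  st_cat :> category;
  F : functor st_cat Expl;
  st_lift : forall (A : Expl) (z : st_cat) (u : hom A (F z)),
    exists (y : st_cat) (e : F y = A) (a : hom y z), fmor F a = u \c obj_cast e;
  st_cart : forall (x y z : st_cat) (a : hom x z) (b : hom y z) (u : hom (F x) (F y)),
    fmor F b \c u = fmor F a ->
    exists! c : hom x y, b \c c = a /\ fmor F c = u;
  st_glue_hom : forall (x y : st_cat) (u : hom (F x) (F y))
    (J : Type) (o : J -> st_cat) (r : forall k, hom (o k) x),
    open_cover_by (fun k => fmor F (r k)) ->
    forall b : forall k, hom (o k) y,
    (forall k, fmor F (b k) = u \c fmor F (r k)) ->
    (forall k l (w : st_cat) (p : hom w (o k)) (q : hom w (o l)),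
       is_pullback (r k) (r l) p q -> b k \c p = b l \c q) ->
    exists! c : hom x y, fmor F c = u /\ forall k, c \c r k = b k;
  (* A descent datum consists of objects o k over the U_k and, over the
     overlaps, of objects with arrows to o k and o l; [coc] is the cocycle
     condition. *)
  st_glue_ob : forall (B : Expl) (J : Type) (o : J -> st_cat)
    (u : forall k, hom (F (o k)) B),
    open_cover_by u ->
    forall (w : J -> J -> st_cat) (p : forall k l, hom (w k l) (o k))
      (q : forall k l, hom (w k l) (o l)),
    (forall k l, is_pullback (u k) (u l) (fmor F (p k l)) (fmor F (q k l))) ->
    forall coc : forall k l m (y : st_cat) (a : hom y (w k l)) (b : hom y (w l m)),
      q k l \c a = p l m \c b ->
      exists c : hom y (w k m), p k m \c c = p k l \c a /\ q k m \c c = q l m \c b,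
    exists (x : st_cat) (e : F x = B) (r : forall k, hom (o k) x),
      (forall k, obj_cast e \c fmor F (r k) = u k) /\
      (forall k l, r k \c p k l = r l \c q k l) }.

Section StackNotions.
Variable X : stack.

Definition pt (x : X) : Type := eman (F X x).

Definition on_pts (x y : X) (a : hom x y) : pt x -> pt y :=
  emap_fun (fmor (F X) a : emap _ _).

Definition is_curve (f : X) : Prop := is_point (F X f).

Definition subfamily_open (x y : X) (u : hom x y) : Prop :=
  open_embedding (fmor (F X) u : emap _ _).

Definition subfamily_transverse (x y : X) (u : hom x y) : Prop :=
  embedding (fmor (F X) u : emap _ _) /\
  locally_transverse_zero_set (range (on_pts u)).

Definition family_cover (y : X) (J : Type) (o : J -> X) (r : forall k, hom (o k) y) : Prop :=
  open_cover_by (fun k => fmor (F X) (r k)).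

(* P -> N is a G-fold cover: a locally trivial principal bundle for the given
   action of G on P. *)
Definition fold_cover (G : finGroupType) (P N : X) (al : action_on G P) (pi : hom P N) : Prop :=
  (forall g, pi \c al g = pi) /\
  forall b : pt N, exists (V : X) (w : hom V N) (s : hom V P),
    [/\ subfamily_open w, range (on_pts w) b, subfamily_open s, pi \c s = w
      & forall x : pt P, range (on_pts w) (on_pts pi x) ->
          exists! gv : G * pt V, on_pts (al gv.1) (on_pts s gv.2) = x].

Definition is_substack (U : X -> Prop) : Prop :=
  forall x : X, U x <-> forall (f : X) (c : hom f x), is_curve f -> U f.

(* x/G represents U: x -> U is a principal G-bundle, that is, for y in U the
   fibre product of x and y exists and is a G-fold cover of y.  As all arrows of
   X are cartesian, the fibre product over X is the product in X. *)
Definition represents (G : finGroupType) (x : X) (al : action_on G x) (U : X -> Prop) : Prop :=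
  U x /\ forall y, U y ->
  exists (P : X) (p : hom P x) (q : hom P y) (be : action_on G P),
    [/\ is_product p q, (forall g, p \c be g = al g \c p) & fold_cover be q].

End StackNotions.

(** * K-categories *)

Record K_category := KCategory {
  Kst : stack;
  kidx : Type;
  kchart : kidx -> Kst;
  kgrp : kidx -> finGroupType;
  kact : forall i, action_on (kgrp i) (kchart i);
  kact_faithful : forall i, injective (kact i);
  k_represents : forall i, exists U : Kst -> Prop,
    is_substack U /\ represents (kact i) U;
  kdim : kidx -> nat;
  k_has_dim : forall i, has_dim (F Kst (kchart i)) (kdim i);
  k_fibre_product : forall i j, (kdim i <= kdim j)%N ->
    exists (P : Kst) (p : hom P (kchart i)) (q : hom P (kchart j))
      (al : action_on (kgrp j) P) (be : action_on (kgrp i) P),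
    [/\ is_product p q,
        (forall g, p \c al g = p /\ q \c al g = kact j g \c q),
        (forall g, p \c be g = kact i g \c p /\ q \c be g = q),
        (exists (N : Kst) (nu : hom N (kchart i)) (pi : hom P N),
           [/\ subfamily_open nu, nu \c pi = p & fold_cover al pi])
      & (exists (N : Kst) (nu : hom N (kchart j)) (pi : hom P N),
           [/\ subfamily_transverse nu, nu \c pi = q & fold_cover be pi])];
  k_cover : forall f : Kst, is_curve f -> exists i, inhabited (hom f (kchart i));
  k_countable : countable [set: kidx];
  k_locally_finite : forall i, finite_set [set j | exists f : Kst,
    [/\ is_curve f, inhabited (hom f (kchart i)) & inhabited (hom f (kchart j))]] }.

Section OverK.
Variable K : K_category.
Local Notation X := (Kst K).

(* The families locally isomorphic to some chart. *)
Definition inK (x : X) : Prop :=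
  forall (f : X) (c : hom f x), is_curve f ->
  exists (i : kidx K) (U : X) (u : hom U x) (d : hom f U) (v : hom U (kchart i)),
    [/\ subfamily_open u, u \c d = c & subfamily_open v].

Definition Kfam : category := full inK.

Definition K_open_cover (y : Kfam) (J : Type) (o : J -> Kfam) (r : forall k, hom (o k) y) : Prop :=
  @family_cover X (sval y) J (fun k => sval (o k)) r.

Definition is_sheaf (T : presheaf Kfam) : Prop :=
  forall (y : Kfam) (J : Type) (o : J -> Kfam) (r : forall k, hom (o k) y),
  K_open_cover r ->
  forall s : forall k, T (o k),
  (forall k l (w : Kfam) (p : hom w (o k)) (q : hom w (o l)),
     is_pullback (r k) (r l) p q -> res T p (s k) = res T q (s l)) ->
  exists! t : T y, forall k, res T (r k) t = s k.

Definition patching (T : presheaf Kfam) : Prop :=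
  forall (y : Kfam) (J : Type) (o : J -> Kfam) (r : forall k, hom (o k) y),
  K_open_cover r ->
  forall th : forall k, T (o k),
  exists t : T y, forall (g : Kfam) (a : hom g y) (t' : T g),
    (forall k (w : Kfam) (p : hom w g) (q : hom w (o k)),
       is_pullback a (r k) p q -> res T p t' = res T q (th k)) ->
    res T a t = t'.

Definition invariant (T : presheaf Kfam) (G : finGroupType) (y : Kfam)
    (al : action_on G y) (t : T y) : Prop :=
  forall g, res T (al g) t = t.

Definition averaging (T : presheaf Kfam) : Prop :=
  forall (y : Kfam) (th : T y) (G : finGroupType) (al : action_on G y),
  exists t : T y, invariant al t /\
    forall (x : Kfam) (be : action_on G x) (a : hom x y),
      (forall g, a \c be g = al g \c a) ->
      invariant be (res T a th) -> res T a t = res T a th.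

(** * Weighted branched covers *)

Record wset := WSet {
  wcar :> finType;
  wmu : wcar -> rat;
  wmu_gt0 : forall i, 0 < wmu i;
  wmu_sum : \sum_i wmu i = 1;
  weqv : rel wcar;
  weqv_equiv : equivalence_rel weqv }.

Definition wset_mor (A B : wset) (h : A -> B) : Prop :=
  (forall b, \sum_(a | h a == b) wmu a = wmu b) /\
  (forall i j, weqv (h i) (h j) -> weqv i j).

Definition wset_iso (A B : wset) (h : A -> B) : Prop :=
  wset_mor h /\ exists h', [/\ wset_mor h', cancel h h' & cancel h' h].

(* Families parametrized by an empty space are not counted as connected. *)
Definition connected_family (x : X) : Prop :=
  [set: eman (F X x)] !=set0 /\ connected [set: eman (F X x)].

Record weighted_branched_cover := WeightedBranchedCover {
  bdom : X -> Prop;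
  bdom_connected : forall x, bdom x -> connected_family x;
  bdom_closed : forall x y (a : hom x y), bdom y -> connected_family x -> bdom x;
  bdom_cover : forall y : X, inK y ->
    exists (J : Type) (o : J -> X) (r : forall k, hom (o k) y),
      family_cover r /\ forall k, bdom (o k);
  bset :> full bdom -> wset;
  bres : forall x y : full bdom, hom x y -> bset y -> bset x;
  bres_mor : forall (x y : full bdom) (a : hom x y), wset_mor (bres a);
  bres_id : forall (x : full bdom) i, bres (idm x) i = i;
  bres_cmp : forall (x y z : full bdom) (b : hom y z) (a : hom x y) i,
    bres (b \c a) i = bres a (bres b i);
  b_local : forall (f x : full bdom) (c : hom f x), is_curve (sval f) ->
    exists (U : full bdom) (u : hom U x) (d : hom f U),
      [/\ @subfamily_open X (sval U) (sval x) u, u \c d = c & wset_iso (bres d)] }.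

Section Branched.
Variable I : weighted_branched_cover.

(* i and j are separated at the curve f in x. *)
Definition separated (f x : full (bdom I)) (c : hom f x) (i j : I x) : Prop :=
  ~~ weqv (bres c i) (bres c j).

Definition trivial_stabilizers : Prop :=
  forall (x : full (bdom I)) (psi psi' : hom x x), inK (sval x) ->
  psi \c psi' = idm x -> psi' \c psi = idm x -> psi <> idm x ->
  forall (f : full (bdom I)) (c : hom f x), is_curve (sval f) ->
  (forall a : @pt X (sval f), same_smooth_part
     (@on_pts X (sval x) (sval x) psi (@on_pts X (sval f) (sval x) c a))
     (@on_pts X (sval f) (sval x) c a)) ->
  forall i : I x, separated c i (bres psi i).

Definition bK : category := full (fun x : X => bdom I x /\ inK x).

Definition bK_dom (O : bK) : full (bdom I) :=
  exist _ (sval O) (proj1 (svalP O)).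

Definition bK_fam (O : bK) : Kfam := exist _ (sval O) (proj2 (svalP O)).

Variable S : presheaf Kfam.

(* The elements of S^I(y): an object of O_{I,y} is a pair of O in [bK] and a
   morphism a from O to y. *)
Record branched_section (y : Kfam) := BranchedSection {
  bsec : forall (O : bK) (a : @hom X (sval O) (sval y)), I (bK_dom O) -> S (bK_fam O);
  bsec_nat : forall (O O' : bK) (h : hom O O')
    (a : @hom X (sval O) (sval y)) (a' : @hom X (sval O') (sval y)),
    a' \c h = a -> forall i : I (bK_dom O'),
    bsec a (@bres I (bK_dom O) (bK_dom O') h i) =
    @res _ S (bK_fam O) (bK_fam O') h (bsec a' i);
  bsec_sep : forall (O : bK) (a : @hom X (sval O) (sval y))
    (f : full (bdom I)) (c : hom f (bK_dom O)) (i j : I (bK_dom O)),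
    is_curve (sval f) -> ~ separated c i j ->
    exists (U : Kfam) (u : hom U (bK_fam O)) (d : @hom X (sval f) (sval U)),
      [/\ @subfamily_open X (sval U) (sval O) u, (u : @hom X _ _) \c d = c
        & res S u (bsec a i) = res S u (bsec a j)] }.

Lemma branched_section_eq y (nu nu' : branched_section y) :
  (forall (O : bK) (a : @hom X (sval O) (sval y)) i, bsec nu a i = bsec nu' a i) ->
  nu = nu'.
Proof.
case: nu => b b1 b2; case: nu' => b' b1' b2' /= bb'.
have {}bb' : b = b'.
  by apply: functional_extensionality_dep => O; apply: funext => a;
     apply: funext => i; exact: bb'.
by subst b'; rewrite (Prop_irrelevance b1 b1') (Prop_irrelevance b2 b2').
Qed.

Section Pull.
Variables (x y : Kfam) (u : hom x y) (nu : branched_section y).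

Let psec (O : bK) (a : @hom X (sval O) (sval x)) : I (bK_dom O) -> S (bK_fam O) :=
  bsec nu ((u : @hom X _ _) \c a).

Lemma branched_pull_nat (O O' : bK) (h : hom O O')
    (a : @hom X (sval O) (sval x)) (a' : @hom X (sval O') (sval x)) :
  a' \c h = a -> forall i : I (bK_dom O'),
  psec a (@bres I (bK_dom O) (bK_dom O') h i) =
  @res _ S (bK_fam O) (bK_fam O') h (psec a' i).
Proof. by move=> e i; apply: bsec_nat; rewrite -e cmp_assoc. Qed.

Definition branched_pull : branched_section x :=
  BranchedSection branched_pull_nat
    (fun O a => bsec_sep nu ((u : @hom X _ _) \c a)).

End Pull.

Lemma branched_pull_id y (nu : branched_section y) : branched_pull (idm y) nu = nu.
Proof. by apply: branched_section_eq => O a i /=; rewrite cmp_id_l. Qed.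

Lemma branched_pull_cmp x y z (v : hom y z) (u : hom x y) (nu : branched_section z) :
  branched_pull (v \c u) nu = branched_pull u (branched_pull v nu).
Proof. by apply: branched_section_eq => O a i /=; rewrite -cmp_assoc. Qed.

(* The functor S^I. *)
Definition branched_sections : presheaf Kfam :=
  Presheaf branched_pull_id branched_pull_cmp.

End Branched.
End OverK.
End Exploded.

(* Main.v *)
From HB Require Import structures.
From mathcomp Require Import all_boot all_order all_algebra all_fingroup.
From mathcomp Require Import all_classical all_reals all_analysis.
From mathcomp Require Import complex ring lra.
Require Import Defs.

(* A section of S^I over y is a compatible system of sections of S indexed by the
   branches i of I over the objects of O_I over y.  Both axioms follow from one
   equivariant statement: G acts on y, local sections with a prescribed property
   exist, and a G-invariant global one is wanted.  Averaging a section theta is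
   patching the sections g^* theta, g in G, each defined over all of y.

   Exploded manifolds are regular, because R^n x T^m_P is locally compact, and
   second countable.  Hence a sheaf on y is globally soft, and so has a global
   section, as soon as it is locally soft; this is applied to the sheaf of
   invariant sections, on the topology of G-invariant open sets.

   Locally, choose a connected neighbourhood u of a point, which each element of G
   preserves or moves off itself, such that equivalence of branches over u means
   equivalence at the centre.  Trivial stabilizers make G act freely on the
   branches over u, so one section per orbit of branches has to be chosen.  The
   section of a branch i is extended by the Patching Axiom of S from a
   neighbourhood of the closed sets where it is prescribed: the one where the
   section is already given, and those where i is equivalent to a branch treated
   before. *)

Set Implicit Arguments.
Unset Strict Implicit.
Unset Printing Implicit Defensive.

Import Order.TTheory GRing.Theory Num.Theory numFieldNormedType.Exports.

Local Open Scope classical_set_scope.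
Local Open Scope ring_scope.

(** * Separation in regular second countable spaces *)

(** [S] comes without partitions of unity: Patching is its only means of extension, and softness is
    the form in which that can be used locally. Both axioms constrain pullbacks along arbitrary maps
    into y, not only restrictions to open sets. So a section is recorded by its values on all
    connected objects over y, and the prescribed pullbacks form a relation [compat] that local and
    global sections alike obey.

    Patching has no equivariance, so comparing a branch with its own translates would impose a
    condition that it cannot meet. Freeness removes it: branches of one orbit that are equivalent
    somewhere come from the same automorphism of u, so a section chosen for one representative is
    transported to the orbit at will. Only comparisons with earlier orbits remain; equivalence at a
    point is a closed condition, so these prescribe germs along closed sets.

    Exploded manifolds need not be Hausdorff: distinct points may lie in the same open sets. Hence
    regularity is used without any separation of points, and stabilizers of points are taken up to
    indistinguishability. *)

Section Separation.
Variable T : topologicalType.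
Implicit Types A B C U V : set T.

Lemma second_countable_seq : @second_countable T ->
  exists b : nat -> set T, (forall n, open (b n)) /\
    forall x U, open U -> U x -> exists n, b n x /\ b n `<=` U.
Proof.
case=> B /countable_injP[f finj] [Bo Bb].
exists (fun n x => exists W, [/\ B W, f W = n & W x]); split=> [n|x U oU Ux].
  rewrite [X in open X](_ : _ = \bigcup_(W in [set W | B W /\ f W = n]) W).
    by apply: bigcup_open => W [/Bo].
  by apply/seteqP; split=> x [W]; [case=> ? ? ?; exists W | case=> ? ? ?; exists W].
have [W [BW Wx] WU] := Bb x U (open_nbhs_nbhs (conj oU Ux)).
exists (f W); split=> [|z [W' [BW' fW W'z]]]; first by exists W.
by apply: WU; rewrite -(finj W' W)// inE.
Qed.

Lemma open_avoid_closures (F : nat -> set T) n :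
  open [set x | forall k, (k <= n)%N -> ~ closure (F k) x].
Proof.
elim: n => [|n ih].
  rewrite [X in open X](_ : _ = ~` closure (F 0%N)); first exact/closed_openC/closed_closure.
  by apply/seteqP; split=> x /= h; [exact: h | move=> k; rewrite leqn0 => /eqP ->].
rewrite [X in open X](_ : _ = [set x | forall k, (k <= n)%N -> ~ closure (F k) x]
                       `&` ~` closure (F n.+1)).
  by apply: openI => //; exact/closed_openC/closed_closure.
apply/seteqP; split=> x /= h.
  by split=> [k kn|]; apply: h => //; exact: leqW.
move=> k; rewrite leq_eqVlt ltnS => /orP[/eqP ->|]; first exact: h.2.
exact: h.1.
Qed.

Hypotheses (Treg : regular_space T) (Tcount : @second_countable T).

Lemma regular_shrink x U : open U -> U x ->
  exists N, [/\ open N, N x & closure N `<=` U].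
Proof.
move=> oU Ux; have [N /= Nx NU] := Treg (open_nbhs_nbhs (conj oU Ux)).
exists (interior N); split; [exact: open_interior| exact: Nx |].
exact: subset_trans (closure_subset (@interior_subset _ N)) NU.
Qed.

(** Tychonoff's argument: regularity covers A by countably many basic open sets whose closures miss
    B, and B likewise; from each set the closures of the opposite sets of no larger index are
    removed. *)
Lemma separated_sets A B :
  (forall x, A x -> ~ closure B x) -> (forall x, B x -> ~ closure A x) ->
  exists P Q, [/\ open P, open Q, A `<=` P, B `<=` Q & P `&` Q = set0].
Proof.
move=> AB BA; have [b [bo bP]] := second_countable_seq Tcount.
pose V C n : set T := [set x | b n x /\ closure (b n) `&` C = set0].
have Vb C n : V C n `<=` b n by move=> x [].
have Vo C n : open (V C n).
  have [e|ne] := pselect (closure (b n) `&` C = set0).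
    by rewrite (_ : V C n = b n)//; apply/seteqP; split=> x; [case | split].
  by rewrite (_ : V C n = set0); [exact: open0 | apply/seteqP; split=> x // -[]].
have Vcl C n x : C x -> ~ closure (V C n) x.
  move=> Cx clx; have [y [[_ e] _]] := clx setT filterT.
  by rewrite -[False]/(set0 x) -e; split=> //; exact: closure_subset clx.
have Vcov C D : (forall x, D x -> ~ closure C x) ->
    forall x, D x -> exists n, V C n x.
  move=> DC x Dx.
  have oC : open (~` closure C) by exact/closed_openC/closed_closure.
  have [N [oN Nx NC]] := regular_shrink oC (DC _ Dx).
  have [n [bnx bnN]] := bP x N oN Nx; exists n; split=> //.
  apply/seteqP; split=> z // -[cz Cz].
  exact: (NC z (closure_subset bnN cz) (subset_closure Cz)).
pose W C D : set T :=
  \bigcup_n (V C n `&` [set x | forall k, (k <= n)%N -> ~ closure (V D k) x]).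
have Wo C D : open (W C D).
  by apply: bigcup_open => n _; apply: openI => //; exact: open_avoid_closures.
exists (W B A), (W A B); split=> //.
- move=> x Ax; have [n Vx] := Vcov _ _ AB x Ax.
  by exists n => //; split=> // k _; exact: Vcl.
- move=> x Bx; have [n Vx] := Vcov _ _ BA x Bx.
  by exists n => //; split=> // k _; exact: Vcl.
apply/seteqP; split=> x // -[[n _ [Vn hn]] [m _ [Vm hm]]].
by have [nm|/ltnW mn] := leqP n m;
  [apply: (hm n nm) | apply: (hn m mn)]; exact: subset_closure.
Qed.

Lemma closed_shrink C A : closed C -> open A -> C `<=` A ->
  exists N, [/\ open N, C `<=` N & closure N `<=` A].
Proof.
move=> cC oA CA.
have [x Cx|x nAx|P [Q [oP oQ CP AQ PQ]]] := @separated_sets C (~` A).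
- by rewrite -(iffLR (closure_id _) (open_closedC oA)) => /(_ (CA x Cx)).
- by rewrite -(iffLR (closure_id _) cC) => /CA.
exists P; split=> // x; apply: contraPP => nAx /(_ Q) h.
have [|z [Pz Qz]] := h (open_nbhs_nbhs _); first by split=> //; exact: AQ.
by rewrite -[False]/(set0 z) -PQ.
Qed.

End Separation.

(** * Gluing sections over a topological space *)

(* A sheaf, with its sections over all open sets put in one type: [on V s] says
   that s is defined over V, [agr V s s'] that the restrictions to V agree. *)
Record section_system (T : topologicalType) := SectionSystem {
  sect :> Type;
  on : set T -> sect -> Prop;
  agr : set T -> sect -> sect -> Prop;
  on_sub : forall U V s, V `<=` U -> on U s -> on V s;
  agr_sub : forall U V s t, V `<=` U -> agr U s t -> agr V s t;
  agr_refl : forall V s, agr V s s;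
  agr_sym : forall V s t, agr V s t -> agr V t s;
  agr_trans : forall V s t u, agr V s t -> agr V t u -> agr V s u;
  agr_loc : forall (J : Type) (V : J -> set T) s t,
    (forall k, open (V k)) -> 
    on (\bigcup_k V k) s -> on (\bigcup_k V k) t ->
    (forall k, agr (V k) s t) -> agr (\bigcup_k V k) s t;
  on_glue : forall (J : Type) (V : J -> set T) (s : J -> sect),
    (forall k, open (V k)) -> (forall k, on (V k) (s k)) ->
    (forall k l, agr (V k `&` V l) (s k) (s l)) ->
    exists t, on (\bigcup_k V k) t /\ forall k, agr (V k) (s k) t }.

Arguments on {T _} _ _.
Arguments agr {T _} _ _ _.

Section Gluing.
Variables (T : topologicalType) (E : section_system T).
Hypotheses (Treg : regular_space T) (Tcount : @second_countable T).
Implicit Types (A B C U V N : set T) (s t : E).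

Lemma on_set0 : exists s, on set0 s.
Proof.
have [|||s [son _]] := @on_glue T E void (fun _ => set0) (of_void E); do ?by case.
by exists s; apply: on_sub son => x [].
Qed.

Lemma on_glue2 A B s t : open A -> open B -> on A s -> on B t ->
  agr (A `&` B) s t ->
  exists u, [/\ on (A `|` B) u, agr A s u & agr B t u].
Proof.
move=> oA oB sA tB st.
pose V (b : bool) := if b then A else B.
pose w (b : bool) := if b then s else t.
have [||[] []|u [uV ust]] := @on_glue T E bool V w.
- by case.
- by case.
- exact: agr_refl.
- exact: st.
- by apply: agr_sym; rewrite setIC.
- exact: agr_refl.
exists u; split; [|exact: (ust true)|exact: (ust false)].
by apply: on_sub uV => x [Ax|Bx]; [exists true | exists false].
Qed.

(** Germs along C extend over U. Both C and A live in the whole space, so for a proper U this is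
    weaker than softness of U as a space; it is what the induction in [soft_section] uses. *)
Definition soft_on U := open U /\ forall C A s,
  closed C -> open A -> C `<=` A -> on (A `&` U) s ->
  exists t N, [/\ open N, C `&` U `<=` N, N `<=` A `&` U, on U t & agr N s t].

(** Enumerate the basic open sets whose closure lies in a soft open set, and extend over one closure
    at a time. Each extension keeps the section near the closures already treated, so the section
    over [B n] is eventually constant and the stages glue. *)
Lemma soft_section : (forall x, exists2 U, U x & soft_on U) ->
  exists s, on setT s.
Proof.
move=> Esoft; have [b [bo bP]] := second_countable_seq Tcount.
pose good n := exists2 U, closure (b n) `<=` U & soft_on U.
pose B n : set T := [set x | b n x /\ good n].
have Bcl n : good n -> B n = b n.
  by move=> g; apply/seteqP; split=> x; [case | split].
have Bo n : open (B n).
  have [/Bcl -> //|ng] := pselect (good n).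
  by rewrite (_ : B n = set0); [exact: open0 | apply/seteqP; split=> x // -[]].
pose K n : set T := [set x | exists2 k, (k < n)%N & closure (B k) x].
have KS n : K n.+1 = K n `|` closure (B n).
  apply/seteqP; split=> x.
    case=> k; rewrite ltnS leq_eqVlt => /orP[/eqP ->|kn] ?; first by right.
    by left; exists k.
  by case=> [[k kn ?]|?]; [exists k => //; exact: ltnW | exists n].
have Kcl n : closed (K n).
  elim: n => [|n ih]; last by rewrite KS; apply: closedU => //; exact: closed_closure.
  by rewrite (_ : K 0%N = set0); [exact: closed0 | apply/seteqP; split=> x // -[]].
pose st := {p : nat * set T * E |
  [/\ open p.1.2, K p.1.1 `<=` p.1.2 & on p.1.2 p.2]}.
pose next (x y : st) := (sval y).1.1 = (sval x).1.1.+1 /\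
  exists A, [/\ open A, K (sval x).1.1 `<=` A & agr A (sval x).2 (sval y).2 /\
    A `<=` (sval x).1.2 `&` (sval y).1.2].
have step x : {y | next x y}.
  apply: cid; case: x => -[[n A] s] /= [oA KA sA].
  have [g|ng] := pselect (good n); last first.
    have KA' : K n.+1 `<=` A.
      rewrite KS => x [/KA //|]; rewrite (_ : B n = set0) ?closure0//.
      by apply/seteqP; split=> z // -[].
    exists (exist _ (n.+1, A, s) (And3 oA KA' sA)); split=> //=.
    by exists A; split=> //; split; [exact: agr_refl |].
  have [U bU [oU Usoft]] := g.
  (* Softness preserves the section only near a closed set, so the domain is first shrunk to [A']
     with closure in [A]; on [A'] the old and new sections then agree. *)
  have [A' [oA' KA' A'A]] := closed_shrink Treg Tcount (Kcl n) oA KA.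
  have [|t [N [oN CN NA tU stN]]] :=
    Usoft (closure A') A s (@closed_closure T A') oA A'A.
    by apply: on_sub sA; exact: subIsetl.
  have [|||v [von sv tv]] := on_glue2 (A := A') (B := U) (s := s) (t := t) oA' oU.
  - by apply: on_sub sA; exact: subset_trans (@subset_closure _ _) A'A.
  - by [].
  - apply: agr_sub stN => x [A'x Ux]; apply: CN; split=> //.
    exact: subset_closure.
  have Kv : K n.+1 `<=` A' `|` U.
    by rewrite KS Bcl// => x [/KA'|/bU]; [left|right].
  exists (exist _ (n.+1, A' `|` U, v) (And3 (openU oA' oU) Kv von)); split=> //=.
  exists A'; split=> //; split=> // x A'x; split; last by left.
  exact/A'A/subset_closure.
have [s0 s00] := on_set0.
have st0 : [/\ @open T set0, K 0%N `<=` set0 & on set0 s0].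
  by split; [exact: open0 | move=> x [] |].
have [f [f0 fS]] := dependent_choice step (exist _ (0%N, set0, s0) st0).
have fn n : (sval (f n)).1.1 = n.
  by elim: n => [|n ih]; [rewrite f0 | rewrite (fS n).1 ih].
have agrf n m : (n < m)%N -> agr (B n) (sval (f n.+1)).2 (sval (f m)).2.
  elim: m => // m ih; rewrite ltnS leq_eqVlt => /orP[/eqP ->|nm].
    exact: agr_refl.
  apply: agr_trans (ih nm) _.
  have [_ [A [_ KA [stA _]]]] := fS m; apply: agr_sub stA => x Bx.
  by apply: KA; rewrite fn; exists n => //; exact: subset_closure.
have onB n : on (B n) (sval (f n.+1)).2.
  have := svalP (f n.+1); rewrite fn => -[_ KA fon].
  by apply: on_sub fon => x Bx; apply: KA; exists n => //; exact: subset_closure.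
(* Stage n covers the closures of [B k] for k < n, so [n.+1] is the first stage defined on [B n]. *)
have [||n m|s [son _]] := @on_glue T E nat B (fun n => (sval (f n.+1)).2).
- by [].
- by [].
- have [nm|mn] := leqP n m.
    by apply: agr_sub (agrf n m.+1 nm) => x [].
  by apply/agr_sym; apply: agr_sub (agrf m n.+1 (ltnW mn)) => x [].
exists s; apply: on_sub son => x _.
have [U Ux sU] := Esoft x.
have [N [oN Nx NU]] := regular_shrink Treg sU.1 Ux.
have [n [bnx bnN]] := bP x N oN Nx.
by exists n => //; split=> //; exists U => // z /(closure_subset bnN) /NU.
Qed.

(** Let [E0] be the largest open set known to carry agreement. Outside it C and D are disjoint
    closed sets; separating these there leaves domains that overlap only inside [E0]. *)
Lemma glue_closed2 C D A B s t :
  closed C -> closed D -> open A -> open B -> C `<=` A -> D `<=` B ->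
  on A s -> on B t ->
  (forall x, C x -> D x -> exists V, [/\ open V, V x & agr V s t]) ->
  exists u N M, [/\ open N, open M, C `<=` N /\ N `<=` A, D `<=` M /\ M `<=` B
    & on (N `|` M) u /\ agr N s u /\ agr M t u].
Proof.
move=> cC cD oA oB CA DB sA tB CD.
pose J := {V : set T | [/\ open V, V `<=` A `&` B & agr V s t]}.
pose E0 := \bigcup_(V : J) sval V.
have oE : open E0 by apply: bigcup_open => V _; have [] := svalP V.
have EAB : E0 `<=` A `&` B by move=> x [V _]; have [_ + _] := svalP V; exact.
have Est : agr E0 s t.
  apply: agr_loc.
  - by move=> V; have [] := svalP V.
  - by apply: on_sub sA => x /EAB[].
  - by apply: on_sub tB => x /EAB[].
  - by move=> V; have [] := svalP V.
have CDE x : C x -> D x -> E0 x.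
  move=> Cx Dx; have [V [oV Vx Vst]] := CD x Cx Dx.
  have h : [/\ open (V `&` (A `&` B)), V `&` (A `&` B) `<=` A `&` B &
      agr (V `&` (A `&` B)) s t].
    split; [by apply: openI => //; apply: openI | by move=> z [] |].
    by apply: agr_sub Vst => z [].
  by exists (exist _ (V `&` (A `&` B)) h) => //=; split=> //; split; auto.
have cE : closed (~` E0) by exact: open_closedC.
have [||x [Cx nEx] [Dx _]|P [oP CP PD]] :=
    @closed_shrink T Treg Tcount (C `&` ~` E0) (~` (D `&` ~` E0)).
- exact: closedI.
- by apply: closed_openC; exact: closedI.
- exact/nEx/CDE.
have oQ : open (~` closure P) by exact/closed_openC/closed_closure.
have [|||||u [uon su tu]] := on_glue2 (A := (P `&` A) `|` E0)
    (B := (~` closure P `&` B) `|` E0) (s := s) (t := t).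
- by apply: openU => //; exact: openI.
- by apply: openU => //; exact: openI.
- by apply: on_sub sA => x [[]|/EAB[]].
- by apply: on_sub tB => x [[]|/EAB[]].
- apply: agr_sub Est => x [] [[Px _]|//] [[nPx _]|//].
  by case: nPx; exact: subset_closure.
exists u, ((P `&` A) `|` E0), ((~` closure P `&` B) `|` E0); split=> //.
- by apply: openU => //; exact: openI.
- by apply: openU => //; exact: openI.
- split=> [x Cx|x [[]|/EAB[]]//].
  have [Ex|nEx] := pselect (E0 x); first by right.
  by left; split; [exact: CP | exact: CA].
- split=> [x Dx|x [[]|/EAB[]]//].
  have [Ex|nEx] := pselect (E0 x); first by right.
  by left; split; [move=> /PD; exact | exact: DB].
Qed.

(** The closed sets are added one by one with [glue_closed2], which yields a section near their
    union; a single use of softness makes it global. *)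
Lemma soft_extend_closed (J : finType) (C A : J -> set T) (s : J -> E) :
  (forall j, [/\ closed (C j), open (A j), C j `<=` A j & on (A j) (s j)]) ->
  (forall i j x, C i x -> C j x -> exists V, [/\ open V, V x & agr V (s i) (s j)]) ->
  soft_on setT ->
  exists u, on setT u /\
    forall j, exists N, [/\ open N, C j `<=` N & agr N (s j) u].
Proof.
move=> h hst [_ Esoft].
have [W [u [oW Wu uW]]] : exists W u, [/\ open W, on W u
    & forall j, j \in enum J -> exists N,
      [/\ open N, C j `<=` N, N `<=` W & agr N (s j) u]].
  elim: (enum J) => [|j l [W [u [oW Wu uW]]]].
    by have [s0 s00] := on_set0; exists set0, s0; split; [exact: open0 | |].
  pose D := \bigcup_(i in [set i | i \in l]) C i.
  have cD : closed D.
    apply: closed_bigcup => [|i _]; last by have [] := h i.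
    exact: finite_finset.
  have DW : D `<=` W.
    by move=> x [i /= il Cix]; have [N [_ CN NW _]] := uW i il; exact/NW/CN.
  have [cC oA CA sA] := h j.
  have [|v [N [M [oN oM [CN NA] [DM MW] [von [sv uv]]]]]] :=
      glue_closed2 cC cD oA oW CA DW sA Wu.
    move=> x Cx [i /= il Cix]; have [V [oV Vx Vst]] := hst _ _ _ Cx Cix.
    have [N [oN CN NW su]] := uW i il.
    exists (V `&` N); split; [exact: openI | by split=> //; exact: CN |].
    by apply: (agr_trans (t := s i)); [apply: agr_sub Vst => z [] | apply: agr_sub su => z []].
  exists (N `|` M), v; split=> //; first exact: openU.
  move=> i; rewrite inE => /orP[/eqP ->|il].
    by exists N; split=> // x; left.
  have [N' [oN' CN' N'W su]] := uW i il.
  exists (N' `&` M); split.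
  - exact: openI.
  - by move=> x Cx; split; [exact: CN' | apply: DM; exists i].
  - by move=> x []; right.
  - by apply: (agr_trans (t := u)); [apply: agr_sub su => z [] | apply: agr_sub uv => z []].
have [|||t [N [oN DN _ tT ut]]] := Esoft (\bigcup_(i in [set: J]) C i) W u _ oW.
- apply: closed_bigcup => [|i _]; last by have [] := h i.
  exact: finite_finset.
- by move=> x [i _ Cix]; have [|M [_ CM MW _]] := uW i; [rewrite mem_enum | exact/MW/CM].
- by rewrite setIT.
exists t; split=> // j; have [|M [oM CM MW su]] := uW j; first by rewrite mem_enum.
exists (M `&` N); split.
- exact: openI.
- by move=> x Cx; split; [exact: CM | apply: DN; split=> //; exists j].
- by apply: (agr_trans (t := u)); [apply: agr_sub su => z [] | apply: agr_sub ut => z []].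
Qed.

End Gluing.

(** * Local compactness of R^n x T^m_P *)

Section ComplexExponential.
Variable R : realType.
Implicit Types (x y : R) (z : R[i]).

Lemma complexM (a b c d : R) :
  Complex a b * Complex c d = Complex (a * c - b * d) (a * d + b * c).
Proof. by []. Qed.

Lemma cexpD x y x' y' : cexp (Complex (x + x') (y + y')) =
  cexp (Complex x y) * cexp (Complex x' y') :> R[i].
Proof.
rewrite /cexp /= expRD cosD sinD complexM; congr Complex; ring.
Qed.

Lemma cexp0 : cexp (Complex 0 0) = 1 :> R[i].
Proof. by rewrite /cexp/= expR0 cos0 sin0 mulr1 mulr0. Qed.

Lemma cabs_cexp x y : cabs (cexp (Complex x y) : R[i]) = expR x.
Proof.
rewrite /cabs /cexp /= !exprMn -mulrDr cos2Dsin2 mulr1 sqrtr_sqr ger0_norm// expR_ge0.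
Qed.

Lemma cexpX x y (k : nat) :
  cexp (Complex x y) ^+ k = cexp (Complex (k%:R * x) (k%:R * y)) :> R[i].
Proof.
elim: k => [|k ih]; first by rewrite expr0 !mul0r cexp0.
by rewrite exprS ih -cexpD -natr1 !mulrDl !mul1r (addrC x) (addrC y).
Qed.

Lemma cexpXz x y (k : int) :
  cexp (Complex x y) ^ k = cexp (Complex (k%:~R * x) (k%:~R * y)) :> R[i].
Proof.
case: k => k; first exact: cexpX.
have -> : cexp (Complex x y) ^ (Negz k) = (cexp (Complex x y) ^+ k.+1)^-1 by [].
rewrite cexpX NegzE; apply: (mulfI (cexp_neq0 (Complex (k.+1%:R * x) (k.+1%:R * y)))).
by rewrite divff ?cexp_neq0// -cexpD mulrNz -pmulrn !mulNr !subrr cexp0.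
Qed.

(** The argument is kept in a bounded interval so that it converges along every ultrafilter; only
    the modulus can then degenerate. *)
Lemma cexp_surj z : z != 0 ->
  exists x y, [/\ z = cexp (Complex x y) & `|y| <= pi].
Proof.
move=> z0; pose r := Num.sqrt (complex.Re z ^+ 2 + complex.Im z ^+ 2).
have s0 : 0 < complex.Re z ^+ 2 + complex.Im z ^+ 2.
  rewrite lt_neqAle addr_ge0 ?sqr_ge0// andbT eq_sym paddr_eq0 ?sqr_ge0//.
  rewrite !sqrf_eq0; apply: contra z0 => /andP[/eqP a /eqP b].
  by case: z a b {r} => a b /= -> ->.
have r0 : 0 < r by rewrite sqrtr_gt0.
have r2 : r ^+ 2 = complex.Re z ^+ 2 + complex.Im z ^+ 2 by rewrite sqr_sqrtr// ltW.
pose c := complex.Re z / r; pose s := complex.Im z / r.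
have cs : c ^+ 2 + s ^+ 2 = 1.
  by rewrite !exprMn -mulrDl -r2 exprVn divff// sqrf_eq0 gt_eqF.
have c1 : -1 <= c <= 1.
  have c2 : c ^+ 2 <= 1 by rewrite -cs lerDl sqr_ge0.
  by apply/andP; split; nra.
have sq : Num.sqrt (1 - c ^+ 2) = `|s| by rewrite -cs addrAC subrr add0r sqrtr_sqr.
have [a0 ac] := acos_def c1; move/andP: a0 => [a0 api].
have rexp : expR (ln r) = r by rewrite lnK.
have zE : z = Complex (r * c) (r * s).
  by rewrite /c /s !(mulrCA r) divff ?gt_eqF// !mulr1; case: (z).
have [s0'|s0'] := leP 0 s.
  exists (ln r), (acos c); split; last by rewrite ger0_norm.
  by rewrite zE /cexp /= rexp ac sin_acos// sq ger0_norm.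
exists (ln r), (- acos c); split; last by rewrite normrN ger0_norm.
by rewrite zE /cexp /= rexp cosN sinN ac sin_acos// sq ltr0_norm// opprK.
Qed.

Lemma cabs_le z : cabs z <= `|complex.Re z| + `|complex.Im z|.
Proof.
rewrite /cabs -[leRHS]ger0_norm ?addr_ge0// -sqrtr_sqr ler_sqrt ?sqr_ge0//.
by rewrite sqrrD !real_normK ?num_real// addrAC lerDl mulrn_wge0// mulr_ge0.
Qed.

End ComplexExponential.

(** * Limits of bounded functions along ultrafilters *)

Section UltrafilterLimits.
Variables (R : realType) (T : Type) (F : set_system T).

Lemma filter_all (FF : Filter F) (J : eqType) (s : seq J) (A : J -> set T) :
  (forall j, j \in s -> F (A j)) -> F [set t | forall j, j \in s -> A j t].
Proof.
elim: s => [|j s ih] h; first by apply: filterE => t j; rewrite in_nil.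
have h1 := h j (mem_head _ _).
have h2 := ih (fun k ks => h k (mem_behead (s := j :: s) ks)).
apply: filterS (filterI h1 h2) => t [At Ast] k; rewrite inE => /orP[/eqP ->//|].
exact: Ast.
Qed.

Lemma ultra_bounded_cvg (FU : UltraFilter F) (f : T -> R) (M : R) :
  F [set t | `|f t| <= M] -> exists2 l, `|l| <= M & f @ F --> l.
Proof.
move=> FM.
have FfF : ProperFilter (f @ F) by exact: fmap_proper_filter.
have [|l [lM lcl]] := @segment_compact R (- M) M (f @ F) FfF.
  have : F (f @^-1` `[- M, M]) by apply: filterS FM => t /=; rewrite in_itv/= -ler_norml.
  by [].
exists l; first by move: lM; rewrite /= in_itv/= ler_norml.
move=> V Vl; have [//|nV] := in_ultra_setVsetC (f @^-1` V) FU.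
by have [x [nVx Vx]] := lcl (~` V) V nV Vl.
Qed.

Lemma ultra_bounded_cvg_fin (FU : UltraFilter F) k (f : T -> 'I_k -> R) (M : R) :
  F [set t | forall i, `|f t i| <= M] ->
  exists l : 'I_k -> R, (forall i, `|l i| <= M) /\ forall i, (fun t => f t i) @ F --> l i.
Proof.
move=> FM; have /choice[l lP] i : exists x, `|x| <= M /\ (fun t => f t i) @ F --> x.
  have [|x ? ?] := @ultra_bounded_cvg FU (fun t => f t i) M; last by exists x.
  by apply: filterS FM => t; exact.
by exists l; split=> i; have [] := lP i.
Qed.

End UltrafilterLimits.

(** * Directions at a point of a polytope, and monomials that are nonnegative on it *)

Section Polytope.
Variables (R : realType) (m : nat).
Implicit Types (l : halfspace R m) (v d w : 'rV[R]_m) (hs : seq (halfspace R m * bool)).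

Definition dot l v : R := \sum_(i < m) (l.1 i)%:~R * v 0 i.

Lemma affD l v d : aff l (v + d) = aff l v + dot l d.
Proof.
rewrite /aff /dot -addrA -big_split/=; congr (_ + _); apply: eq_bigr => i _.
by rewrite mxE mulrDr.
Qed.

Lemma dotD l v d : dot l (v + d) = dot l v + dot l d.
Proof. by rewrite /dot -big_split; apply: eq_bigr => i _; rewrite mxE mulrDr. Qed.

Lemma dotZ l c v : dot l (c *: v) = c * dot l v.
Proof. by rewrite /dot mulr_sumr; apply: eq_bigr => i _; rewrite mxE mulrCA. Qed.

Lemma dotN l v : dot l (- v) = - dot l v.
Proof. by rewrite -scaleN1r dotZ mulN1r. Qed.

Lemma dotB l v d : dot l (v - d) = dot l v - dot l d.
Proof. by rewrite dotD dotN. Qed.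

Lemma small_perturbation (J : eqType) (s : seq J) (a b : J -> R) :
  (forall j, j \in s -> 0 < a j) ->
  exists2 e, 0 < e & forall j, j \in s -> 0 < a j + e * b j.
Proof.
elim: s => [|j s ih] h; first by exists 1.
have [e e0 he] := ih (fun k ks => h k (mem_behead (s := j :: s) ks)).
have aj := h j (mem_head _ _).
(* The second bound makes e times the modulus of [b j] less than [a j]; the 1 avoids a zero
   denominator. Lowering e keeps the earlier inequalities, each being affine in e and positive at
   0. *)
exists (Num.min e (a j / (2 * (`|b j| + 1)))).
  by rewrite lt_min e0/= divr_gt0// mulr_gt0// ltr_wpDl.
set f := Num.min _ _.
have f0 : 0 < f by rewrite lt_min e0/= divr_gt0// mulr_gt0// ltr_wpDl.
move=> k; rewrite inE => /orP[/eqP ->|ks].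
  have : f * (2 * (`|b j| + 1)) <= a j.
    by rewrite -ler_pdivlMr ?ge_min ?lexx ?orbT// mulr_gt0// ltr_wpDl.
  have : - `|b j| <= b j by rewrite lerNl ler_normr lexx orbT.
  have : 0 <= `|b j| by [].
  move: (`|b j|) (b j) (a j) aj f0 => n b' a' ? ? ? ? ?; nra.
have fe : f <= e by rewrite ge_min lexx.
have ak := h k (mem_behead (s := j :: s) ks).
have := he k ks; have [bk|/ltW bk] := leP 0 (b k) => ?.
  by rewrite ltr_wpDr// mulr_ge0// ltW.
by apply: lt_le_trans (he k ks) _; rewrite lerD2l ler_wnM2r.
Qed.

Definition polytope hs : set 'rV[R]_m :=
  [set v | forall h, h \in hs -> if h.2 then 0 < aff h.1 v else 0 <= aff h.1 v].

Lemma polytope_ge0 hs v h : polytope hs v -> h \in hs -> 0 <= aff h.1 v.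
Proof. by move=> Pv /Pv; case: ifP => // _ /ltW. Qed.

Lemma polytope_cone hs v d : polytope hs v ->
  (forall h, h \in hs -> aff h.1 v = 0 -> 0 <= dot h.1 d) ->
  exists e, [/\ 0 < e, polytope hs (v + e *: d) &
    forall h, h \in hs -> 0 < aff h.1 v -> 0 < aff h.1 (v + e *: d)].
Proof.
move=> Pv hd.
have [j|e e0 he] := @small_perturbation _ [seq h <- hs | 0 < aff h.1 v]
    (fun h => aff h.1 v) (fun h => dot h.1 d).
  by rewrite mem_filter => /andP[].
have pos h : h \in hs -> 0 < aff h.1 v -> 0 < aff h.1 (v + e *: d).
  by move=> hhs h0; rewrite affD dotZ; apply: he; rewrite mem_filter h0.
exists e; split=> // h hhs; have [h0|h0] := boolP (0 < aff h.1 v).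
  by have := pos h hhs h0; case: ifP => // _ /ltW.
have z : aff h.1 v = 0.
  by apply/eqP; rewrite eq_le leNgt h0/= (polytope_ge0 Pv hhs).
case: ifP (Pv h hhs) => [_|_ _]; first by rewrite z ltxx.
by rewrite affD z add0r dotZ mulr_ge0 ?(ltW e0)// hd.
Qed.

(** A short move from v along d stays in the polytope, where l is nonnegative. This stands in for
    Farkas' lemma, which would write the linear part of l as a nonnegative combination of the active
    inequalities. *)
Lemma smooth_cone hs l v d : smooth_monomial (polytope hs) l ->
  polytope hs v -> aff l v = 0 ->
  (forall h, h \in hs -> aff h.1 v = 0 -> 0 <= dot h.1 d) -> 0 <= dot l d.
Proof.
move=> sl Pv lv hd; have [e [e0 Pe _]] := polytope_cone Pv hd.
by have := sl _ Pe; rewrite affD lv add0r dotZ pmulr_rge0.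
Qed.

Lemma smooth_cone0 hs l v d : smooth_monomial (polytope hs) l ->
  polytope hs v -> aff l v = 0 ->
  (forall h, h \in hs -> aff h.1 v = 0 -> dot h.1 d = 0) -> dot l d = 0.
Proof.
move=> sl Pv lv hd; apply/eqP; rewrite eq_le.
rewrite (smooth_cone sl Pv lv) ?andbT; last by move=> h hhs h0; rewrite hd.
rewrite -oppr_ge0 -dotN (smooth_cone sl Pv lv)// => h hhs h0.
by rewrite dotN hd ?oppr0.
Qed.

(** Point from v to an interior point u. An inequality active at v and not strict at u is
    nonnegative around u and zero at u, so its linear part is zero. *)
Lemma inward_direction hs v : interior (polytope hs) !=set0 -> polytope hs v ->
  exists d, forall h, h \in hs -> aff h.1 v = 0 ->
    0 < dot h.1 d \/ forall w, dot h.1 w = 0.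
Proof.
case=> u iu Pv; exists (u - v) => h hhs h0.
have uE : aff h.1 u = dot h.1 (u - v) by rewrite -[in LHS](subrK v u) addrC affD h0 add0r.
have Pu := interior_subset iu.
have := polytope_ge0 Pu hhs; rewrite uE le_eqVlt => /orP[/eqP d0|]; last by left.
right=> w.
have wge w' : 0 <= dot h.1 w'.
  have [V nV VP] := iu.
  have [e e0 Pe] : exists2 e, 0 < e & polytope hs (u + e *: w').
    have nVe j : \forall e \near (0 : R)^'+, V 0 j (u 0 j + e * w' 0 j).
      have ce : (fun e : R => u 0 j + e * w' 0 j) @ 0^'+ --> u 0 j.
        rewrite -[X in _ --> X]addr0 -[X in u 0 j + X](mul0r (w' 0 j)).
        apply: cvg_at_right_filter; apply: cvgD; first exact: cvg_cst.
        by apply: cvgM; [exact: cvg_id | exact: cvg_cst].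
      exact: ce (nV 0 j).
    have nVs : \forall e \near (0 : R)^'+,
        forall j, j \in enum 'I_m -> V 0 j (u 0 j + e * w' 0 j).
      by apply: filter_all => j _; exact: nVe.
    have [e [e0 eV]] := filter_ex (filterI (nbhs_right_gt (0 : R)) nVs).
    by exists e => //; apply: VP => i j; rewrite !mxE (ord1 i); apply: eV; rewrite mem_enum.
  have : aff h.1 u = 0 by rewrite uE d0.
  by move=> hu; have := polytope_ge0 Pe hhs; rewrite affD dotZ hu add0r pmulr_rge0.
apply/eqP; rewrite eq_le wge andbT -oppr_ge0 -dotN; exact: wge.
Qed.

End Polytope.

(** * Existence of limits in the local model *)

Section ModelLimits.
Variables (R : realType) (n m : nat).
Local Notation X := (mpoint R n m).
Implicit Types (l : halfspace R m) (p q : X).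

Lemma mono_coef_cexp l q (a b : 'rV[R]_m) :
  (forall i, coef (q.2 i) = cexp (Complex (a 0 i) (b 0 i))) ->
  mono_coef l q = cexp (Complex (dot l a) (dot l b)).
Proof.
move=> h; rewrite /mono_coef /dot.
pose K (x : R[i]) (y z : R) := x = cexp (Complex y z).
apply: (big_rec3 K) => [|i x y z _]; rewrite /K ?cexp0// => ->.
by rewrite h cexpXz -cexpD.
Qed.

Variables (F : set_system X) (FU : UltraFilter F).
Variables (hs : seq (halfspace R m * bool)) (M : R).
Hypothesis hs_int : interior (polytope hs) !=set0.
Hypothesis F_model : F (model (polytope hs)).
Hypothesis F_real : F [set q : X | forall i, `|q.1 0 i| <= M].
Hypothesis F_mono : F [set q : X | forall h, h \in hs -> cabs (mono_val h.1 q) <= M].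

(* Along F, the tropical part is eventually in the interior of one face of the
   polytope, but the moduli of the coordinates may degenerate; the limit lies on
   a larger stratum, found by moving off that face in the direction in which
   they do. *)
Lemma model_ultra_limit : exists q0, model (polytope hs) q0 /\
  forall (ls : seq (halfspace R m)) (e : R), 0 < e ->
    (forall l, l \in ls -> smooth_monomial (polytope hs) l) ->
    F [set q : X | (forall i, `|q.1 0 i - q0.1 0 i| < e) /\
               forall l, l \in ls -> cabs (mono_val l q - mono_val l q0) < e].
Proof.
set P := polytope hs.
have /choice[lg lgP] (c : ctr R) : exists ab : R * R,
    coef c = cexp (Complex ab.1 ab.2) /\ `|ab.2| <= pi.
  by have [a [b [? ?]]] := cexp_surj (coef_neq0 c); exists (a, b).
pose L q : 'rV[R]_m := \row_i (lg (q.2 i)).1.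
pose Ph q : 'rV[R]_m := \row_i (lg (q.2 i)).2.
have monoE l q : mono_coef l q = cexp (Complex (dot l (L q)) (dot l (Ph q))).
  by apply: mono_coef_cexp => i; rewrite !mxE; have [] := lgP (q.2 i).
(* The inequalities that are equalities F-eventually cut out the face containing the tropical parts;
   [v1] below is a point where these and no others are equalities. *)
pose zr (h : halfspace R m * bool) := F [set q : X | aff h.1 (trop q) = 0].
pose G0 := [set q : X | P (trop q) /\
  forall h, h \in hs -> (zr h -> aff h.1 (trop q) = 0) /\ (~ zr h -> aff h.1 (trop q) <> 0)].
have FG0 : F G0.
  apply: filterI => //; apply: filter_all => h hhs.
  have [z|nz] := pselect (zr h).
    by apply: filterS (z : F _) => q.
  have [//|] := in_ultra_setVsetC [set q : X | aff h.1 (trop q) = 0] FU.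
  by apply: filterS => q ?.
have [q1 [P1 q1z]] := filter_ex FG0; set v1 := trop q1 in q1z P1.
have FL h : h \in hs -> zr h -> F [set q : X | dot h.1 (L q) <= M].
  move=> hhs z; apply: filterS (filterI (z : F _) F_mono) => q [/= hz /(_ h hhs)].
  rewrite /mono_val hz eqxx monoE cabs_cexp; apply: le_trans.
  by apply: le_trans (expR_ge1Dx _); rewrite lerDr.
(* Among the active inequalities, those whose monomials stay away from 0 in modulus. For the other
   active ones the logarithm of the modulus tends to minus infinity. *)
pose Fh (h : halfspace R m * bool) := zr h /\ exists c, F [set q : X | c <= dot h.1 (L q)].
have FnFh h c : zr h -> ~ Fh h -> F [set q : X | dot h.1 (L q) < c].
  move=> z nF; have [//|] := in_ultra_setVsetC [set q : X | dot h.1 (L q) < c] FU.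
  move=> FC; case: nF; split=> //; exists c; apply: filterS FC => q /= /negP.
  by rewrite -leNgt.
pose gs := [seq h <- hs | `[< Fh h >]]; pose k := size gs.
pose h0 : halfspace R m * bool := (fun=> 0, 0, false).
pose g (j : 'I_k) := nth h0 gs j.
pose N : 'M[R]_(m, k) := \matrix_(i, j) ((g j).1.1 i)%:~R.
have NE (v : 'rV[R]_m) j : (v *m N) 0 j = dot (g j).1 v.
  by rewrite !mxE; apply: eq_bigr => i _; rewrite mxE mulrC.
have gP j : g j \in hs /\ Fh (g j).
  by have := mem_nth h0 (ltn_ord j); rewrite mem_filter => /andP[/asboolP].
have gE h : h \in hs -> Fh h -> exists j, g j = h.
  move=> hhs hF; have hg : h \in gs by rewrite mem_filter hhs andbT; apply/asboolP.
  have hk : (index h gs < k)%N by rewrite index_mem.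
  by exists (Ordinal hk); rewrite /g nth_index.
(* [L'] depends only on the values at [L q] of the forms with [Fh], which are bounded, so it
   converges along F. [L''] is killed by these forms and carries all the degeneration. *)
pose L' q := L q *m N *m pinvmx N; pose L'' q := L q - L' q.
have L''0 h q : h \in hs -> Fh h -> dot h.1 (L'' q) = 0.
  move=> hhs hF; have [j <-] := gE h hhs hF.
  by rewrite -NE mulmxBl mulmxKpV ?submxMl// subrr mxE.
have FB : exists B, F [set q : X | forall j : 'I_k, `|dot (g j).1 (L q)| <= B].
  have /choice[B BP] (j : 'I_k) : exists B, F [set q : X | `|dot (g j).1 (L q)| <= B].
    have [gj [z [c Fc]]] := gP j; exists (`|c| + `|M|).
    apply: filterS (filterI Fc (FL _ gj z)) => q /= [c1 c2].
    rewrite ler_norml; apply/andP; split.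
      rewrite opprD; apply: le_trans c1.
      by have := ler_norm (- c); rewrite normrN; have := normr_ge0 M; lra.
    by rewrite (le_trans c2)// (le_trans (ler_norm M))// lerDr.
  exists (\sum_j `|B j|).
  have : F [set q : X | forall j, j \in enum 'I_k -> `|dot (g j).1 (L q)| <= B j].
    by apply: filter_all => j _; exact: BP.
  apply: filterS => q h j; have jk : j \in enum 'I_k by rewrite mem_enum.
  rewrite (le_trans (h j jk))// (le_trans (ler_norm _))// (bigD1 j)//= lerDl.
  exact: sumr_ge0.
have [B FBB] := FB.
have FL' : F [set q : X | forall i : 'I_m,
    `|L' q 0 i| <= \sum_i \sum_j `|B| * `|pinvmx N j i|].
  apply: filterS FBB => q hB i.
  rewrite (bigD1 i)//=; apply: ler_wpDr.
    by apply: sumr_ge0 => i' _; apply: sumr_ge0 => j _; rewrite mulr_ge0.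
  rewrite mxE (le_trans (ler_norm_sum _ _ _))// ler_sum// => j _.
  by rewrite normrM NE ler_wpM2r// (le_trans (hB j))// ler_norm.
have [l' [_ cL']] := ultra_bounded_cvg_fin FU FL'.
have FPh : F [set q : X | forall i : 'I_m, `|Ph q 0 i| <= pi].
  by apply: filterE => q i; rewrite mxE; have [] := lgP (q.2 i).
have [f' [_ cPh]] := ultra_bounded_cvg_fin FU FPh.
have [x' [_ cx]] := ultra_bounded_cvg_fin FU F_real.
pose L0 : 'rV[R]_m := \row_i l' i; pose Ph0 : 'rV[R]_m := \row_i f' i.
have cdot (V : X -> 'rV[R]_m) (V0 : 'rV[R]_m) l :
    (forall i, (fun q => V q 0 i) @ F --> V0 0 i) ->
    (fun q => dot l (V q)) @ F --> dot l V0.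
  move=> cV; apply: cvg_big => [|i _]; first exact: add_continuous.
  by apply: cvgM; [exact: cvg_cst | exact: cV].
have cL'l l : (fun q => dot l (L' q)) @ F --> dot l L0.
  by apply: cdot => i; rewrite mxE.
have cPhl l : (fun q => dot l (Ph q)) @ F --> dot l Ph0.
  by apply: cdot => i; rewrite mxE.
(* The direction off the face: minus [L''] at one well chosen q. It is positive on the degenerating
   forms because there [L] is very negative while [L'] is bounded. *)
have [w [wF wpos]] : exists w, (forall h, h \in hs -> Fh h -> dot h.1 w = 0) /\
    forall h, h \in hs -> zr h -> ~ Fh h -> 0 < dot h.1 w.
  have : F [set q : X | forall h, h \in hs -> zr h -> ~ Fh h -> 0 < - dot h.1 (L'' q)].
    apply: filter_all => h hhs.
    have [z|nz] := pselect (zr h); last by apply: filterE => q /nz.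
    have [hF|nF] := pselect (Fh h); first by apply: filterE => q _ /(_ hF).
    have c1 := FnFh h (dot h.1 L0 - 1) z nF.
    have c2 : F [set q : X | `|dot h.1 L0 - dot h.1 (L' q)| < 1].
      by have /cvgrPdist_lt := cL'l h.1; apply.
    apply: filterS (filterI c1 c2) => q /= [d1 d2] _ _; rewrite dotB.
    by move: d2; rewrite ltr_norml => /andP[_ d2]; lra.
  move=> /filter_ex [q wq]; exists (- L'' q); split=> h hhs.
    by move=> hF; rewrite dotN L''0 ?oppr0.
  by move=> z nF; rewrite dotN; exact: wq.
have [e [e0 Pe epos]] : exists e, [/\ 0 < e, P (v1 + e *: w) &
    forall h, h \in hs -> 0 < aff h.1 v1 -> 0 < aff h.1 (v1 + e *: w)].
  apply: polytope_cone => // h hhs hv.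
  have z : zr h by apply: contrapT => nz; exact: (q1z h hhs).2.
  by have [hF|nF] := pselect (Fh h); [rewrite wF | rewrite ltW// wpos].
set v0 := v1 + e *: w in Pe epos.
have v0F h : h \in hs -> aff h.1 v0 = 0 -> Fh h.
  move=> hhs hv; apply: contrapT => nF.
  have h1 : aff h.1 v1 = 0.
    apply/eqP; rewrite eq_le (polytope_ge0 P1 hhs) andbT leNgt; apply/negP.
    by move=> /(epos h hhs); rewrite hv ltxx.
  have z : zr h by apply: contrapT => nz; exact: (q1z h hhs).2.
  by have := wpos h hhs z nF; move: hv; rewrite affD h1 add0r dotZ => /eqP;
    rewrite mulf_eq0 (gt_eqF e0)/= => /eqP ->; rewrite ltxx.
(* Every inequality active at [v0] satisfies [Fh], so the monomials that tend to 0 along F have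
   value 0 at [q0]. *)
pose q0 : X := (\row_i x' i,
  fun i => Ctr (v0 0 i) (cexp_neq0 (Complex (L0 0 i) (Ph0 0 i)))).
have tq0 : trop q0 = v0 by apply/rowP => i; rewrite mxE.
have mono0 l : mono_coef l q0 = cexp (Complex (dot l L0) (dot l Ph0)).
  exact: mono_coef_cexp.
exists q0; split; first by rewrite /model /= tq0.
move=> ls eps eps0 sls; apply: filterI.
  have : F [set q : X | forall i, i \in enum 'I_n -> `|q.1 0 i - q0.1 0 i| < eps].
    apply: filter_all => i _; have /cvgrPdist_lt/(_ _ eps0) := cx i.
    by apply: filterS => q; rewrite /= mxE distrC.
  by apply: filterS => q h i; apply: h; rewrite mem_enum.
apply: filter_all => l /sls sl.
(* If l vanishes at [v0], its linear part vanishes wherever all forms with [Fh] do; so it takes the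
   same value on [L] and [L'], and its monomial converges. Otherwise the limit value is 0 and
   smallness has to be proved. *)
have [lv|lv] := eqVneq (aff l v0) 0.
  have Fdot d : (forall h, h \in hs -> Fh h -> dot h.1 d = 0) -> dot l d = 0.
    by move=> hd; apply: (smooth_cone0 sl Pe) => // h hhs /(v0F h hhs); exact: hd.
  have lL q : dot l (L q) = dot l (L' q).
    apply/eqP; rewrite -subr_eq0 -dotB; apply/eqP/Fdot => h hhs; exact: L''0.
  have lt : F [set q : X | aff l (trop q) = 0].
    apply: filterS FG0 => q [Pq qz] /=.
    rewrite -[trop q](subrK v0) addrC affD lv add0r; apply: Fdot => h hhs hF.
    have h1 : aff h.1 v0 = 0.
      by rewrite affD dotZ wF// mulr0 addr0; exact: (q1z h hhs).1 hF.1.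
    have := (qz h hhs).1 hF.1.
    by rewrite -[trop q in LHS](subrK v0) addrC affD h1 add0r.
  have cre : (fun q => complex.Re (mono_coef l q)) @ F --> complex.Re (mono_coef l q0).
    rewrite mono0 /=.
    have -> : (fun q => complex.Re (mono_coef l q)) =
        (fun q => expR (dot l (L' q)) * cos (dot l (Ph q))).
      by apply/funext => q; rewrite monoE /= lL.
    apply: cvgM.
      by apply: (cvg_comp _ _ (cL'l l)); exact: continuous_expR.
    by apply: (cvg_comp _ _ (cPhl l)); exact: continuous_cos.
  have cim : (fun q => complex.Im (mono_coef l q)) @ F --> complex.Im (mono_coef l q0).
    rewrite mono0 /=.
    have -> : (fun q => complex.Im (mono_coef l q)) =
        (fun q => expR (dot l (L' q)) * sin (dot l (Ph q))).
      by apply/funext => q; rewrite monoE /= lL.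
    apply: cvgM.
      by apply: (cvg_comp _ _ (cL'l l)); exact: continuous_expR.
    by apply: (cvg_comp _ _ (cPhl l)); exact: continuous_sin.
  have eps2 : 0 < eps / 2 by rewrite divr_gt0.
  have /cvgrPdist_lt/(_ _ eps2) Fre := cre.
  have /cvgrPdist_lt/(_ _ eps2) Fim := cim.
  apply: filterS (filterI lt (filterI Fre Fim)) => q /= [lq [dr di]].
  rewrite /mono_val tq0 lq lv eqxx.
  apply: le_lt_trans (cabs_le _) _; rewrite (splitr eps); apply: ltrD.
    by rewrite distrC in dr; apply: le_lt_trans dr; case: mono_coef => ? ?; case: mono_coef.
  by rewrite distrC in di; apply: le_lt_trans di; case: mono_coef => ? ?; case: mono_coef.
have mv0 : mono_val l q0 = 0 by rewrite /mono_val tq0 (negbTE lv).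
have lv0 : 0 < aff l v0 by rewrite lt_neqAle eq_sym lv sl.
have cabs0 : cabs 0 = 0 :> R by rewrite /cabs /= expr0n /= addr0 sqrtr0.
have [Fl|Fl] := in_ultra_setVsetC [set q : X | aff l (trop q) = 0] FU; last first.
  apply: filterS Fl => q /= /eqP/negbTE lq.
  by rewrite mv0 /mono_val lq subr0 cabs0.
have lv1 : aff l v1 = 0.
  have [q [[Pq qz] /= lq]] := filter_ex (filterI FG0 Fl).
  rewrite -[v1](subrK (trop q)) addrC affD lq add0r.
  apply: (smooth_cone0 sl Pq lq) => h hhs hq.
  have z : zr h by apply: contrapT => nz; exact: (qz h hhs).2.
  have := (q1z h hhs).1 z.
  by rewrite -[v1 in LHS](subrK (trop q)) addrC affD hq add0r.
have lw : 0 < dot l w by move: lv0; rewrite affD lv1 add0r dotZ pmulr_rgt0.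
have [d0 d0P] := inward_direction hs_int P1.
have [K [K0 KP]] : exists K, 0 <= K /\ forall h, h \in hs -> aff h.1 v1 = 0 ->
    `|M| <= K * dot h.1 d0 \/ forall w, dot h.1 w = 0.
  have: forall s : seq (halfspace R m * bool), {subset s <= hs} -> exists K, 0 <= K /\
      forall h, h \in s -> aff h.1 v1 = 0 ->
      `|M| <= K * dot h.1 d0 \/ forall w, dot h.1 w = 0.
    elim=> [|h s ih] sh; first by exists 0.
    have [|K [K0 KP]] := ih; first by move=> z zs; apply: sh; rewrite inE zs orbT.
    have [h1|h1] := eqVneq (aff h.1 v1) 0; last first.
      exists K; split=> // z; rewrite inE => /orP[/eqP -> zv|]; last exact: KP.
      by rewrite zv eqxx in h1.
    have [dh|dh] := d0P h (sh _ (mem_head _ _)) h1; last first.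
      by exists K; split=> // z; rewrite inE => /orP[/eqP -> _|]; [right | exact: KP].
    exists (K + `|M| / dot h.1 d0).
    have p0 : 0 <= `|M| / dot h.1 d0 by rewrite divr_ge0// ltW.
    split=> [|z]; first exact: addr_ge0.
    rewrite inE => /orP[/eqP -> _|zs zv].
      by left; rewrite mulrDl divfK ?gt_eqF// lerDr mulr_ge0// ltW.
    have [Kz|Kz] := KP z zs zv; last by right.
    left; rewrite mulrDl (le_trans Kz)// lerDl mulr_ge0//.
    have zhs : z \in hs by apply: sh; rewrite inE zs orbT.
    by have [/ltW//|->] := d0P z zhs zv.
  by move=> /(_ hs); apply.
(* With these constants, minus [L q] minus [T *: w] plus [K *: d0] is admissible at [v1]: [K *: d0]
   absorbs the bound M, and the degeneration of [L q] outweighs [T *: w]. Then [smooth_cone] bounds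
   [dot l (L q)] by [ln (eps / 2)]. *)
pose T := `|(K * dot l d0 - ln (eps / 2)) / dot l w|.
have FT : F [set q : X | forall h, h \in hs -> zr h ->
    dot h.1 (L q) <= M /\ (~ Fh h -> dot h.1 (L q) <= - (T * dot h.1 w))].
  apply: filter_all => h hhs; have [z|nz] := pselect (zr h); last first.
    by apply: filterE => q /nz.
  have [hF|nF] := pselect (Fh h).
    by apply: filterS (FL h hhs z) => q ? _; split.
  apply: filterS (filterI (FL h hhs z) (FnFh h (- (T * dot h.1 w)) z nF)).
  by move=> q [? /ltW].
apply: filterS (filterI Fl FT) => q /= [lq qL].
rewrite mv0 /mono_val lq eqxx subr0 monoE cabs_cexp.
have : 0 <= dot l (- L q - T *: w + K *: d0).
  apply: (smooth_cone sl P1 lv1) => h hhs hv1.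
  have z : zr h by apply: contrapT => nz; exact: (q1z h hhs).2.
  have [Kd|triv] := KP h hhs hv1; last by rewrite triv.
  have [hM hT] := qL h hhs z.
  rewrite dotD dotB dotN !dotZ.
  have [hF|nF] := pselect (Fh h).
    by rewrite wF// mulr0 subr0; have := ler_norm M; lra.
  by have := hT nF; have := normr_ge0 M; lra.
rewrite dotD dotB dotN !dotZ => dge.
have Tw : K * dot l d0 - ln (eps / 2) <= T * dot l w.
  by rewrite -ler_pdivrMr// ler_norm.
have : expR (dot l (L q)) <= expR (ln (eps / 2)) by rewrite ler_expR; lra.
rewrite lnK ?posrE ?divr_gt0// => h; apply: le_lt_trans h _.
by rewrite ltr_pdivrMr// ltr_pMr// ltr1n.
Qed.

End ModelLimits.

Lemma ultra_fmap (T T' : Type) (f : T -> T') (F : set_system T) :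
  UltraFilter F -> UltraFilter (f @ F).
Proof.
move=> FU; split=> [|G GF sG]; first exact: fmap_proper_filter.
apply/seteqP; split=> A //; last exact: sG.
move=> GA; have [//|nA] := in_ultra_setVsetC (f @^-1` A) FU.
by have [x []] := filter_ex (filterI GA (sG (~` A) nA)).
Qed.

(** * Regularity of exploded manifolds *)

Section ExplodedRegular.
Variable R : realType.

Lemma cabsD (z w : R[i]) : cabs (z + w) <= cabs z + cabs w.
Proof. by have := le_normcD z w; case: z w => a b [c d]. Qed.

Lemma cabsN (z : R[i]) : cabs (- z) = cabs z.
Proof. by case: z => a b; rewrite /cabs /= !sqrrN. Qed.

Lemma cabs_dist (z w v : R[i]) : cabs (z - v) <= cabs (z - w) + cabs (w - v).
Proof. by rewrite -[z](subrK w) addrK -addrA cabsD. Qed.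

Lemma model_nbhsI n m (P : set 'rV[R]_m) (p : mpoint R n m) V V' :
  model_nbhs P p V -> model_nbhs P p V' -> model_nbhs P p (V `&` V').
Proof.
move=> [ls [e [e0 sl hV]]] [ls' [e' [e0' sl' hV']]].
exists (ls ++ ls'), (Num.min e e'); split; first by rewrite lt_min e0.
  by move=> l; rewrite mem_cat => /orP[/sl|/sl'].
move=> q Pq q1 q2; split.
  apply: hV => // [i|l ll]; first by have := q1 i; rewrite lt_min => /andP[].
  by have := q2 l; rewrite mem_cat ll lt_min => /(_ isT)/andP[].
apply: hV' => // [i|l ll]; first by have := q1 i; rewrite lt_min => /andP[].
by have := q2 l; rewrite mem_cat ll orbT lt_min => /(_ isT)/andP[].
Qed.

Lemma model_nbhsS n m (P : set 'rV[R]_m) (p : mpoint R n m) V V' :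
  V `<=` V' -> model_nbhs P p V -> model_nbhs P p V'.
Proof.
move=> VV' [ls [e [e0 sl hV]]]; exists ls, e; split=> // q ? ? ?.
exact/VV'/hV.
Qed.

Lemma model_nbhs_ball n m (P : set 'rV[R]_m) (p q : mpoint R n m)
    (ls : seq (halfspace R m)) (e : R) :
  (forall l, l \in ls -> smooth_monomial P l) ->
  (forall i, `|q.1 0 i - p.1 0 i| < e) ->
  (forall l, l \in ls -> cabs (mono_val l q - mono_val l p) < e) ->
  model_nbhs P q [set r : mpoint R n m | (forall i, `|r.1 0 i - p.1 0 i| < e) /\
    forall l, l \in ls -> cabs (mono_val l r - mono_val l p) < e].
Proof.
move=> sl q1 q2.
have [d d0 dP] : exists2 d : R, 0 < d & (forall i, d + `|q.1 0 i - p.1 0 i| <= e) /\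
    forall l, l \in ls -> d + cabs (mono_val l q - mono_val l p) <= e.
  have [j|d d0 dP] := @small_perturbation R _ (map (fun i => `|q.1 0 i - p.1 0 i|) (enum 'I_n)
      ++ map (fun l => cabs (mono_val l q - mono_val l p)) ls) (fun x => e - x) (fun => -1).
    rewrite mem_cat => /orP[] /mapP[z zs ->]; rewrite subr_gt0; first exact: q1.
    exact: q2.
  exists d => //; split=> [i|l ll].
    have := dP `|q.1 0 i - p.1 0 i|; rewrite mem_cat.
    rewrite (map_f (fun i => `|q.1 0 i - p.1 0 i|) (mem_enum 'I_n i)) => /(_ isT).
    by lra.
  have := dP (cabs (mono_val l q - mono_val l p)).
  by rewrite mem_cat (map_f (fun l => cabs (mono_val l q - mono_val l p)) ll) orbT => /(_ isT); lra.
exists ls, d; split; [exact: d0 | exact: sl | move=> r Pr r1 r2; split=> [i|l ll]].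
  apply: lt_le_trans (dP.1 i).
  by rewrite (le_lt_trans (ler_distD (q.1 0 i) _ _))// ltrD2r.
apply: lt_le_trans (dP.2 l ll).
by rewrite (le_lt_trans (cabs_dist _ (mono_val l q) _))// ltrD2r r2.
Qed.

(** The neighbourhood is a chart ball of half radius. Its closure in B could a priori leave the
    chart; but an ultrafilter on the ball converging to y also converges to a point of the chart
    inside U, and the Hausdorff condition then forbids y outside U. *)
Lemma exploded_regular (B : exploded_manifold R) : regular_space B.
Proof.
move=> x U0 nU0.
have [U [oU Ux] UU0] : exists2 U, open_nbhs x U & U `<=` U0 by rewrite nbhsE in nU0.
have [n [m [P [W [phi [Wx [Ppoly oW [phiinj phiP] phio _]]]]]]] := eman_charts x.
have [[hs PE] Pint] := Ppoly.
have {PE} PE : P = polytope hs by [].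
have oUW : open (U `&` W) by exact: openI.
have [VP Vnb] := iffLR (phio (U `&` W) (@subIsetr _ _ _)) oUW.
have [ls0 [e [e0 sl0 hls0]]] := Vnb (phi x) (ex_intro2 _ _ x (conj Ux Wx) erefl).
(* The inequalities of the polytope are added to the monomials defining the ball, since
   [model_ultra_limit] asks for bounds on them. *)
pose ls := ls0 ++ map fst hs.
have sl l : l \in ls -> smooth_monomial P l.
  rewrite mem_cat => /orP[/sl0//|/mapP[h hhs ->]] v Pv.
  by rewrite PE in Pv; exact: polytope_ge0 Pv hhs.
have e2 : 0 < e / 2 by rewrite divr_gt0.
pose Bl := [set r : mpoint R n m | (forall i, `|r.1 0 i - (phi x).1 0 i| < e / 2) /\
    forall l, l \in ls -> cabs (mono_val l r - mono_val l (phi x)) < e / 2].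
have cabs0 : cabs 0 = 0 :> R by rewrite /cabs /= expr0n /= addr0 sqrtr0.
pose N := W `&` phi @^-1` Bl.
have NW : N `<=` W by move=> z [].
have Nx : N x.
  by split=> //; split=> [i|l _]; rewrite subrr ?normr0 ?cabs0.
have oN : open N.
  apply/(phio N NW); split=> [_ [z [Wz _] <-]|_ [z [Wz [z1 z2]] <-]].
    by apply: phiP; exists z.
  have [_ /(_ (phi z) (ex_intro2 _ _ z Wz erefl)) Wnb] :=
    iffLR (phio W (@subset_refl _ _)) oW.
  apply: model_nbhsS (model_nbhsI Wnb (model_nbhs_ball sl z1 z2)).
  by move=> _ [[t Wt <-] tB]; exact: (ex_intro2 _ _ t (conj Wt tB) erefl).
exists N => /=; first exact: (open_nbhs_nbhs (conj oN Nx)).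
move=> y clNy; apply: UU0; apply: contrapT => nUy.
have wP : ProperFilter (within N (nbhs y)).
  apply: Build_ProperFilter_ex => A wA; have [z [Nz /(_ Nz) Az]] := clNy _ wA.
  by exists z.
have [G [GU sG]] := ultraFilterLemma wP.
have GN : G N by apply: sG; apply: (filterS _ (filterT : nbhs y setT)) => z _.
have GphiU := ultra_fmap phi GU.
pose M := \sum_i `|(phi x).1 0 i| + \sum_(h <- hs) cabs (mono_val h.1 (phi x)) + e / 2.
have sum0 : 0 <= \sum_i `|(phi x).1 0 i| by exact: sumr_ge0.
have sumc0 (s : seq (halfspace R m * bool)) :
    0 <= \sum_(h <- s) cabs (mono_val h.1 (phi x)).
  by apply: sumr_ge0 => h _; exact: sqrtr_ge0.
have [||||q0 [Pq0 q0lim]] := @model_ultra_limit R n m (phi @ G) GphiU hs M.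
- by rewrite -PE.
- by apply: (@filterS _ G _ N _ _ GN) => z [Wz _] /=; rewrite /model /= -PE; apply: phiP; exists z.
- apply: (@filterS _ G _ N _ _ GN) => z [_ [z1 _]] i /=.
  have := z1 i; have := ler_normB ((phi z).1 0 i) ((phi x).1 0 i).
  have : `|(phi x).1 0 i| <= \sum_i `|(phi x).1 0 i| by rewrite (bigD1 i)//= lerDl sumr_ge0.
  have := ler_distD ((phi x).1 0 i) ((phi z).1 0 i) 0; rewrite !subr0.
  by have := sumc0 hs; rewrite /M; lra.
- apply: (@filterS _ G _ N _ _ GN) => z [_ [_ z2]] h hhs /=.
  have h1 : cabs (mono_val h.1 (phi z) - mono_val h.1 (phi x)) < e / 2.
    by apply: z2; rewrite mem_cat (map_f fst hhs) orbT.
  have h2 := cabs_dist (mono_val h.1 (phi z)) (mono_val h.1 (phi x)) 0.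
  rewrite !subr0 in h2.
  have h3 : cabs (mono_val h.1 (phi x)) <= \sum_(h <- hs) cabs (mono_val h.1 (phi x)).
    move: hhs sumc0; elim: (hs) => // h' s ih.
    rewrite inE big_cons => /orP[/eqP <- /(_ s) ?|/ih {}ih s0]; first by rewrite lerDl.
    by rewrite ler_wpDl ?sqrtr_ge0// ih.
  by rewrite (le_trans h2)// addrC lerD ?(ltW h1)// ler_wpDl.
rewrite -PE in Pq0 q0lim.
have {}q0lim (ls' : seq (halfspace R m)) e' : 0 < e' ->
    (forall l, l \in ls' -> smooth_monomial P l) ->
    G [set z | (forall i, `|(phi z).1 0 i - q0.1 0 i| < e') /\
      forall l, l \in ls' -> cabs (mono_val l (phi z) - mono_val l q0) < e'].
  by move=> h1 h2; exact: (q0lim ls' e' h1 h2).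
have [b [Ub Wb] bq0] : (phi @` (U `&` W)) q0.
  have [z [[z1 z2] [_ [z3 z4]]]] := filter_ex (filterI (q0lim ls (e / 2) e2 sl) GN).
  apply: hls0 => // [i|l ll].
    rewrite (splitr e) (le_lt_trans (ler_distD ((phi z).1 0 i) _ _))// ltrD//.
    by rewrite distrC.
  have lls : l \in ls by rewrite mem_cat ll.
  rewrite (splitr e) (le_lt_trans (cabs_dist _ (mono_val l (phi z)) _))// ltrD ?z4//.
  by rewrite -cabsN opprB z2.
(* [eman_hausdorff] separates only points that some open set distinguishes; here U does, containing
   b but not y. *)
have [V1 [V2 [oV1 oV2 V1b V2y V12]]] := eman_hausdorff oU Ub nUy.
have GV2 : G V2.
  apply: sG; apply: (filterS _ (open_nbhs_nbhs (conj oV2 V2y))) => z ? _ //.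
have oV1W : open (V1 `&` W) by exact: openI.
have [_ /(_ q0)] := iffLR (phio (V1 `&` W) (@subIsetr _ _ _)) oV1W.
case=> [|ls' [e' [e0' sl' hls']]]; first by exists b.
have [z [[z1 z2] [[Wz _] V2z]]] :=
  filter_ex (filterI (q0lim ls' e' e0' sl') (filterI GN GV2)).
have [|t [V1t Wt] tz] := hls' (phi z) _ z1 z2; first by apply: phiP; exists z.
have tzE : t = z by apply: phiinj; rewrite ?inE.
rewrite tzE in V1t; have : (V1 `&` V2) z by [].
by rewrite V12.
Qed.

End ExplodedRegular.

(** * Open subsets and points of exploded manifolds *)

Section OpenSubset.
Variable R : realType.

Definition ctr1 : ctr R := Ctr 0 (oner_neq0 _).

Section SubSpace.
Variables (B : exploded_space R) (A : set B).
Hypothesis oA : open A.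
Implicit Types (U V : set (set_type A)) (f g : set_type A -> ctr R).

(** [efun] speaks of functions on the whole space, so a function on A needs values elsewhere; by
    [efun_ext] only its values on the open set in question matter. *)
Definition ext_by_one f (x : B) : ctr R :=
  if pselect (A x) is left Ax then f (exist _ x (mem_set Ax)) else ctr1.

Lemma ext_by_oneE f (w : set_type A) : ext_by_one f (val w) = f w.
Proof.
rewrite /ext_by_one; case: pselect => [Ax|nAx]; first by congr f; exact: val_inj.
by case: nAx; exact: set_mem (valP w).
Qed.

Lemma open_subE U : open U -> exists2 V : set B, open V & U = val @^-1` V.
Proof. by case=> V oV <-; exists V. Qed.

Lemma open_sub_image U : open U -> open (val @` U).
Proof.
move=> /open_subE[V oV ->]; rewrite (_ : _ @` _ = V `&` A); first exact: openI.
apply/seteqP; split=> [_ [w Vw <-]|x [Vx Ax]].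
  by split=> //; exact: set_mem (valP w).
by exists (exist _ x (mem_set Ax)).
Qed.

Lemma open_sub_preimage (V : set B) : open V -> open (val @^-1` V : set (set_type A)).
Proof. by move=> oV; exists V. Qed.

Lemma preimage_sub_image U : val @^-1` (val @` U) = U.
Proof.
apply/seteqP; split=> [w [v Uv /val_inj <-]//|w Uw].
by exists w.
Qed.

Definition sub_efun U f := efun (val @` U) (ext_by_one f).

Lemma sub_efunE U f (g : B -> ctr R) : (forall w, U w -> f w = g (val w)) ->
  sub_efun U f <-> efun (val @` U) g.
Proof.
move=> fg; split; apply: efun_ext => _ /set_mem[w Uw <-];
  by rewrite ext_by_oneE fg.
Qed.

Lemma sub_efun_ext U f g : {in U, f =1 g} -> sub_efun U f -> sub_efun U g.
Proof.
move=> fg; apply: efun_ext => _ /set_mem[w Uw <-].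
by rewrite !ext_by_oneE fg// inE.
Qed.

Lemma sub_efun_res U V f : open U -> open V -> V `<=` U -> sub_efun U f -> sub_efun V f.
Proof.
move=> oU oV VU Uf; apply: (efun_res _ _ _ Uf); [exact: open_sub_image.. |].
exact: image_subset.
Qed.

Lemma sub_efun_glue U f : open U ->
  (forall x, U x -> exists V, [/\ open V, V x, V `<=` U & sub_efun V f]) -> sub_efun U f.
Proof.
move=> oU h; apply: efun_glue; first exact: open_sub_image.
move=> _ [w Uw <-]; have [V [oV Vw VU fV]] := h w Uw.
exists (val @` V); split; [exact: open_sub_image | by exists w | | exact: fV].
exact: image_subset.
Qed.

Lemma sub_efun_cst U z : open U -> sub_efun U (fun=> z).
Proof.
move=> oU; apply/(sub_efunE (g := fun=> z)) => //.
by apply: efun_cst; exact: open_sub_image.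
Qed.

Lemma sub_efun_mul U f g : open U -> sub_efun U f -> sub_efun U g ->
  sub_efun U (fun x => ctr_mul (f x) (g x)).
Proof.
move=> oU Uf Ug; apply/(sub_efunE (g := fun x => ctr_mul (ext_by_one f x) (ext_by_one g x))).
  by move=> w _; rewrite !ext_by_oneE.
by apply: efun_mul => //; exact: open_sub_image.
Qed.

Lemma sub_efun_inv U f : open U -> sub_efun U f -> sub_efun U (fun x => ctr_inv (f x)).
Proof.
move=> oU Uf; apply/(sub_efunE (g := fun x => ctr_inv (ext_by_one f x))).
  by move=> w _; rewrite !ext_by_oneE.
by apply: efun_inv => //; exact: open_sub_image.
Qed.

Definition sub_space : exploded_space R :=
  @ExplodedSpace R (set_type A) sub_efun sub_efun_ext sub_efun_res sub_efun_glue
    sub_efun_cst sub_efun_mul sub_efun_inv.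

Lemma sub_cont : continuous (val : sub_space -> B).
Proof. exact: initial_continuous. Qed.

Lemma sub_pull (V : set B) (g : B -> ctr R) : open V -> efun V g ->
  @efun R sub_space (val @^-1` V) (g \o val).
Proof.
move=> oV Vg; apply/(sub_efunE (g := g)) => //.
apply: efun_res Vg => //; first exact/open_sub_image/open_sub_preimage.
by move=> _ [w Vw <-].
Qed.

Definition sub_incl : emap sub_space B := EMap sub_cont sub_pull.

Lemma sub_incl_range : range sub_incl = A.
Proof.
apply/seteqP; split=> [_ [w _ <-]|x Ax]; first exact: set_mem (valP w).
by exists (exist _ x (mem_set Ax)).
Qed.

Lemma sub_incl_open : open_embedding sub_incl.
Proof.
split; last by rewrite sub_incl_range.
split; first exact: val_inj.
- by move=> U /open_subE.
move=> U h x oU Uh Ux; exists (val @` U), (ext_by_one h); split=> //.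
- exact: open_sub_image.
- by exists x.
- by move=> w [v Uv /val_inj <-].
by move=> w _; rewrite /= ext_by_oneE.
Qed.

End SubSpace.

Section SubManifold.
Variables (B : exploded_manifold R) (A : set B).
Hypothesis oA : open A.

Lemma sub_charts (b : sub_space oA) : exists n m (P : set 'rV[R]_m)
  (W : set (sub_space oA)) (phi : sub_space oA -> mpoint R n m), W b /\ is_chart P W phi.
Proof.
have [n [m [P [W [phi [Wb [Pp oW [inj phiP] phio phie]]]]]]] := eman_charts (val b : B).
exists n, m, P, (val @^-1` W), (phi \o val).
have imE V : (phi \o val) @` V = phi @` (val @` V) by rewrite image_comp.
have sW (V : set (sub_space oA)) : V `<=` val @^-1` W -> val @` V `<=` W.
  by move=> VW _ [w Vw <-]; exact: VW.
split=> //; split=> //.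
- exact: open_sub_preimage.
- split=> [x y /set_mem xW /set_mem yW /inj e|_ [w Ww <-]].
    by apply: val_inj; apply: e; rewrite inE.
  by apply: phiP; exists (val w).
- move=> V VW; rewrite imE -(phio _ (sW V VW)); split; first exact: open_sub_image.
  move=> /(@open_sub_preimage B A); rewrite (_ : _ @^-1` _ = V)//.
  exact: preimage_sub_image.
move=> V g VW oV; rewrite imE -(phie _ g (sW V VW) (open_sub_image oA oV)).
exact: sub_efunE.
Qed.

Lemma sub_second_countable : @second_countable (sub_space oA).
Proof.
have [b [bo bP]] := second_countable_seq (@eman_countable R B).
exists (range (fun n => val @^-1` (b n) : set (sub_space oA))).
  by apply: (@sub_countable _ _ _ setT (card_image_le _ _)); exact: countableP.
split=> [_ [n _ <-]|x U nU]; first exact: open_sub_preimage.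
have := nU; rewrite nbhsE => -[V [/open_subE[V' oV' ->] V'x] VU].
have [n [bx bV]] := bP _ _ oV' V'x.
exists (val @^-1` (b n)); first by split=> //; exists n.
by move=> w /bV /VU.
Qed.

Lemma sub_hausdorff (x y : sub_space oA) (U : set (sub_space oA)) :
  open U -> U x -> ~ U y ->
  exists V W : set (sub_space oA), [/\ open V, open W, V x, W y & V `&` W = set0].
Proof.
move=> /open_subE[U' oU' ->] Ux Uy.
have [V [W [oV oW Vx Wy VW]]] := eman_hausdorff oU' Ux Uy.
exists (val @^-1` V), (val @^-1` W); split=> //; [exact: open_sub_preimage.. |].
by rewrite -preimage_setI VW preimage_set0.
Qed.

Definition sub_manifold : exploded_manifold R :=
  ExplodedManifold sub_charts sub_second_countable sub_hausdorff.

End SubManifold.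

(** The lift pulls back exploded functions because those of B are locally restrictions of functions
    on C, which a pulls back. *)
Lemma embedding_lift (A B C : exploded_space R) (r : emap B C) (a : emap A C) :
  embedding r -> range a `<=` range r -> exists b : emap A B, emap_comp r b = a.
Proof.
move=> [rinj ropen refun] ar.
have /choice[b rb] x : exists y, r y = a x by have [|y _ ?] := ar (a x); [exists x | exists y].
have rbE : r \o b = a by apply/funext => x; exact: rb.
have bcont : continuous b.
  apply/continuousP => U oU; have [V oV ->] := ropen U oU.
  rewrite -comp_preimage rbE; apply: open_comp => // x _; exact: emap_cont.
have bpull V g : open V -> efun V g -> efun (b @^-1` V) (g \o b).
  move=> oV Vg.
  have obV : open (b @^-1` V) by apply: open_comp => // x _; exact: bcont.
  apply: efun_glue => // x Vx.
  have [V' [g' [oV' V'r V'g' rV' gg']]] := refun V g (b x) oV Vg Vx.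
  exists (a @^-1` V'); split.
  - by apply: open_comp => // z _; exact: emap_cont.
  - by rewrite /preimage /= -rb.
  - by move=> z; rewrite /preimage /= -rb => /rV'.
  apply: (efun_ext _ (@emap_pull _ _ _ a _ _ oV' V'g')) => z /set_mem /= V'z.
  by rewrite -rb [LHS]/= -/((g' \o r) (b z)) -gg'// inE /preimage /= rb.
by exists (EMap bcont bpull); apply: emap_eq => x; exact: rb.
Qed.

Lemma embedding_comp (A B C : exploded_space R) (r : emap B C) (s : emap A B) :
  embedding r -> embedding s -> embedding (emap_comp r s).
Proof.
move=> [rinj ropen refun] [sinj sopen sefun]; split.
- exact: inj_comp.
- move=> U oU; have [V oV ->] := sopen U oU; have [V' oV' ->] := ropen V oV.
  by exists V'.
move=> U h x oU Uh Ux; have [V [g [oV Vx Vg sV hg]]] := sefun U h x oU Uh Ux.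
have [V' [g' [oV' V'x Vg' rV' gg']]] := refun V g (s x) oV Vg Vx.
exists V', g'; split=> //; first by move=> z V'z; apply/sV/rV'.
move=> z /set_mem V'z; rewrite hg; last by rewrite inE; exact: rV'.
by rewrite /= gg'// inE.
Qed.

Lemma embedding_factor (A B C : exploded_space R) (r : emap B C) (s : emap A B) :
  embedding (emap_comp r s) -> embedding s.
Proof.
move=> [rinj ropen refun]; split.
- by move=> x y e; apply: rinj; rewrite /= e.
- move=> U oU; have [V oV ->] := ropen U oU; exists (r @^-1` V) => //.
  by apply: open_comp => // z _; exact: emap_cont.
move=> U h x oU Uh Ux; have [V [g [oV Vx Vg sV hg]]] := refun U h x oU Uh Ux.
exists (r @^-1` V), (g \o r); split=> //; last exact: emap_pull.
by apply: open_comp => // z _; exact: emap_cont.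
Qed.

Lemma open_embedding_image (A B : exploded_space R) (r : emap A B) (U : set A) :
  open_embedding r -> open U -> open (r @` U).
Proof.
move=> [[_ ropen _] oR] oU; have [V oV ->] := ropen U oU.
rewrite (_ : _ @` _ = V `&` range r); first exact: openI.
apply/seteqP; split=> [_ [x Vx <-]|t [Vt [x _ rx]]]; first by split=> //; exists x.
by exists x => //; rewrite /preimage /= rx.
Qed.

Lemma open_embedding_comp (A B C : exploded_space R) (r : emap B C) (s : emap A B) :
  open_embedding r -> open_embedding s -> open_embedding (emap_comp r s).
Proof.
move=> or [es oS]; split; first exact: embedding_comp or.1 es.
rewrite (_ : range _ = r @` range s); first exact: open_embedding_image.
by rewrite image_comp.
Qed.

Lemma open_embedding_factor (A B C : exploded_space R) (r : emap B C) (s : emap A B) :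
  injective r -> open_embedding (emap_comp r s) -> open_embedding s.
Proof.
move=> rinj [ers oR]; split; first exact: embedding_factor ers.
rewrite (_ : range s = r @^-1` range (emap_comp r s)).
  by apply: open_comp => // z _; exact: emap_cont.
apply/seteqP; split=> [_ [x _ <-]|y [x _ /rinj <-]]; first by exists x.
by exists x.
Qed.

Lemma open_embedding_id (A : exploded_space R) : open_embedding (emap_id A).
Proof.
split; last by rewrite image_id; exact: openT.
split=> //; first by move=> U oU; exists U.
by move=> U h x oU Uh Ux; exists U, h; split=> // w.
Qed.

(** ** The point *)

Definition point_space : exploded_space R :=
  @ExplodedSpace R 'rV[R]_0 (fun _ _ => True) (fun _ _ _ _ _ => I)
    (fun _ _ _ _ _ _ _ => I) (fun _ _ _ _ => I) (fun _ _ _ => I)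
    (fun _ _ _ _ _ _ => I) (fun _ _ _ _ => I).

Lemma Cinfty1_point (P : set 'rV[R]_0) U (f : mpoint R 0 0 -> R) : Cinfty1 P U f.
Proof.
have pE (p q : mpoint R 0 0) : p = q.
  case: p q => p1 p2 [q1 q2]; congr pair; first by apply/rowP => -[].
  by apply/funext => -[].
have dE vs (g : R) : exists g' : R,
    dir_derivs vs (fun _ : mpoint R 0 0 => g) = fun _ => g'.
  elim: vs => [|v vs [g' ih]]; first by exists g.
  by exists 0; apply/funext => p; rewrite /= ih /dir_deriv derive1_cst.
have fE : f = fun _ => f (0, fun=> ctr1) by apply/funext => p; congr f; exact: pE.
rewrite {}fE; move: (f _) => {}f vs p Up; have [g ->] := dE vs f.
split=> [v|e e0|delta ss d01 _].
- exact: derivable_cst.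
- by exists [::], 1; split=> // q _ _ _ /=; rewrite subrr normr0.
(* With no strata, the constant monomial 1 serves as weight. With at least one, [e_strat] is the
   identity on a one-point space, so [Delta] vanishes and the empty sum suffices. *)
case: ss => [|s ss].
  exists `|g|, [:: ((fun=> 0), 0)]; split=> [l|].
    rewrite inE => /eqP ->; split=> // v _.
    by rewrite /aff /= big_ord0 addr0.
  exists [::], 1; split=> // q _ _ _ /=; rewrite big_seq1 /mono_val /aff /= !big_ord0 addr0 eqxx.
  by rewrite /mono_coef big_ord0 /cabs /= expr1n expr0n /= addr0 sqrtr1 powR1 mulr1.
exists 0, [::]; split=> [l|]; first by rewrite in_nil.
exists [::], 1; split=> // q _ _ _ /=; rewrite /e_strat /= (pE (toward s q) q) subrr.
by rewrite normr0 mul0r.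
Qed.

Lemma point_charts (b : point_space) : exists n m (P : set 'rV[R]_m)
  (W : set point_space) (phi : point_space -> mpoint R n m), W b /\ is_chart P W phi.
Proof.
have pE (p q : mpoint R 0 0) : p = q.
  case: p q => p1 p2 [q1 q2]; congr pair; first by apply/rowP => -[].
  by apply/funext => -[].
have bE (x y : point_space) : x = y by apply/rowP => -[].
have oV (V : set point_space) : open V.
  have [->|/set0P[x Vx]] := eqVneq V set0; first exact: open0.
  by rewrite (_ : V = setT); [exact: openT | apply/seteqP; split=> // y _; rewrite (bE y x)].
have nbT (p : mpoint R 0 0) V : V p -> model_nbhs setT p V.
  by move=> Vp; exists [::], 1; split=> // q _ _ _; rewrite (pE q p).
exists 0%N, 0%N, setT, setT, (fun _ => (0, fun=> ctr1)); split=> //; split=> //.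
- split; last by exists 0; exact: filterT.
  by exists [::]; apply/seteqP; split.
- by split=> // x y _ _ _; exact: bE.
- by move=> V _; split=> // _; split=> // p; exact: nbT.
move=> V g _ _; split=> // _ p [x Vx xp].
exists ((fun _ : point_space => (0, fun=> ctr1) : mpoint R 0 0) @` V),
  ((fun=> 0), expo (g (0, fun=> ctr1))), (fun q => coef (g q)).
split=> //.
- by split=> // q; exact: nbT.
- by exists x.
- by split; exact: Cinfty1_point.
move=> q _; rewrite (pE (0, fun=> ctr1) q) /mono_coef /aff !big_ord0 /= mulr1 addr0.
by split.
Qed.

Lemma point_countable : @second_countable point_space.
Proof.
exists [set setT]; first exact: countable1.
split=> [_ ->|x U nU]; first exact: openT.
exists setT => // y _; rewrite (_ : y = x); first exact: nbhs_singleton.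
by apply/rowP => -[].
Qed.

Lemma point_hausdorff (x y : point_space) (U : set point_space) :
  open U -> U x -> ~ U y ->
  exists V W : set point_space, [/\ open V, open W, V x, W y & V `&` W = set0].
Proof. by move=> _ + []; rewrite (_ : x = y)//; apply/rowP => -[]. Qed.

Definition point_manifold : exploded_manifold R :=
  ExplodedManifold point_charts point_countable point_hausdorff.

Lemma point_manifold_point : is_point (point_manifold : Expl R).
Proof. by exists (0 : 'rV[R]_0) => b; apply/rowP => -[]. Qed.

Lemma is_point_map (A B : Expl R) (b : eman B) : is_point A ->
  exists u : emap (eman A) (eman B), forall a, u a = b.
Proof.
case=> a0 aE.
have c : continuous (fun _ : eman A => b) by move=> x; exact: cvg_cst.
have p V (g : eman B -> ctr R) : open V -> efun V g ->
    efun ((fun _ : eman A => b) @^-1` V) (g \o (fun _ : eman A => b)).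
  move=> oV _; apply: (@efun_cst R (eman A) _ (g b)).
  by apply: open_comp => // x _; exact: c.
by exists (EMap c p).
Qed.

End OpenSubset.

(** * Open subfamilies *)

Section Subfamilies.
Variables (R : realType) (X : stack R).
Implicit Types (x y z o f : X).

Lemma on_pts_cmp x y z (b : hom y z) (a : hom x y) q :
  on_pts (b \c a) q = on_pts b (on_pts a q).
Proof. by rewrite /on_pts fmor_cmp. Qed.

Lemma on_pts_id x q : on_pts (idm x) q = q.
Proof. by rewrite /on_pts fmor_id. Qed.

Lemma on_pts_cont x y (a : hom x y) : continuous (on_pts a).
Proof. exact: emap_cont. Qed.

(** Both arrows lift the same base map through c, and cartesian lifts are unique. *)
Lemma hom_ext x y (a b : hom x y) (z : X) (c : hom y z) :
  c \c a = c \c b -> (forall q, on_pts a q = on_pts b q) -> a = b.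
Proof.
move=> cab ab.
have e : fmor (F X) a = fmor (F X) b by apply: emap_eq => q; exact: ab.
have [d [_ d1]] := st_cart (esym (fmor_cmp (F X) c b)).
by rewrite -(d1 a) ?(d1 b).
Qed.

(** [st_lift] gives the base of x only up to an equality. Speaking of ranges in y lets that equality
    be eliminated here, so that no cast appears later. *)
Lemma family_restriction y (A : Expl R) (u : @hom (Expl R) A (F X y)) :
  exists x (r : hom x y), forall U : set (pt y), open_embedding u -> range (emap_fun u) = U ->
    subfamily_open r /\ range (on_pts r) = U.
Proof.
have [x [e [r rE]]] := st_lift u; subst A.
exists x, r => U ou ru; move: rE; rewrite /= emap_id_r => rE.
by rewrite /subfamily_open /on_pts rE.
Qed.

Lemma open_subfamily y (V : set (pt y)) : open V ->
  exists x (r : hom x y), subfamily_open r /\ range (on_pts r) = V.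
Proof.
move=> oV; have [x [r h]] :=
  @family_restriction y (sub_manifold oV) (sub_incl oV).
by exists x, r; apply: h; [exact: sub_incl_open | exact: sub_incl_range].
Qed.

Lemma curve_through x (q : pt x) :
  exists f (c : hom f x), is_curve f /\ exists a, on_pts c a = q.
Proof.
have [u uq] := @is_point_map R (point_manifold R) (F X x) q (point_manifold_point R).
have [f [e [c cE]]] := @st_lift R X (point_manifold R) x u.
exists f, c.
have fc : is_curve f by rewrite /is_curve e; exact: point_manifold_point.
split=> //; have [a _] := fc; exists a.
by rewrite /on_pts cE /= uq.
Qed.

Lemma curve_pt f (a b : pt f) : is_curve f -> a = b.
Proof. by case=> c h; rewrite (h a) (h b). Qed.

Lemma curve_lift x y f (r : hom x y) (c : hom f y) (q : pt x) a :
  is_curve f -> on_pts c a = on_pts r q ->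
  exists c' : hom f x, r \c c' = c /\ forall b, on_pts c' b = q.
Proof.
move=> fc ca; have [u uq] := is_point_map (B := F X x) q fc.
have e : @cmp (Expl R) _ _ _ (fmor (F X) r) u = fmor (F X) c.
  apply: emap_eq => b /=; rewrite uq -[LHS]ca.
  by rewrite (curve_pt b a).
have [c' [[rc' c'u] _]] := st_cart e.
by exists c'; split=> // b; rewrite /on_pts c'u uq.
Qed.

Lemma subfamily_inj x y (r : hom x y) : subfamily_open r -> injective (on_pts r).
Proof. by case=> -[]. Qed.

Lemma subfamily_monic x y z (r : hom y z) (a b : hom x y) :
  subfamily_open r -> r \c a = r \c b -> a = b.
Proof.
move=> ro e; apply: (hom_ext e) => q; apply: (subfamily_inj ro).
by rewrite -!on_pts_cmp e.
Qed.

Lemma subfamily_lift x y z (r : hom y z) (a : hom x z) : subfamily_open r ->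
  range (on_pts a) `<=` range (on_pts r) -> exists b : hom x y, r \c b = a.
Proof.
move=> [re _] ar; have [u ru] := embedding_lift re ar.
by have [b [[rb _] _]] := st_cart ru; exists b.
Qed.

Lemma subfamily_id x : subfamily_open (idm x).
Proof. by rewrite /subfamily_open fmor_id; exact: open_embedding_id. Qed.

Lemma subfamily_comp x y z (r : hom y z) (s : hom x y) :
  subfamily_open r -> subfamily_open s -> subfamily_open (r \c s).
Proof. by rewrite /subfamily_open fmor_cmp; exact: open_embedding_comp. Qed.

Lemma subfamily_factor x y z (r : hom y z) (s : hom x y) :
  subfamily_open r -> subfamily_open (r \c s) -> subfamily_open s.
Proof.
by rewrite /subfamily_open fmor_cmp => -[[rinj _ _] _]; exact: open_embedding_factor.
Qed.

Lemma subfamily_image x y (r : hom x y) (U : set (pt x)) :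
  subfamily_open r -> open U -> open (on_pts r @` U).
Proof. exact: open_embedding_image. Qed.

Lemma subfamily_range x y (r : hom x y) : subfamily_open r -> open (range (on_pts r)).
Proof. by case. Qed.

Lemma open_on_pts x y (a : hom x y) (V : set (pt y)) : open V -> open (on_pts a @^-1` V).
Proof. by move=> oV; apply: open_comp => // q _; exact: on_pts_cont. Qed.

Lemma subfamily_pullback x y o (a : hom x y) (r : hom o y) : subfamily_open r ->
  exists w (p : hom w x) (q : hom w o),
    [/\ subfamily_open p, range (on_pts p) = on_pts a @^-1` range (on_pts r) &
        is_pullback a r p q].
Proof.
move=> ro; have [w [p [po pr]]] := open_subfamily (open_on_pts a (subfamily_range ro)).
have [|q qE] := @subfamily_lift w o y r (a \c p) ro.
  move=> _ [t _ <-]; rewrite on_pts_cmp.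
  have : range (on_pts p) (on_pts p t) by exists t.
  by rewrite pr.
exists w, p, q; split=> //; split=> // v p' q' e.
have [|h hE] := @subfamily_lift v w x p p' po.
  rewrite pr => _ [t _ <-]; rewrite /preimage /= -on_pts_cmp e on_pts_cmp.
  by exists (on_pts q' t).
exists h; split=> [|h' [h'p _]]; last by apply: (subfamily_monic po); rewrite hE.
by split=> //; apply: (subfamily_monic ro); rewrite cmp_assoc qE -cmp_assoc hE.
Qed.

End Subfamilies.

Section FamiliesInK.
Variables (R : realType) (K : K_category R).
Local Notation X := (Kst K).

Lemma inK_subfamily (x y : X) (r : hom x y) : subfamily_open r -> inK y -> inK x.
Proof.
move=> ro yK f c fc.
have [i [U [u [d [v [uo ud vo]]]]]] := yK f (r \c c) fc.
have [w [p [q [po pr [pq puniv]]]]] := subfamily_pullback r uo.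
have [d' [[pd' _] _]] := puniv f c d (esym ud).
exists i, w, p, d', (v \c q); split=> //; apply: subfamily_comp => //.
by apply: (subfamily_factor uo); rewrite -pq; exact: subfamily_comp.
Qed.

Lemma Kfam_pullback (x y o w : Kfam K) (a : hom x y) (r : hom o y) (p : hom w x) (q : hom w o) :
  @is_pullback X _ _ _ _ a r p q -> is_pullback a r p q.
Proof. by move=> [pq univ]; split=> // v p' q'; exact: univ. Qed.

Lemma Kfam_subfamily_pullback (x y o : Kfam K) (a : hom x y) (r : hom o y) :
  @subfamily_open _ X _ _ r ->
  exists (w : Kfam K) (p : hom w x) (q : hom w o), is_pullback a r p q.
Proof.
move=> ro; have [w [p [q [po _ pq]]]] := @subfamily_pullback _ X _ _ _ a r ro.
by exists (exist _ w (inK_subfamily po (svalP x))), p, q; exact: Kfam_pullback.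
Qed.

End FamiliesInK.

(** * Weighted branched covers at the points of a family *)

Section BranchedPoints.
Variables (R : realType) (K : K_category R) (I : weighted_branched_cover K).
Local Notation X := (Kst K).
Local Notation D := (full (bdom I)).
Implicit Types (Q U : D).

(** The restriction of branches with its arrow typed in X, so that arrows between objects of
    different full subcategories compose freely. [spull], [rpull], [bspull] and [ipull] serve the
    same end. *)
Definition bpull Q Q' (h : @hom X (sval Q') (sval Q)) : I Q -> I Q' :=
  @bres R K I Q' Q h.

Lemma bpull_id Q i : bpull (idm (sval Q)) i = i.
Proof. exact: bres_id. Qed.

Lemma bpull_cmp Q Q' Q'' (h : @hom X (sval Q') (sval Q))
    (h' : @hom X (sval Q'') (sval Q')) i :
  bpull (Q := Q) (Q' := Q'') (h \c h') i = bpull h' (bpull h i).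
Proof. exact: (@bres_cmp R K I Q'' Q' Q h h' i). Qed.

Lemma bpull_eqv Q Q' (h : @hom X (sval Q') (sval Q)) i j :
  weqv (bpull h i) (bpull h j) -> weqv i j.
Proof. by have [_] := @bres_mor R K I Q' Q h; apply. Qed.

(** The map preserves measure and every point has positive weight, so no fibre is empty. *)
Lemma bpull_surj Q Q' (h : @hom X (sval Q') (sval Q)) (i : I Q') :
  exists j, bpull h j = i.
Proof.
have [+ _] := @bres_mor R K I Q' Q h => /(_ i) mu.
apply: contrapT => /forallNP n; have := wmu_gt0 i; rewrite -mu big_pred0 ?ltxx// => j.
by apply/eqP; exact: n.
Qed.

Lemma weqv_refl (A : wset) (i : A) : weqv i i.
Proof. by have [] := @weqv_equiv A i i i. Qed.

Lemma weqv_sym (A : wset) (i j : A) : weqv i j -> weqv j i.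
Proof. by move=> ij; have [_ /(_ ij) <-] := @weqv_equiv A i j i; exact: weqv_refl. Qed.

Lemma weqv_trans (A : wset) (i j k : A) : weqv i j -> weqv j k -> weqv i k.
Proof. by move=> ij; have [_ /(_ ij) ->] := @weqv_equiv A i j k. Qed.

Lemma curve_connected (f : X) : is_curve f -> connected_family f.
Proof.
case=> a aE; split; first by exists a.
rewrite (_ : [set: _] = [set a]); first exact: connected1.
by apply/seteqP; split=> b //= _; exact: aE.
Qed.

Lemma bdom_curve Q (f : X) (c : hom f (sval Q)) : is_curve f -> bdom I f.
Proof. by move=> fc; exact: (bdom_closed c (svalP Q) (curve_connected fc)). Qed.

Lemma bdom_curve_through Q (q : pt (sval Q)) :
  exists (f : D) (c : @hom X (sval f) (sval Q)),
    is_curve (sval f) /\ exists a, on_pts c a = q.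
Proof.
have [f [c [fc ca]]] := curve_through q.
by exists (exist _ f (bdom_curve c fc)), c.
Qed.

(** The negation of separation, indexed by points of the family; [equiv_atP] shows that the curve
    chosen through q is immaterial. *)
Definition equiv_at Q (q : pt (sval Q)) (i j : I Q) : Prop :=
  exists (f : D) (c : @hom X (sval f) (sval Q)),
    [/\ is_curve (sval f), exists a, on_pts c a = q & weqv (bpull c i) (bpull c j)].

Lemma equiv_atP Q q (i j : I Q) (f : D) (c : @hom X (sval f) (sval Q)) a :
  is_curve (sval f) -> on_pts c a = q ->
  equiv_at q i j <-> weqv (bpull c i) (bpull c j).
Proof.
move=> fc ca; split=> [[g [d [gc [b db] ij]]]|ij]; last first.
  by exists f, c; split=> //; exists a.
have [e [ce _]] := @curve_lift R X (sval f) (sval Q) (sval g) c d a b gc (etrans db (esym ca)).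
move: ij; rewrite -ce !(@bpull_cmp Q f g); exact: bpull_eqv.
Qed.

Lemma equiv_at_refl Q q (i : I Q) : equiv_at q i i.
Proof.
have [f [c [fc [a ca]]]] := bdom_curve_through q.
by apply/(equiv_atP i i fc ca); exact: weqv_refl.
Qed.

Lemma equiv_at_sym Q q (i j : I Q) : equiv_at q i j -> equiv_at q j i.
Proof.
have [f [c [fc [a ca]]]] := bdom_curve_through q.
by move=> /(equiv_atP i j fc ca) ij; apply/(equiv_atP j i fc ca); exact: weqv_sym.
Qed.

Lemma equiv_at_trans Q q (i j k : I Q) :
  equiv_at q i j -> equiv_at q j k -> equiv_at q i k.
Proof.
have [f [c [fc [a ca]]]] := bdom_curve_through q.
move=> /(equiv_atP i j fc ca) ij /(equiv_atP j k fc ca) jk.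
by apply/(equiv_atP i k fc ca); exact: weqv_trans jk.
Qed.

Lemma equiv_at_weqv Q q (i j : I Q) : equiv_at q i j -> weqv i j.
Proof. by case=> f [c [_ _ /bpull_eqv]]. Qed.

Lemma equiv_at_pull Q Q' (h : @hom X (sval Q') (sval Q)) q (i j : I Q) :
  equiv_at q (bpull h i) (bpull h j) <-> equiv_at (on_pts h q) i j.
Proof.
have [f [c [fc [a ca]]]] := bdom_curve_through q.
have hca : on_pts (h \c c) a = on_pts h q by rewrite on_pts_cmp ca.
by rewrite (equiv_atP _ _ fc ca) (equiv_atP _ _ fc hca) -!bpull_cmp.
Qed.

(* I(Q) has no more equivalences than the stalk of I at q. *)
Definition central Q (q : pt (sval Q)) := forall i j : I Q, weqv i j -> equiv_at q i j.

(** On the neighbourhood given by [b_local], the inverse of restriction to the curve is itself a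
    morphism, and so turns equivalence over U into equivalence at the curve. *)
Lemma central_nbhs Q (q : pt (sval Q)) : exists U (u : @hom X (sval U) (sval Q)) q',
  [/\ subfamily_open u, on_pts u q' = q & central q'].
Proof.
have [f [c [fc [a ca]]]] := bdom_curve_through q.
have [U [u [d [uo ud [dm [d' [d'm dK _]]]]]]] := @b_local R K I f Q c fc.
exists U, u, (on_pts d a); split=> //.
  by rewrite -on_pts_cmp [@cmp X _ _ _ u d]ud.
move=> i j ij; apply/(@equiv_atP U _ i j f d a fc erefl).
by apply: d'm.2; rewrite !dK.
Qed.

Lemma central_sub Q Q' (h : @hom X (sval Q') (sval Q)) q :
  central (on_pts h q) -> central q.
Proof.
move=> cq i j; have [i' <-] := bpull_surj h i; have [j' <-] := bpull_surj h j.
by move=> /bpull_eqv /cq /equiv_at_pull.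
Qed.

(** Equivalence at a point near q gives equivalence over a central neighbourhood of q, hence at q
    itself; so inequivalence is open. *)
Lemma closed_equiv_at Q (i j : I Q) : closed [set q | equiv_at q i j].
Proof.
rewrite -openC openE => q nq; rewrite /interior nbhsE.
have [U [u [q' [uo uq cU]]]] := central_nbhs q.
exists (range (on_pts u)); first by split; [exact: subfamily_range | exists q'].
move=> _ [t _ <-] /= /equiv_at_pull /equiv_at_weqv /cU /equiv_at_pull.
by rewrite uq.
Qed.

End BranchedPoints.

(** * Sections over the domain of a branched cover *)

Section BranchedGluing.
Variables (R : realType) (K : K_category R) (I : weighted_branched_cover K).
Local Notation X := (Kst K).
Implicit Types (Q U : bK I).

Lemma bK_nbhs (x : X) (q : pt x) (V : set (pt x)) : inK x -> open V -> V q ->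
  exists Q (h : @hom X (sval Q) x),
    [/\ subfamily_open h, range (on_pts h) q & range (on_pts h) `<=` V].
Proof.
move=> xK oV Vq; have [z [r [ro rV]]] := open_subfamily oV.
have zK := inK_subfamily ro xK.
have [J [v [s [[so sc] vd]]]] := bdom_cover I zK.
have [q' _ rq] : range (on_pts r) q by rewrite rV.
have [k [a sa]] := sc q'.
have oK : inK (v k) := inK_subfamily (so k) zK.
exists (exist _ (v k) (conj (vd k) oK)), (r \c s k); split.
- exact: (subfamily_comp ro (so k)).
- by exists a => //; rewrite on_pts_cmp -rq; congr on_pts.
by move=> _ [t _ <-]; rewrite on_pts_cmp -rV; exists (on_pts (s k) t).
Qed.

Variable S : presheaf (Kfam K).

Definition spull (x y : Kfam K) (h : @hom X (sval x) (sval y)) : S y -> S x :=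
  @res _ S x y h.

Lemma spull_cmp (x y z : Kfam K) (h : @hom X (sval y) (sval z))
    (h' : @hom X (sval x) (sval y)) s :
  spull (x := x) (y := z) (h \c h') s = spull h' (spull h s).
Proof. exact: (@res_cmp _ S x y z h h'). Qed.

Definition rpull Q (x : Kfam K) (c : @hom X (sval Q) (sval x)) : S x -> S (bK_fam Q) :=
  spull (x := bK_fam Q) c.

Definition bspull Q Q' (h : @hom X (sval Q') (sval Q)) :
    S (bK_fam Q) -> S (bK_fam Q') :=
  spull (x := bK_fam Q') (y := bK_fam Q) h.

Definition ipull Q Q' (h : @hom X (sval Q') (sval Q)) : I (bK_dom Q) -> I (bK_dom Q') :=
  bpull (Q := bK_dom Q) (Q' := bK_dom Q') h.

Lemma rpull_cmp Q Q' (x : Kfam K) (c : @hom X (sval Q) (sval x))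
    (h : @hom X (sval Q') (sval Q)) s : rpull (c \c h) s = bspull h (rpull c s).
Proof. exact: (@spull_cmp (bK_fam Q') (bK_fam Q) x c h). Qed.

Lemma rpull_spull Q (x y : Kfam K) (c : @hom X (sval Q) (sval x))
    (a : @hom X (sval x) (sval y)) s : rpull c (spull a s) = rpull (a \c c) s.
Proof. by rewrite /rpull -[LHS]spull_cmp. Qed.

Lemma bspull_cmp Q Q' Q'' (h : @hom X (sval Q') (sval Q))
    (h' : @hom X (sval Q'') (sval Q')) s : bspull (h \c h') s = bspull h' (bspull h s).
Proof. exact: (@spull_cmp (bK_fam Q'') (bK_fam Q') (bK_fam Q) h h'). Qed.

Lemma ipull_id Q i : ipull (idm (sval Q)) i = i.
Proof. exact: bpull_id. Qed.

Lemma ipull_cmp Q Q' Q'' (h : @hom X (sval Q') (sval Q))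
    (h' : @hom X (sval Q'') (sval Q')) i : ipull (h \c h') i = ipull h' (ipull h i).
Proof. exact: (@bpull_cmp _ _ _ (bK_dom Q) (bK_dom Q') (bK_dom Q'') h h'). Qed.

Hypothesis Ssheaf : is_sheaf S.

Lemma S_separated (x : Kfam K) (s t : S x) :
  (forall q : pt (sval x), exists Q (h : @hom X (sval Q) (sval x)),
    [/\ subfamily_open h, range (on_pts h) q &
        rpull h s = rpull h t]) -> s = t.
Proof.
move=> st.
have /choice[f fP] q : exists Oh : {Q : bK I & @hom X (sval Q) (sval x)},
    [/\ subfamily_open (projT2 Oh), range (on_pts (projT2 Oh)) q &
      rpull (projT2 Oh) s = rpull (projT2 Oh) t].
  by have [Q [h hP]] := st q; exists (existT _ Q h).
pose o q := bK_fam (projT1 (f q)).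
pose r q : @hom (Kfam K) (o q) x := projT2 (f q).
have cov : K_open_cover r.
  split=> [q|q]; first by have [] := fP q.
  by have [_ [a _ aq] _] := fP q; exists q, a.
have [|u [uE uniq]] := Ssheaf cov (s := fun q => spull (r q) s).
  move=> k l w p q [pq _]; rewrite -[LHS]spull_cmp -[RHS]spull_cmp.
  by congr spull.
rewrite -(uniq s) ?(uniq t)// => q.
by have [_ _ e] := fP q; exact: esym e.
Qed.

(** The overlaps in [is_sheaf] need not be connected, so they may carry no branches. The descent
    datum is therefore a functional relation on objects of [bK], and agreement on overlaps is tested
    on such objects. *)
Lemma S_glue (x : Kfam K)
    (rho : forall Q, @hom X (sval Q) (sval x) -> S (bK_fam Q) -> Prop) :
  (forall Q c s t, @rho Q c s -> @rho Q c t -> s = t) ->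
  (forall Q c s, @rho Q c s -> forall Q' (h : @hom X (sval Q') (sval Q)),
    @rho Q' (c \c h) (bspull h s)) ->
  (forall q : pt (sval x), exists Q c s,
    [/\ subfamily_open c, range (on_pts c) q & @rho Q c s]) ->
  exists s : S x, forall Q c t, @rho Q c t -> rpull c s = t.
Proof.
move=> runiq rnat rex.
have /choice[f fP] q : exists Ocs : {Q : bK I & @hom X (sval Q) (sval x) * S (bK_fam Q)}%type,
    [/\ subfamily_open (projT2 Ocs).1, range (on_pts (projT2 Ocs).1) q &
      rho _ (projT2 Ocs).1 (projT2 Ocs).2].
  by have [Q [c [s csP]]] := rex q; exists (existT _ Q (c, s)).
pose o q := bK_fam (projT1 (f q)).
pose r q : @hom (Kfam K) (o q) x := (projT2 (f q)).1.
have cov : K_open_cover r.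
  split=> [q|q]; first by have [] := fP q.
  by have [_ [a _ aq] _] := fP q; exists q, a.
have [|u [uE _]] := Ssheaf cov (s := fun q => (projT2 (f q)).2).
  move=> k l w p q [pq _].
  apply: S_separated => t.
  have [Q [h [ho th _]]] := bK_nbhs (q := t) (svalP w) openT Logic.I.
  exists Q, h; split=> //; rewrite [LHS](@rpull_spull _ _ (o k)) [RHS](@rpull_spull _ _ (o l)).
  have [_ _ rk] := fP k; have [_ _ rl] := fP l.
  have rk' := rnat _ _ _ rk Q (@cmp X _ _ _ p h).
  have rl' := rnat _ _ _ rl Q (@cmp X _ _ _ q h).
  apply: runiq rk' _; rewrite cmp_assoc.
  by rewrite [@cmp X _ _ _ _ p]pq -cmp_assoc.
exists u => Q c t ct; apply: S_separated => a.
have := uE (on_pts c a); have := fP (on_pts c a); rewrite /r /o.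
case: (f _) => Q0 [r0 s0] /= [r0o [b _ ba] r0s0] us0.
have oV : open (on_pts c @^-1` range (on_pts r0)).
  by apply: open_on_pts; exact: subfamily_range.
have [|Q' [h [ho ha hV]]] := bK_nbhs (q := a) (svalP (bK_fam Q)) oV; first by exists b.
have [|d dE] := @subfamily_lift _ X (sval Q') _ _ _ (@cmp X _ _ _ c h) r0o.
  by move=> _ [e _ <-]; rewrite on_pts_cmp; apply: hV; exists e.
exists Q', h; split=> //.
rewrite -[LHS](rpull_cmp c h) -dE (rpull_cmp r0 d) [X in bspull d X]us0.
apply: (runiq Q' (@cmp X _ _ _ c h)); last exact: rnat.
by rewrite -dE; exact: rnat.
Qed.

End BranchedGluing.

(** * Systems of local sections *)

(* A presheaf of sets on the domain of the cover, whose elements over Q are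
   equipped with a map from the points of Q to a space T. *)
Record fibration (R : realType) (K : K_category R) (I : weighted_branched_cover K)
    (T : topologicalType) := Fibration {
  fib :> bK I -> Type;
  fpull : forall Q Q' : bK I, @hom (Kst K) (sval Q') (sval Q) -> fib Q -> fib Q';
  fpull_cmp : forall (Q Q' Q'' : bK I) (h : @hom (Kst K) (sval Q') (sval Q))
    (h' : @hom (Kst K) (sval Q'') (sval Q')) d,
    fpull (h \c h') d = fpull h' (fpull h d);
  fpt : forall Q : bK I, fib Q -> pt (sval Q) -> T;
  fpt_open : forall (Q : bK I) (d : fib Q) V, open V -> open (fpt d @^-1` V);
  fpt_pull : forall (Q Q' : bK I) (h : @hom (Kst K) (sval Q') (sval Q)) d t,
    fpt (fpull h d) t = fpt d (on_pts h t) }.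

Arguments fpull {R K I T} _ {Q Q'} _ _.
Arguments fpt {R K I T _ Q} _ _.

Section Systems.
Variables (R : realType) (K : K_category R) (I : weighted_branched_cover K).
Local Notation X := (Kst K).
Variables (T : topologicalType) (D : fibration I T) (S : presheaf (Kfam K)).
Hypothesis Ssheaf : is_sheaf S.
Implicit Types (Q : bK I) (V : set T).

(* [None] where the system is not defined. *)
Definition system := forall Q, D Q -> option (S (bK_fam Q)).
Implicit Types (s t : system).

Definition lands Q (d : D Q) V := forall q, V (fpt d q).

Definition sys_on V s := forall Q (d : D Q), lands d V ->
  exists a, s Q d = Some a /\
    forall Q' (h : @hom X (sval Q') (sval Q)), s Q' (fpull D h d) = Some (bspull h a).

Definition sys_agr V s t := forall Q (d : D Q), lands d V -> s Q d = t Q d.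

Lemma lands_sub Q (d : D Q) U V : U `<=` V -> lands d U -> lands d V.
Proof. by move=> UV h q; exact: UV. Qed.

Lemma lands_pull Q Q' (h : @hom X (sval Q') (sval Q)) (d : D Q) V :
  lands d V -> lands (fpull D h d) V.
Proof. by move=> dV q; rewrite fpt_pull. Qed.

Lemma lands_nbhs Q (d : D Q) (q : pt (sval Q)) V : open V -> V (fpt d q) ->
  exists Q' (h : @hom X (sval Q') (sval Q)),
    [/\ subfamily_open h, range (on_pts h) q & lands (fpull D h d) V].
Proof.
move=> oV Vq.
have [Q' [h [ho hq hV]]] := bK_nbhs I (q := q) (svalP (bK_fam Q)) (fpt_open d oV) Vq.
by exists Q', h; split=> // t; rewrite fpt_pull; apply: hV; exists t.
Qed.

Lemma sys_pull V s Q (d : D Q) a : sys_on V s -> lands d V -> s Q d = Some a ->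
  forall Q' (h : @hom X (sval Q') (sval Q)), s Q' (fpull D h d) = Some (bspull h a).
Proof. by move=> sV dV sd Q' h; have [b [+ bP]] := sV Q d dV; rewrite sd => -[->]. Qed.

Variable extra : set T -> system -> Prop.
Hypothesis extra_sub : forall U V s, V `<=` U -> extra U s -> extra V s.
Hypothesis extra_glue : forall (J : Type) (V : J -> set T) (s : J -> system) (t : system),
  (forall k, open (V k)) -> (forall k, sys_on (V k) (s k)) ->
  (forall k, extra (V k) (s k)) -> sys_on (\bigcup_k V k) t ->
  (forall k, sys_agr (V k) (s k) t) -> extra (\bigcup_k V k) t.

Definition sys_sec V s := sys_on V s /\ extra V s.

Lemma sys_sec_sub U V s : V `<=` U -> sys_sec U s -> sys_sec V s.
Proof.
move=> VU [sU eU]; split; last exact: extra_sub eU.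
by move=> Q d dV; apply: sU; exact: lands_sub dV.
Qed.

Lemma sys_agr_sub U V s t : V `<=` U -> sys_agr U s t -> sys_agr V s t.
Proof. by move=> VU st Q d dV; apply: st; exact: lands_sub dV. Qed.

Lemma sys_agr_sym V s t : sys_agr V s t -> sys_agr V t s.
Proof. by move=> st Q d dV; rewrite st. Qed.

Lemma sys_agr_trans V s t u : sys_agr V s t -> sys_agr V t u -> sys_agr V s u.
Proof. by move=> st tu Q d dV; rewrite st// tu. Qed.

Lemma sys_agr_loc (J : Type) (V : J -> set T) s t : (forall k, open (V k)) ->
  sys_sec (\bigcup_k V k) s -> sys_sec (\bigcup_k V k) t ->
  (forall k, sys_agr (V k) s t) -> sys_agr (\bigcup_k V k) s t.
Proof.
move=> oV [sV _] [tV _] st Q d dV.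
have [a [sa aP]] := sV Q d dV; have [b [tb bP]] := tV Q d dV.
rewrite sa tb; congr Some; apply: (S_separated Ssheaf (I := I)) => q.
have [k _ Vq] := dV q; have [Q' [h [ho hq hV]]] := lands_nbhs (oV k) Vq.
exists Q', h; split=> //; have := aP Q' h.
by rewrite (st k _ _ hV) (bP Q' h) => -[].
Qed.

Lemma sys_glue (J : Type) (V : J -> set T) (s : J -> system) :
  (forall k, open (V k)) -> (forall k, sys_sec (V k) (s k)) ->
  (forall k l, sys_agr (V k `&` V l) (s k) (s l)) ->
  exists t, sys_sec (\bigcup_k V k) t /\ forall k, sys_agr (V k) (s k) t.
Proof.
move=> oV sV sst.
pose rho Q (d : D Q) Q' (h : @hom X (sval Q') (sval Q)) (a : S (bK_fam Q')) :=
  exists k, lands (fpull D h d) (V k) /\ s k Q' (fpull D h d) = Some a.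
(* The value at d is characterized by its restrictions to objects landing in a single [V k]; these
   cover d and determine the value. *)
pose glued Q (d : D Q) a := lands d (\bigcup_k V k) /\
  forall Q' (h : @hom X (sval Q') (sval Q)) b, rho Q d Q' h b -> bspull h a = b.
have runiq Q (d : D Q) Q' h a b : rho Q d Q' h a -> rho Q d Q' h b -> a = b.
  move=> [k [kV ka]] [l [lV lb]]; move: ka.
  by rewrite (sst k l) ?lb => [[]|q]; [| split; [exact: kV | exact: lV]].
have rnat Q (d : D Q) Q' h a : rho Q d Q' h a ->
    forall Q'' h', rho Q d Q'' (h \c h') (bspull h' a).
  move=> [k [kV ka]] Q'' h'; exists k; rewrite fpull_cmp; split; first exact: lands_pull.
  exact: sys_pull (sV k).1 kV ka _ _.
have rex Q (d : D Q) : lands d (\bigcup_k V k) -> forall q, exists Q' h a,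
    [/\ subfamily_open h, range (on_pts h) q & rho Q d Q' h a].
  move=> dV q; have [k _ Vq] := dV q; have [Q' [h [ho hq hV]]] := lands_nbhs (oV k) Vq.
  have [a [sa _]] := (sV k).1 Q' _ hV.
  by exists Q', h, a; split=> //; exists k.
have gex Q (d : D Q) : lands d (\bigcup_k V k) -> exists a, glued Q d a.
  move=> dV; have [a aP] := S_glue Ssheaf (x := bK_fam Q) (runiq Q d) (rnat Q d) (rex Q d dV).
  by exists a; split.
have guniq Q (d : D Q) a b : glued Q d a -> glued Q d b -> a = b.
  move=> [dV ga] [_ gb]; apply: (S_separated Ssheaf (I := I)) => q.
  have [Q' [h [c [ho hq hc]]]] := rex Q d dV q.
  by exists Q', h; split=> //; rewrite [LHS](ga Q' h c hc) [RHS](gb Q' h c hc).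
have gnat Q (d : D Q) a Q' h : glued Q d a -> glued Q' (fpull D h d) (bspull h a).
  move=> [dV ga]; split; first exact: lands_pull.
  move=> Q'' h' b [k [kV kb]]; rewrite -bspull_cmp; apply: ga.
  by exists k; rewrite fpull_cmp.
pose t : system := fun Q d => if pselect (exists a, glued Q d a) is left e
  then Some (sval (cid e)) else None.
have tE Q (d : D Q) a : glued Q d a -> t Q d = Some a.
  move=> ga; rewrite /t; case: pselect => [e|[]]; last by exists a.
  by congr Some; apply: guniq ga; case: cid.
have ton : sys_on (\bigcup_k V k) t.
  move=> Q d dV; have [a ga] := gex Q d dV; exists a; split; first exact: tE.
  by move=> Q' h; apply: tE; exact: gnat.
have st k : sys_agr (V k) (s k) t.
  move=> Q d dV; have [a [sa aP]] := (sV k).1 Q d dV; rewrite sa; symmetry; apply: tE.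
  split; first by move=> q; exists k => //; exact: dV.
  move=> Q' h b [l [lV lb]]; have := aP Q' h.
  by rewrite (sst k l) ?lb => [[]|q]; [| split; [exact: lands_pull | exact: lV]].
exists t; split=> //; split=> //.
by apply: extra_glue st => // k; have [] := sV k.
Qed.

Definition sys_sections : section_system T :=
  SectionSystem sys_sec_sub sys_agr_sub (fun _ _ _ _ _ => erefl)
    sys_agr_sym sys_agr_trans sys_agr_loc sys_glue.

End Systems.

Section Requirements.
Variables (R : realType) (K : K_category R) (I : weighted_branched_cover K).
Local Notation X := (Kst K).
Variables (T : topologicalType) (D : fibration I T) (S : presheaf (Kfam K)).
Hypothesis Ssheaf : is_sheaf S.

(* [req d a] forces every section to take the value a at d. *)
Variable req : forall Q : bK I, D Q -> S (bK_fam Q) -> Prop.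
Hypothesis req_pull : forall (Q Q' : bK I) (h : @hom X (sval Q') (sval Q)) d a,
  @req Q d a -> @req Q' (fpull D h d) (bspull h a).

Definition meets (V : set T) (s : system D S) :=
  forall Q (d : D Q) a, lands d V -> req d a -> s Q d = Some a.

Lemma meets_sub (U V : set T) s : V `<=` U -> meets U s -> meets V s.
Proof. by move=> VU sU Q d a dV; apply: sU; exact: lands_sub dV. Qed.

Lemma meets_glue (J : Type) (V : J -> set T) (s : J -> system D S) (t : system D S) :
  (forall k, open (V k)) -> (forall k, sys_on (V k) (s k)) ->
  (forall k, meets (V k) (s k)) -> sys_on (\bigcup_k V k) t ->
  (forall k, sys_agr (V k) (s k) t) -> meets (\bigcup_k V k) t.
Proof.
move=> oV _ sV tV st Q d a dV da.
have [b [-> bP]] := tV Q d dV; congr Some.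
apply: (S_separated Ssheaf (I := I)) => q.
have [k _ Vq] := dV q; have [Q' [h [ho hq hV]]] := lands_nbhs (oV k) Vq.
exists Q', h; split=> //; have := bP Q' h.
by rewrite -(st k _ _ hV) (sV k _ _ _ hV (req_pull h da)) => -[].
Qed.

End Requirements.

(** * Softness of the sheaf of sections of S over one family, subject to requirements *)

Section FamilySystems.
Variables (R : realType) (K : K_category R) (I : weighted_branched_cover K).
Local Notation X := (Kst K).
Variables (S : presheaf (Kfam K)) (Ssheaf : is_sheaf S) (Spatch : patching S).
Variable u : Kfam K.
Implicit Types (Q : bK I).

Definition family_fib : fibration I (pt (sval u)).
Proof.
refine (@Fibration R K I (pt (sval u)) (fun Q => @hom X (sval Q) (sval u))
  (fun Q Q' h b => b \c h) _ (fun Q b => on_pts b) _ _).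
- by move=> Q Q' Q'' h h' d; rewrite cmp_assoc.
- by move=> Q d V; exact: open_on_pts.
- by move=> Q Q' h d t; rewrite on_pts_cmp.
Defined.

Variable req : forall Q, family_fib Q -> S (bK_fam Q) -> Prop.
Hypothesis req_pull : forall Q Q' (h : @hom X (sval Q') (sval Q)) d a,
  @req Q d a -> @req Q' (fpull family_fib h d) (bspull h a).

Definition family_sections : section_system (pt (sval u)) :=
  sys_sections Ssheaf (@meets_sub _ _ _ _ _ _ req) (meets_glue Ssheaf req_pull).

Variable s0 : S u.
Hypothesis s0P : forall Q (b : @hom X (sval Q) (sval u)) a, @req Q b a -> rpull b s0 = a.

(** Patch s over A with [s0] over the complement of the closure of a neighbourhood N of C. Both
    pieces meet the requirements, so the patched section does; over N the second piece is empty, so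
    s is unchanged there. *)
Lemma family_soft : @soft_on _ family_sections setT.
Proof.
split; first exact: openT.
move=> C A s cC oA CA; rewrite !setIT => -[sA mA].
have Treg : regular_space (pt (sval u)) by exact: exploded_regular.
have [N [oN CN NA]] := closed_shrink Treg (@eman_countable _ _) cC oA CA.
have oB : open (~` closure N) by exact/closed_openC/closed_closure.
have [xA [rA [rAo rAA]]] := open_subfamily oA.
have [xB [rB [rBo rBB]]] := open_subfamily oB.
pose o (k : bool) : Kfam K := if k then exist _ xA (inK_subfamily rAo (svalP u))
  else exist _ xB (inK_subfamily rBo (svalP u)).
pose r (k : bool) : @hom (Kfam K) (o k) u :=
  if k as k return @hom (Kfam K) (o k) u then rA else rB.
have landA Q (c : @hom X (sval Q) xA) : lands (D := family_fib) (Q := Q) (rA \c c) A.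
  move=> q; rewrite /fpt /= on_pts_cmp -[X in X _]rAA.
  by exists (on_pts c q).
have [sigma sigmaP] : exists a : S (o true), forall Q c b,
    s Q (rA \c c) = Some b -> rpull (x := o true) c a = b.
  apply: (S_glue Ssheaf (x := o true) (I := I)
    (rho := fun Q (c : @hom X (sval Q) (sval (o true))) b => s Q (rA \c c) = Some b)).
  - by move=> Q c a b -> [].
  - move=> Q c a ca Q' h; rewrite cmp_assoc.
    exact: (sys_pull sA (landA Q c) ca h).
  - move=> q; have [Q [c [co cq _]]] := bK_nbhs I (q := q) (svalP (o true)) openT Logic.I.
    by have [a [ca _]] := sA Q _ (landA Q c); exists Q, c, a.
pose th k : S (o k) := if k as k return S (o k) then sigma else spull (x := o false) rB s0.
have cov : K_open_cover r.
  split=> [[]|q]; [exact: rAo | exact: rBo |].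
  have [Aq|nAq] := pselect (A q).
    have [a _ aq] : range (on_pts rA) q by rewrite rAA.
    by exists true, a.
  have [a _ aq] : range (on_pts rB) q by rewrite rBB => /NA.
  by exists false, a.
have [t tP] := Spatch cov th.
(* The conclusion of the Patching Axiom restated on objects of [bK]: a candidate that agrees with s
   over A and with [s0] over the other piece is the pullback of t. *)
have tPA Q (b : @hom X (sval Q) (sval u)) a :
    (forall Q' (h : @hom X (sval Q') (sval Q)), lands (D := family_fib) (Q := Q') (b \c h) A ->
       s Q' (b \c h) = Some (bspull h a)) ->
    (forall (w : Kfam K) (p : @hom X (sval w) (sval Q)) (q : @hom X (sval w) xB),
       b \c p = rB \c q -> spull (y := bK_fam Q) p a = spull (x := w) (rB \c q) s0) ->
    rpull b t = a.
  move=> hA hB; apply: (tP (bK_fam Q) b a) => -[] w p q [pq _]; last first.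
    by rewrite [LHS](hB w p q pq) [LHS](@spull_cmp _ _ S w (o false) u rB q).
  apply: (S_separated Ssheaf (I := I)) => z.
  have [Q' [h [ho hz _]]] := bK_nbhs I (q := z) (svalP w) openT Logic.I.
  exists Q', h; split=> //.
  rewrite [LHS](@rpull_spull _ _ _ _ _ w (bK_fam Q)) [RHS](@rpull_spull _ _ _ _ _ w (o true)).
  symmetry; apply: sigmaP.
  have e : rA \c @cmp X _ _ _ q h = b \c @cmp X _ _ _ p h.
    by rewrite !cmp_assoc; congr (_ \c _); exact: esym pq.
  have l := landA Q' (@cmp X _ _ _ q h); rewrite e in l.
  by rewrite [X in s Q' X]e; exact: hA l.
exists (fun Q b => Some (rpull b t)), N; split=> //.
- by move=> x Nx; exact/NA/subset_closure.
- split=> [Q b _|Q b a _ ba].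
    by exists (rpull b t); split=> // Q' h; rewrite -rpull_cmp.
  congr Some; apply: tPA => [Q' h l|w p q e].
    exact: mA l (req_pull h ba).
  rewrite -e -(s0P ba); symmetry; exact: (@spull_cmp _ _ S w (bK_fam Q) u b p).
move=> Q b bN; have bA : lands (D := family_fib) b A.
  by move=> q; apply/NA/subset_closure/bN.
have [a [ba aP]] := sA Q b bA; rewrite ba; congr Some; symmetry; apply: tPA.
  by move=> Q' h _; exact: aP.
(* A point of w would lie both in N and outside its closure; w is empty and S is separated, so any
   two sections over w agree. *)
move=> w p q e; apply: (S_separated Ssheaf (I := I)) => z; exfalso.
have := bN (on_pts p z); rewrite /fpt /= -on_pts_cmp e on_pts_cmp => /subset_closure.
by have : range (on_pts rB) (on_pts rB (on_pts q z)) by [exists (on_pts q z)]; rewrite rBB.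
Qed.

End FamilySystems.

(** * Equivariant sections *)

Lemma open_forall (T : topologicalType) (J : finType) (V : J -> set T) :
  (forall j, open (V j)) -> open [set z | forall j, V j z].
Proof.
move=> oV; rewrite (_ : mkset _ = ~` \bigcup_(j in [set: J]) ~` V j).
  apply/closed_openC/closed_bigcup => [|j _]; first exact: finite_finset.
  exact: open_closedC.
apply/seteqP; split=> z h; first by case=> j _; exact.
by move=> j; apply: contrapT => nV; apply: h; exists j.
Qed.

(** A second topology on T itself instead of a quotient. Points of one orbit become
    indistinguishable, which regularity in the present sense allows, and no descent of maps is
    needed. *)
Definition orbit_space (T : topologicalType) (G : finGroupType) (act : G -> T -> T) : Type := T.

Section OrbitSpace.
Variables (T : topologicalType) (G : finGroupType) (act : G -> T -> T).

HB.instance Definition _ := Choice.copy (orbit_space act) T.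

Definition orbit_open (V : set (orbit_space act)) :=
  @open T V /\ forall g x, V x -> V (act g x).

Lemma orbit_openT : orbit_open setT.
Proof. by split=> //; exact: openT. Qed.

Lemma orbit_openI : setI_closed orbit_open.
Proof.
move=> U V [oU hU] [oV hV]; split; first exact: openI.
by move=> g x [Ux Vx]; split; [exact: hU | exact: hV].
Qed.

Lemma orbit_open_bigU (J : Type) (V : J -> set (orbit_space act)) :
  (forall k, orbit_open (V k)) -> orbit_open (\bigcup_k V k).
Proof.
move=> oV; split; first by apply: (@bigcup_open T) => k _; have [] := oV k.
by move=> g x [k _ Vx]; exists k => //; have [_] := oV k; apply.
Qed.

HB.instance Definition _ := isOpenTopological.Build (orbit_space act)
  orbit_openT orbit_openI orbit_open_bigU.

Hypothesis act1 : forall x, act 1%g x = x.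
Hypothesis actM : forall g h x, act (g * h)%g x = act g (act h x).
Hypothesis act_cont : forall g, continuous (act g).

Lemma orbit_saturate (V : set T) : open V ->
  orbit_open [set x | exists g, V (act g x)].
Proof.
move=> oV; split.
  rewrite (_ : mkset _ = \bigcup_g (act g @^-1` V)).
    by apply: bigcup_open => g _; apply: open_comp => // x _; exact: act_cont.
  by apply/seteqP; split=> x; [case=> g ?; exists g | case=> g _ ?; exists g].
by move=> h x [g Vx]; exists (g * h^-1)%g; rewrite -actM mulgKV.
Qed.

Lemma orbit_regular : regular_space T -> regular_space (orbit_space act).
Proof.
move=> Treg x U0 nU0.
have [U [[oU Uinv] Ux] UU0] : exists2 U, open_nbhs (x : orbit_space act) U & U `<=` U0.
  by move: nU0; rewrite nbhsE.
have [N [oN Nx NU]] := regular_shrink Treg oU Ux.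
have oM : orbit_open [set z | forall g, ~ closure N (act g z)].
  split; last by move=> h z Mz g; rewrite -actM; exact: Mz.
  apply: (open_forall (V := fun g => act g @^-1` (~` closure N))) => g.
  apply: open_comp => [z _|]; first exact: act_cont.
  exact/closed_openC/closed_closure.
exists [set z | exists g, N (act g z)].
  apply: open_nbhs_nbhs; split; first exact: orbit_saturate.
  by exists 1%g; rewrite act1.
move=> z clz; apply: UU0; apply: contrapT => nUz.
have [|t [[g Nt] Mt]] := clz [set z | forall g, ~ closure N (act g z)].
  apply: open_nbhs_nbhs; split=> // g /NU Ugz; apply: nUz.
  by rewrite -(act1 z) -(mulVg g) actM; exact: Uinv.
by apply: (Mt g); exact: subset_closure.
Qed.

Lemma orbit_second_countable : @second_countable T -> @second_countable (orbit_space act).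
Proof.
move=> /second_countable_seq[b [bo bP]].
exists (range (fun n => [set x | exists g, b n (act g x)] : set (orbit_space act))).
  by apply: (@sub_countable _ _ _ setT (card_image_le _ _)); exact: countableP.
split=> [_ [n _ <-]|x U nU]; first exact: orbit_saturate.
have [V [[oV Vinv] Vx] VU] : exists2 V, open_nbhs (x : orbit_space act) V & V `<=` U.
  by move: nU; rewrite nbhsE.
have [n [bx bV]] := bP x V oV Vx.
exists [set x | exists g, b n (act g x)].
  by split; [exists n | exists 1%g; rewrite act1].
move=> z [g /bV Vgz]; apply: VU.
by rewrite -(act1 z) -(mulVg g) actM; exact: Vinv.
Qed.

End OrbitSpace.

Section EquivariantSections.
Variables (R : realType) (K : K_category R) (I : weighted_branched_cover K).
Local Notation X := (Kst K).
Variables (S : presheaf (Kfam K)) (Ssheaf : is_sheaf S) (Spatch : patching S).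
Variables (y : Kfam K) (G : finGroupType) (al : action_on G y).
Local Notation branched := (branched_section I S).
Local Notation alh g := (act_hom al g : @hom X (sval y) (sval y)).

(* Whenever [compat c t] holds, the section to be built has to pull back to t
   along c. *)
Variable compat : forall x : Kfam K, @hom X (sval x) (sval y) -> branched x -> Prop.
Hypothesis compat_pull : forall (x x' : Kfam K) (c : @hom X (sval x) (sval y))
  (b : @hom X (sval x') (sval x)) t,
  compat c t -> compat (x := x') (c \c b) (branched_pull (x := x') b t).
Hypothesis compat_act : forall (x : Kfam K) (c : @hom X (sval x) (sval y)) t g,
  compat c t -> compat (x := x) (alh g \c c) t.
Hypothesis compat_loc : forall q : pt (sval y),
  exists (o : Kfam K) (r : @hom X (sval o) (sval y)) (tau : branched o),
    [/\ subfamily_open r, range (on_pts r) q &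
      forall (x : Kfam K) (b : @hom X (sval x) (sval o)) t,
        compat (x := x) (r \c b) t -> branched_pull (x := x) b tau = t].
Implicit Types (Q : bK I).

Definition act (g : G) : pt (sval y) -> pt (sval y) := on_pts (alh g).

Lemma act1 x : act 1%g x = x.
Proof. by rewrite /act act_hom1 on_pts_id. Qed.

Lemma actM g h x : act (g * h)%g x = act g (act h x).
Proof. by rewrite /act act_homM [LHS]on_pts_cmp. Qed.

Lemma actK g x : act g^-1%g (act g x) = x.
Proof. by rewrite -actM mulVg act1. Qed.

Lemma actVK g x : act g (act g^-1%g x) = x.
Proof. by rewrite -actM mulgV act1. Qed.

Lemma act_cont g : continuous (act g).
Proof. exact: on_pts_cont. Qed.

Lemma open_act g (V : set (pt (sval y))) : open V -> open (act g @^-1` V).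
Proof. exact: open_on_pts. Qed.

Local Notation Y := (orbit_space act).

(** A branched section assigns a section of S to each pair of an arrow into y and a branch over its
    source. Points are sent to [Y], so that only invariant open sets occur as domains. *)
Definition cover_fib : fibration I Y.
Proof.
refine (@Fibration R K I Y
  (fun Q => (@hom X (sval Q) (sval y) * I (bK_dom Q))%type)
  (fun Q Q' h d => (d.1 \c h, ipull h d.2)) _ (fun Q d => on_pts d.1) _ _).
- by move=> Q Q' Q'' h h' d; rewrite cmp_assoc ipull_cmp.
- by move=> Q d V [oV _]; exact: open_on_pts.
- by move=> Q Q' h d t; rewrite on_pts_cmp.
Defined.

Local Notation Sys := (system cover_fib S).

Definition creq Q (d : cover_fib Q) (a : S (bK_fam Q)) :=
  exists tau : branched (bK_fam Q), compat (x := bK_fam Q) d.1 tau /\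
    a = bsec tau (idm (sval Q)) d.2.

Lemma bsec_idm Q (x : Kfam K) (tau : branched x) (b : @hom X (sval Q) (sval x)) Q'
    (h : @hom X (sval Q') (sval Q)) i :
  bsec tau (b \c h) (ipull h i) = bspull h (bsec tau b i).
Proof. exact: (bsec_nat tau (O := Q') (O' := Q) (h := h) (a' := b) erefl). Qed.

Lemma creq_pull Q Q' (h : @hom X (sval Q') (sval Q)) (d : cover_fib Q) a :
  creq d a -> creq (fpull cover_fib h d) (bspull h a).
Proof.
case=> tau [dt ->]; exists (branched_pull (x := bK_fam Q') (y := bK_fam Q) h tau).
split; first exact: (compat_pull (x := bK_fam Q) (x' := bK_fam Q') h dt).
by rewrite /= cmp_id_r -[X in _ = bsec tau X _](cmp_id_l h) bsec_idm.
Qed.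

Definition sys_sep (V : set Y) (s : Sys) := forall Q (a : @hom X (sval Q) (sval y)) i j q,
  lands (D := cover_fib) (a, i) V -> equiv_at (Q := bK_dom Q) q i j ->
  exists Q' (h : @hom X (sval Q') (sval Q)), [/\ subfamily_open h, range (on_pts h) q &
    s Q' (a \c h, ipull h i) = s Q' (a \c h, ipull h j)].

Definition sys_inv (V : set Y) (s : Sys) := forall Q (a : @hom X (sval Q) (sval y)) i g,
  lands (D := cover_fib) (a, i) V -> s Q (alh g \c a, i) = s Q (a, i).

Definition sys_extra (V : set Y) (s : Sys) := [/\ sys_sep V s, sys_inv V s & meets creq V s].

Lemma sys_extra_sub (U V : set Y) (s : Sys) : V `<=` U -> sys_extra U s -> sys_extra V s.
Proof.
move=> VU [sepU invU mU]; split; last exact: meets_sub mU.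
- by move=> Q a i j q aV; apply: sepU; exact: lands_sub aV.
- by move=> Q a i g aV; apply: invU; exact: lands_sub aV.
Qed.

Lemma lands_act Q a i g (V : set Y) : open V -> lands (D := cover_fib) (Q := Q) (a, i) V ->
  lands (D := cover_fib) (Q := Q) (alh g \c a, i) V.
Proof. by move=> [_ Vinv] aV q; rewrite /fpt /= on_pts_cmp; exact/Vinv/aV. Qed.

Lemma sys_extra_glue (J : Type) (V : J -> set Y) (s : J -> Sys) (t : Sys) :
  (forall k, open (V k)) -> (forall k, sys_on (V k) (s k)) ->
  (forall k, sys_extra (V k) (s k)) -> sys_on (\bigcup_k V k) t ->
  (forall k, sys_agr (V k) (s k) t) -> sys_extra (\bigcup_k V k) t.
Proof.
move=> oV sV eV tV st; split.
- move=> Q a i j q aV ij; have [k _ Vq] := aV q.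
  have [Q' [h [ho [q' _ hq'] hV]]] := lands_nbhs (D := cover_fib) (d := (a, i)) (oV k) Vq.
  have [sepk _ _] := eV k.
  have ij' : equiv_at (Q := bK_dom Q') q' (ipull h i) (ipull h j).
    by apply/(equiv_at_pull (Q := bK_dom Q) (Q' := bK_dom Q') h); rewrite hq'.
  have [Q'' [h' [ho' [q'' _ hq''] e]]] := sepk Q' (a \c h) _ _ q' hV ij'.
  exists Q'', (h \c h'); split; [exact: subfamily_comp | |].
    by exists q'' => //; rewrite on_pts_cmp hq''.
  have hV' l : lands (D := cover_fib) (a \c h, l) (V k) := hV.
  rewrite !ipull_cmp cmp_assoc.
  rewrite -(st k _ _ (lands_pull h' (hV' (ipull h i)))).
  by rewrite -(st k _ _ (lands_pull h' (hV' (ipull h j)))).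
- move=> Q a i g aV; have [b [tb bP]] := tV Q (a, i) aV.
  have oVV : open (\bigcup_k V k) by exact: bigcup_open.
  have [c [tc cP]] := tV Q _ (lands_act g oVV aV).
  rewrite tb tc; congr Some; apply: (S_separated Ssheaf (I := I)) => q.
  have [k _ Vq] := aV q.
  have [Q' [h [ho hq hV]]] := lands_nbhs (D := cover_fib) (d := (a, i)) (oV k) Vq.
  exists Q', h; split=> //; have [_ invk _] := eV k.
  have := bP Q' h; have := cP Q' h.
  rewrite /= -cmp_assoc -(st k _ _ hV) -(st k _ _ (lands_act g (oV k) hV)) invk//.
  by move=> -> [].
- by apply: (meets_glue Ssheaf creq_pull oV sV _ tV st) => k; have [] := eV k.
Qed.

Definition equivariant_sections : section_system Y :=
  sys_sections Ssheaf sys_extra_sub sys_extra_glue.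

Lemma section_of_global (s : Sys) : on setT (s : equivariant_sections) ->
  exists t : branched_sections I S y, invariant al t /\
    forall (x : Kfam K) (c : @hom (Kfam K) x y) (t' : branched_sections I S x),
      compat c t' -> res (branched_sections I S) c t = t'.
Proof.
move=> [son [ssep sinv smeets]].
have lT Q (a : @hom X (sval Q) (sval y)) i : lands (D := cover_fib) (a, i) setT by [].
have ex Q a i : exists b, s Q (a, i) = Some b by have [b []] := son Q _ (lT Q a i); exists b.
pose f Q (a : @hom X (sval Q) (sval y)) i := sval (cid (ex Q a i)).
have fE Q a i : s Q (a, i) = Some (f Q a i) by exact: svalP (cid (ex Q a i)).
have fnat Q Q' (h : @hom X (sval Q) (sval Q')) (a : @hom X (sval Q) (sval y))
    (a' : @hom X (sval Q') (sval y)) : a' \c h = a -> forall i : I (bK_dom Q'),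
    f Q a (ipull h i) = bspull h (f Q' a' i).
  move=> <- i; have := sys_pull son (lT Q' a' i) (fE Q' a' i) h.
  by rewrite fE => -[].
have fsep Q (a : @hom X (sval Q) (sval y)) (g : full (bdom I))
    (c : @hom X (sval g) (sval Q)) (i j : I (bK_dom Q)) :
    is_curve (sval g) -> ~ separated (x := bK_dom Q) c i j ->
    exists (U : Kfam K) (v : @hom (Kfam K) U (bK_fam Q)) (d : @hom X (sval g) (sval U)),
      [/\ @subfamily_open _ X (sval U) (sval Q) v, (v : @hom X _ _) \c d = c
        & res S v (f Q a i) = res S v (f Q a j)].
  move=> gc /negP/negPn ij; have [b _] := gc.
  have eij : equiv_at (Q := bK_dom Q) (on_pts c b) i j.
    by apply/(equiv_atP (Q := bK_dom Q) i j (c := c) gc erefl).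
  have [Q' [h [ho [q' _ hq'] e]]] := ssep Q a i j _ (lT Q a i) eij.
  have [d [hd _]] := curve_lift gc (esym hq').
  exists (bK_fam Q'), h, d; split=> //.
  have := fnat Q' Q h _ a erefl i; have := fnat Q' Q h _ a erefl j.
  rewrite /bspull /spull => <- <-.
  by move: e; rewrite !fE => -[].
pose t : branched y := @BranchedSection _ _ _ _ y f
  (fun Q Q' h a a' e => fnat Q Q' h a a' e) (fun Q a g c i j => fsep Q a g c i j).
exists t; split=> [g|x c t' ct'].
  apply: branched_section_eq => Q a i /=; have := sinv Q a i g (lT Q a i).
  by rewrite !fE => -[].
apply: branched_section_eq => Q a i /=.
have := smeets Q (@cmp X _ _ _ c a, i) (bsec t' a i) (lT _ _ _); rewrite fE => h.
suff /h[] : creq (Q := Q) (@cmp X _ _ _ c a, i) (bsec t' a i) by [].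
exists (branched_pull (x := bK_fam Q) (y := x) a t'); split.
  exact: (compat_pull (x' := bK_fam Q) a ct').
by rewrite /= cmp_id_r.
Qed.

Lemma connected_subfamily (x : X) (r : hom x (sval y)) : subfamily_open r ->
  connected (range (on_pts r)) -> connected [set: pt x].
Proof.
move=> ro cr B [b Bb] [U oU BU] [C cC BC].
rewrite setTI in BU; rewrite setTI in BC; subst U.
have rB : on_pts r @` B = range (on_pts r).
  apply: cr; first by exists (on_pts r b); exists b.
    exists (on_pts r @` B); first exact: subfamily_image.
    by rewrite setIC; symmetry; apply/setIidPl => _ [t _ <-]; exists t.
  exists (~` (on_pts r @` (~` B))).
    by apply/open_closedC/subfamily_image => //; rewrite openC BC.
  apply/seteqP; split=> [_ [t Bt <-]|_ [[t _ <-] nt]].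
    split; first by exists t.
    by case=> z nBz /(subfamily_inj ro) zt; apply: nBz; rewrite zt.
  have [Bt|nBt] := pselect (B t); first by exists t.
  by case: nt; exists t.
apply/seteqP; split=> // t _; have : range (on_pts r) (on_pts r t) by exists t.
by rewrite -rB => -[z Bz /(subfamily_inj ro) <-].
Qed.

Lemma connected_nbhs (p : pt (sval y)) (W : set (pt (sval y))) : open W -> W p ->
  exists N, [/\ open N, N p, N `<=` W & connected N].
Proof.
move=> oW Wp; have [Q [h [ho hp hW]]] := bK_nbhs I (svalP y) oW Wp.
exists (range (on_pts h)); split=> //; first exact: subfamily_range.
apply: connected_continuous_connected.
  by have [_] := bdom_connected (proj1 (svalP Q)).
by apply: continuous_subspaceT; exact: on_pts_cont.
Qed.

(** [stab] collects the g for which every neighbourhood of p contains g p; the Hausdorff condition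
    makes it a group and separates p from g p for all other g. The translates of a small connected N
    by [stab] all contain p, so their union is connected, as the domain of the branched cover
    demands. *)
Lemma invariant_nbhs (p : pt (sval y)) (W : set (pt (sval y))) : open W -> W p ->
  exists U, [/\ open U /\ U p, U `<=` W, connected U,
    forall g, (forall q, U q -> U (act g q)) \/ (forall q, U q -> ~ U (act g q)) &
    forall g, (forall q, U q -> U (act g q)) -> forall V, open V -> V p -> V (act g p)].
Proof.
move=> oW Wp.
pose stab g := forall V, open V -> V p -> V (act g p).
have stab1 : stab 1%g by move=> V _; rewrite act1.
have stabM g h : stab g -> stab h -> stab (g * h)%g.
  move=> sg sh V oV Vp; rewrite actM.
  exact: (sh _ (open_act g oV) (sg V oV Vp)).
have stabV g : stab g -> stab g^-1%g.
  move=> sg V oV Vp; apply: contrapT => nV.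
  have [V1 [V2 [oV1 oV2 V1p V2p V12]]] := eman_hausdorff oV Vp nV.
  have V1g : V1 (act g^-1%g p).
    have := sg _ (open_act g^-1%g oV2) V2p; rewrite /preimage /= actK => V2p'.
    by have : set0 p by rewrite -V12.
  by have : set0 (act g^-1%g p) by rewrite -V12.
have /choice[w wP] g : exists V, [/\ open V, V p &
    ~ stab g -> forall z, V z -> ~ V (act g z)].
  have [sg|nsg] := pselect (stab g); first by exists setT; split=> //; exact: openT.
  have /existsNP[V /not_implyP[oV /not_implyP[Vp nV]]] := nsg.
  have [V1 [V2 [oV1 oV2 V1p V2p V12]]] := eman_hausdorff oV Vp nV.
  exists (V1 `&` act g @^-1` V2); split=> //.
    by apply: openI => //; exact: open_act.
  move=> _ z [_ V2z] [V1z _].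
  by have : set0 (act g z) by rewrite -V12.
pose W1 := W `&` [set z | forall g, w g z].
have oW1 : open W1 by apply: openI => //; apply: open_forall => g; have [] := wP g.
have W1p : W1 p by split=> // g; have [] := wP g.
pose W2 := [set z | forall g, stab g -> W1 (act g z)].
have oW2 : open W2.
  rewrite (_ : W2 = [set z | forall g, [set z | stab g -> W1 (act g z)] z])//.
  apply: (open_forall (V := fun g => [set z | stab g -> W1 (act g z)])) => g.
  have [sg|nsg] := pselect (stab g); last first.
    by rewrite (_ : mkset _ = setT); [exact: openT | apply/seteqP; split].
  rewrite (_ : mkset _ = act g @^-1` W1); first exact: open_act.
  by apply/seteqP; split=> z; [exact | move=> ? _].
have W2p : W2 p by move=> g sg; exact: sg.
have [N [oN Np NW2 cN]] := connected_nbhs oW2 W2p.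
pose U := \bigcup_(g in stab) (act g^-1%g @^-1` N).
have UE z : U z <-> exists g n, [/\ stab g, N n & z = act g n].
  split=> [[g sg Nz]|[g [n [sg Nn ->]]]].
    by exists g, (act g^-1%g z); rewrite actVK.
  by exists g => //; rewrite /preimage /= actK.
have Ustab g z : stab g -> U z -> U (act g z).
  move=> sg /UE[h [n [sh Nn ->]]]; apply/UE; exists (g * h)%g, n.
  by rewrite actM; split=> //; exact: stabM.
have Unstab g z : ~ stab g -> U z -> ~ U (act g z).
  move=> nsg /UE[h [n [sh Nn ->]]] /UE[h' [n' [sh' Nn' e]]].
  have nk : ~ stab (h'^-1 * g * h)%g.
    move=> sk; apply: nsg.
    rewrite (_ : g = h' * (h'^-1 * g * h) * h^-1)%g; last by rewrite !mulgA mulgV mul1g mulgK.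
    exact: (stabM _ _ (stabM _ _ sh' sk) (stabV _ sh)).
  have W1N m : N m -> W1 m by move=> /NW2 /(_ _ stab1); rewrite act1.
  have kn : act (h'^-1 * g * h)%g n = n' by rewrite !actM e actK.
  have [_ _ /(_ nk n)] := wP (h'^-1 * g * h)%g; apply; first exact: (W1N _ Nn).2.
  by rewrite kn; exact: (W1N _ Nn').2.
exists U; split.
- split; first by apply: bigcup_open => g _; exact: open_act.
  by exists 1%g => //; rewrite /preimage /= invg1 act1.
- by move=> z /UE[g [n [sg /NW2 /(_ g sg) [Wz _] ->]]].
- apply: bigcup_connected.
    by exists p => g sg; rewrite /preimage /=; apply: (stabV g sg).
  move=> g sg; rewrite (_ : _ @^-1` _ = act g @` N).
    apply: connected_continuous_connected => //.
    by apply: continuous_subspaceT; exact: act_cont.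
  apply/seteqP; split=> [z Nz|_ [n Nn <-]]; last by rewrite /preimage /= actK.
  by exists (act g^-1%g z) => //; rewrite actVK.
- by move=> g; have [sg|nsg] := pselect (stab g);
    [left=> z; exact: Ustab | right=> z; exact: Unstab].
move=> g gU; apply: contrapT => nsg.
have Up : U p by exists 1%g => //; rewrite /preimage /= invg1 act1.
exact: (Unstab g p nsg Up (gU p Up)).
Qed.

(** [s0 i] is the value on branch i of the section supplied by [compat_loc]. Branches equivalent
    over V are equivalent at q, so their values agree near q; W serves all the finitely many pairs.
    It stays a set because it is shrunk again to an invariant neighbourhood. *)
Lemma good_nbhs (p : pt (sval y)) :
  exists (V : bK I) (r : @hom X (sval V) (sval y)) (q : pt (sval V))
    (s0 : I (bK_dom V) -> S (bK_fam V)) (W : set (pt (sval V))),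
  [/\ subfamily_open r /\ on_pts r q = p, central (Q := bK_dom V) q, open W /\ W q,
      forall (i j : I (bK_dom V)) Q (b : @hom X (sval Q) (sval V)), weqv i j ->
        (forall t, W (on_pts b t)) -> bspull b (s0 i) = bspull b (s0 j) &
      forall Q (b : @hom X (sval Q) (sval V)) (tau : branched (bK_fam Q)) i,
        compat (x := bK_fam Q) (r \c b) tau ->
        bspull b (s0 i) = bsec tau (idm (sval Q)) (ipull b i)].
Proof.
have [x [r0 [tau [r0o [q0 _ rq0] tauP]]]] := compat_loc p.
have [V1 [h1 [h1o [q1 _ hq1] _]]] := bK_nbhs I (q := q0) (svalP x) openT Logic.I.
have [[V dV] [u2 [q [u2o uq qc]]]] := central_nbhs (Q := bK_dom V1) q1.
pose VK : bK I := exist _ V (conj dV (inK_subfamily u2o (proj2 (svalP V1)))).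
have qVK : central (Q := bK_dom VK) q.
  apply: (central_sub (Q := exist _ V dV) (Q' := bK_dom VK) (h := idm V)).
  by rewrite on_pts_id.
pose a : @hom X (sval VK) (sval x) := @cmp X _ _ _ h1 u2.
have /choice[w wP] (ij : I (bK_dom VK) * I (bK_dom VK)) : exists W : set (pt (sval VK)),
    [/\ open W, W q & weqv ij.1 ij.2 -> forall Q (b : @hom X (sval Q) (sval VK)),
      (forall t, W (on_pts b t)) -> bspull b (bsec tau a ij.1) = bspull b (bsec tau a ij.2)].
  case: ij => i j /=.
  have [nij|ij] := pselect (~ weqv i j); first by exists setT; split=> //; exact: openT.
  have {}ij : weqv i j by apply: contrapT.
  have [f [c [fc [e ce]]]] := bdom_curve_through (Q := bK_dom VK) q.
  have sij : ~ separated (x := bK_dom VK) c i j.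
    apply/negP/negPn.
    by apply/(equiv_atP (Q := bK_dom VK) i j fc ce); exact: (qVK i j ij).
  have [U [u [d [uo ud eU]]]] := bsec_sep tau a fc sij.
  exists (range (on_pts (u : @hom X (sval U) (sval VK)))); split.
  - exact: subfamily_range.
  - by exists (on_pts d e) => //; rewrite -on_pts_cmp ud.
  move=> _ Q b bU; have [|b' <-] := subfamily_lift uo (a := b).
    by move=> _ [t _ <-]; exact: bU.
  by rewrite /bspull !(@spull_cmp _ _ S (bK_fam Q) U (bK_fam VK) u b') /spull eU.
exists VK, (@cmp X _ _ _ r0 a), q, (bsec tau a), [set z | forall ij, w ij z]; split.
- split; first by apply: subfamily_comp => //; exact: subfamily_comp.
  by rewrite on_pts_cmp [on_pts a _]on_pts_cmp uq hq1.
- exact: qVK.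
- by split=> [|ij]; [apply: open_forall => ij; have [] := wP ij | have [] := wP ij].
- move=> i j Q b ij bW; have [_ _ h] := wP (i, j).
  by apply: (h ij) => t; exact: bW.
move=> Q b t i bt.
rewrite -cmp_assoc in bt.
have /= <- := tauP (bK_fam Q) (@cmp X _ _ _ a b) t bt.
by rewrite -bsec_idm /= cmp_id_r.
Qed.

(* Trivial stabilizers enter through the third property: G acts freely, up to
   elements acting trivially on u, on the branches over u. *)
Lemma local_structure (p : pt (sval y)) : trivial_stabilizers I ->
  exists (u : bK I) (r : @hom X (sval u) (sval y)) (s0 : I (bK_dom u) -> S (bK_fam u)),
  [/\ subfamily_open r /\ range (on_pts r) p,
      forall g, (forall q, range (on_pts r) q -> range (on_pts r) (act g q)) \/
                (forall q, range (on_pts r) q -> ~ range (on_pts r) (act g q)),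
      forall g (psi : @hom X (sval u) (sval u)) i, r \c psi = alh g \c r ->
        weqv (ipull psi i) i -> psi = idm (sval u),
      forall i j : I (bK_dom u), weqv i j -> s0 i = s0 j &
      forall Q (b : @hom X (sval Q) (sval u)) (tau : branched (bK_fam Q)) i,
        compat (x := bK_fam Q) (r \c b) tau ->
        bspull b (s0 i) = bsec tau (idm (sval Q)) (ipull b i)].
Proof.
move=> Itriv.
have [V [r2 [q2 [s2 [W [[r2o r2q] q2c [oW Wq] s2W s2P]]]]]] := good_nbhs p.
have [||U [[oU Up] UW cU Uact Ustab]] := @invariant_nbhs p (on_pts r2 @` W).
- exact: subfamily_image.
- by exists q2.
have [x [r [ro rU]]] := open_subfamily oU.
have [|l r2l] := @subfamily_lift _ X x _ _ r2 r r2o.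
  by rewrite rU => z /UW[t _ <-]; exists t.
have lW t : W (on_pts l t).
  have /UW[z Wz] : U (on_pts r t) by rewrite -rU; exists t.
  by rewrite -r2l on_pts_cmp => /(subfamily_inj r2o) <-.
have [p' _ rp'] : range (on_pts r) p by rewrite rU.
have xc : connected_family x.
  by split; [exists p' | apply: (connected_subfamily ro); rewrite rU].
pose u : bK I := exist _ x (conj (bdom_closed l (proj1 (svalP V)) xc)
  (inK_subfamily ro (svalP y))).
have /choice[li liP] (i : I (bK_dom u)) : exists j, ipull (Q := V) (Q' := u) l j = i.
  exact: (bpull_surj (Q := bK_dom V) (Q' := bK_dom u) l i).
exists u, r, (fun i => bspull (Q := V) (Q' := u) l (s2 (li i))); split.
- by split=> //; exists p'.
- by rewrite rU.
- move=> g psi i rpsi wi.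
  have psiU h (k : @hom X x x) : r \c k = alh h \c r -> forall z, U z -> U (act h z).
    move=> rk; have [hU|nU] := Uact h; [exact: hU | exfalso; apply: (nU p Up)].
    by rewrite -rp' /act -on_pts_cmp -rk on_pts_cmp -rU; exists (on_pts k p').
  have gU := psiU g psi rpsi.
  have gVU z : U z -> U (act g^-1%g z).
    have [hU|nU] := Uact g^-1%g; [exact: hU | exfalso; apply: (nU _ (gU p Up))].
    by rewrite actK.
  have [|psi' rpsi'] := @subfamily_lift _ X x x _ r (alh g^-1%g \c r) ro.
    move=> _ [t _ <-]; rewrite on_pts_cmp rU; apply: gVU.
    by rewrite -rU; exists t.
  have alM h k : alh h \c alh k = alh (h * k)%g by rewrite act_homM.
  have al1 : alh 1%g = idm (sval y) by rewrite act_hom1.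
  have K1 : psi \c psi' = idm x.
    apply: (subfamily_monic ro).
    rewrite cmp_assoc rpsi -[LHS]cmp_assoc rpsi' [LHS]cmp_assoc alM mulgV al1.
    by rewrite cmp_id_l cmp_id_r.
  have K2 : psi' \c psi = idm x.
    apply: (subfamily_monic ro).
    rewrite cmp_assoc rpsi' -[LHS]cmp_assoc rpsi [LHS]cmp_assoc alM mulVg al1.
    by rewrite cmp_id_l cmp_id_r.
  (* A nontrivial psi would separate i from its translate at [p'], whereas centrality of [p'] makes
     the two equivalent there. *)
  apply: contrapT => npsi.
  have [f [c [fc [e ce]]]] := bdom_curve_through (Q := bK_dom u) p'.
  have sep := Itriv (bK_dom u) psi psi' (proj2 (svalP u)) K1 K2 npsi f c fc _ i.
  have := sep _; apply/not_implyP; split.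
    (* By [Ustab] every neighbourhood of p contains g p, so no continuous real function tells the
       image of [p'] under psi from [p']. *)
    move=> e'; rewrite (curve_pt e' e fc) ce => h hc; apply: contrapT => hne.
    pose A := h @^-1` (~` [set h (on_pts psi p')]).
    have oA : open A.
      apply: open_comp => [z _|]; first exact: hc.
      exact/closed_openC/accessible_closed_set1/hausdorff_accessible/norm_hausdorff.
    have Ap : A p' by move=> /= hp; apply: hne; rewrite -hp.
    have := Ustab g gU (on_pts r @` A) (subfamily_image ro oA).
    case; first by exists p'.
    move=> z Az; rewrite -rp' /act -on_pts_cmp -rpsi on_pts_cmp => /(subfamily_inj ro) zp.
    by apply: Az; rewrite zp.
  apply/negP; rewrite /separated negbK.
  have p'c : central (Q := bK_dom u) p'.
    apply: (central_sub (Q := bK_dom V) (Q' := bK_dom u) (h := l)).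
    rewrite (_ : on_pts l p' = q2)//; apply: (subfamily_inj r2o).
    by rewrite -on_pts_cmp r2l rp'.
  by apply/(equiv_atP (Q := bK_dom u) _ _ fc ce); apply: p'c; exact: weqv_sym.
- move=> i j ij; apply: s2W => //; move: ij; rewrite -{1}(liP i) -{1}(liP j).
  exact: (bpull_eqv (Q := bK_dom V) (Q' := bK_dom u) (h := l)).
move=> Q b tau i; rewrite -[r]r2l -cmp_assoc => ct.
rewrite -(bspull_cmp (Q := V) (Q' := u) l b) (s2P Q (l \c b) tau _ ct).
by rewrite (ipull_cmp (Q := V) (Q' := u) l b) liP.
Qed.

(** * Softness over the translates of one good neighbourhood *)

Section LocalSoftness.
Variables (u : bK I) (r : @hom X (sval u) (sval y)) (s0 : I (bK_dom u) -> S (bK_fam u)).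
Hypothesis ro : subfamily_open r.
Hypothesis r_act : forall g,
  (forall q, range (on_pts r) q -> range (on_pts r) (act g q)) \/
  (forall q, range (on_pts r) q -> ~ range (on_pts r) (act g q)).
Hypothesis r_free : forall g (psi : @hom X (sval u) (sval u)) i,
  r \c psi = alh g \c r -> weqv (ipull psi i) i -> psi = idm (sval u).
Hypothesis s0_weqv : forall i j : I (bK_dom u), weqv i j -> s0 i = s0 j.
Hypothesis s0_compat : forall Q (b : @hom X (sval Q) (sval u))
  (tau : branched (bK_fam Q)) i, compat (x := bK_fam Q) (r \c b) tau ->
  bspull b (s0 i) = bsec tau (idm (sval Q)) (ipull b i).

Definition stable g := forall q, range (on_pts r) q -> range (on_pts r) (act g q).

Lemma stableP g q : range (on_pts r) q -> range (on_pts r) (act g q) -> stable g.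
Proof. by move=> rq rgq; have [//|n] := r_act g; case: (n q rq). Qed.

Lemma stable1 : stable 1%g.
Proof. by move=> q; rewrite act1. Qed.

Lemma stableM g h : stable g -> stable h -> stable (g * h)%g.
Proof. by move=> sg sh q rq; rewrite actM; apply/sg/sh. Qed.

Lemma u_point : exists q : pt (sval u), True.
Proof. by have [[q _] _] := bdom_connected (proj1 (svalP u)); exists q. Qed.

Lemma stableV g : stable g -> stable g^-1%g.
Proof.
move=> sg; have [q _] := u_point.
have rq : range (on_pts r) (on_pts r q) by exists q.
by apply: (stableP (sg _ rq)); rewrite actK.
Qed.

Lemma psi_ex g : exists psi : @hom X (sval u) (sval u),
  stable g -> r \c psi = alh g \c r.
Proof.
have [sg|nsg] := pselect (stable g); last by exists (idm (sval u)).
have [|psi rpsi] := @subfamily_lift _ X (sval u) (sval u) _ r (alh g \c r) ro.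
  by move=> _ [t _ <-]; rewrite on_pts_cmp; apply: sg; exists t.
by exists psi.
Qed.

Definition psi g : @hom X (sval u) (sval u) := sval (cid (psi_ex g)).

Lemma psiE g : stable g -> r \c psi g = alh g \c r.
Proof. exact: svalP (cid (psi_ex g)). Qed.

Lemma psiM g h : stable g -> stable h -> psi (g * h)%g = psi g \c psi h.
Proof.
move=> sg sh; apply: (subfamily_monic ro).
rewrite (psiE (stableM sg sh)) cmp_assoc (psiE sg) -[RHS]cmp_assoc (psiE sh).
by rewrite act_homM [RHS]cmp_assoc.
Qed.

Lemma psi1 : psi 1%g = idm (sval u).
Proof.
apply: (subfamily_monic ro); rewrite (psiE stable1) act_hom1 cmp_id_r.
exact: cmp_id_l.
Qed.

Lemma on_psi g q : stable g -> on_pts r (on_pts (psi g) q) = act g (on_pts r q).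
Proof. by move=> sg; rewrite -on_pts_cmp psiE// on_pts_cmp. Qed.

Lemma psi_eq g h i : stable g -> stable h ->
  weqv (ipull (psi g) i) (ipull (psi h) i) -> psi g = psi h.
Proof.
move=> sg sh; have sk : stable (h^-1 * g)%g by apply: stableM => //; exact: stableV.
have gE : psi g = psi h \c psi (h^-1 * g)%g by rewrite -psiM// mulKVg.
rewrite gE ipull_cmp => /(r_free (psiE sk)) ->.
by rewrite cmp_id_r.
Qed.

Lemma ipull_psiVK g i : stable g -> ipull (psi g) (ipull (psi g^-1%g) i) = i.
Proof.
move=> sg; rewrite -ipull_cmp -psiM//; last exact: stableV.
by rewrite mulVg psi1 ipull_id.
Qed.

Definition near_eq (x : pt (sval u)) (a b : S (bK_fam u)) :=
  exists V, [/\ open V, V x & forall Q (c : @hom X (sval Q) (sval u)),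
    (forall t, V (on_pts c t)) -> bspull c a = bspull c b].

Lemma near_eq_sym x a b : near_eq x a b -> near_eq x b a.
Proof. by case=> V [oV Vx h]; exists V; split=> // Q c cV; rewrite h. Qed.

Definition ireq (i : I (bK_dom u)) Q (b : family_fib I (bK_fam u) Q) (a : S (bK_fam Q)) :=
  creq (Q := Q) (@cmp X _ _ _ r b, ipull (Q := u) b i) a.

Lemma ireq_pull i Q Q' (h : @hom X (sval Q') (sval Q)) b a :
  @ireq i Q b a -> @ireq i Q' (fpull (family_fib I (bK_fam u)) h b) (bspull h a).
Proof.
move=> /(creq_pull h); rewrite /ireq /= -cmp_assoc.
by rewrite -(@ipull_cmp _ _ _ u Q Q' b h).
Qed.

Lemma ireq_s0 i Q (b : family_fib I (bK_fam u) Q) a : ireq i b a -> bspull (Q := u) b (s0 i) = a.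
Proof. by case=> tau [ct ->]; exact: s0_compat. Qed.

(** A prescribed value on branch i is the restriction of [s0 i], and [s0] does not distinguish
    equivalent branches. *)
Lemma ireq_weqv i j Q (b : family_fib I (bK_fam u) Q) a :
  weqv i j -> ireq i b a -> ireq j b a.
Proof.
move=> ij [tau [ct aE]]; exists tau; split=> //=; rewrite aE /=.
by rewrite -!s0_compat// (s0_weqv ij).
Qed.

Variables (C A : set Y) (s : equivariant_sections).
Hypotheses (cC : closed C) (oA : open A) (CA : C `<=` A).

Definition saturation : set Y := [set z | exists g, range (on_pts r) (act g z)].
Hypothesis sA : on (A `&` saturation) s.

Lemma act_closed g z : C z -> C (act g z).
Proof.
have [_ Cinv] := closed_openC cC; move=> Cz; apply: contrapT => nC.
by have := Cinv g^-1%g _ nC; rewrite actK.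
Qed.

Lemma act_open (V : set Y) g z : open V -> V (act g z) -> V z.
Proof. by case=> _ Vinv /(Vinv g^-1%g); rewrite actK. Qed.

Definition Cu : set (pt (sval u)) := on_pts r @^-1` C.
Definition Au : set (pt (sval u)) := on_pts r @^-1` A.

Lemma closed_Cu : closed Cu.
Proof.
have [oC _] := closed_openC cC.
by rewrite -openC; exact: (open_on_pts r oC).
Qed.

Lemma open_Au : open Au.
Proof. by case: oA => oA' _; exact: open_on_pts. Qed.

Lemma lands_Au Q (b : @hom X (sval Q) (sval u)) i : (forall t, Au (on_pts b t)) ->
  lands (D := cover_fib) (r \c b, i) (A `&` saturation).
Proof.
move=> bA q; rewrite /fpt /= on_pts_cmp; split; first exact: bA.
by exists 1%g; rewrite act1; exists (on_pts b q).
Qed.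

(* The sections chosen so far, in an induction over the orbits of branches. *)
Record partial_choice (P : {set I (bK_dom u)}) (f : I (bK_dom u) -> S (bK_fam u)) :=
  PartialChoice {
  pc_stable : forall g i, stable g -> i \in P -> ipull (psi g) i \in P;
  pc_act : forall g i, stable g -> i \in P -> f (ipull (psi g) i) = bspull (psi g) (f i);
  pc_eq : forall i j x, i \in P -> j \in P ->
    equiv_at (Q := bK_dom u) x i j -> near_eq x (f i) (f j);
  pc_near : forall i, i \in P -> exists N, [/\ open N, Cu `<=` N, N `<=` Au &
    forall Q (b : @hom X (sval Q) (sval u)), (forall t, N (on_pts b t)) ->
      (s : Sys) Q (r \c b, ipull b i) = Some (bspull b (f i))];
  pc_req : forall i Q (b : family_fib I (bK_fam u) Q) a, i \in P ->
    ireq i b a -> bspull (Q := u) b (f i) = a }.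

Definition branch_sections i : section_system (pt (sval u)) :=
  family_sections Ssheaf (u := bK_fam u) (@ireq_pull i).

Definition const_system (a : S (bK_fam u)) : system (family_fib I (bK_fam u)) S :=
  fun Q b => Some (bspull (Q := u) b a).

Lemma const_on V i a : (forall Q (b : family_fib I (bK_fam u) Q) c,
    ireq i b c -> bspull (Q := u) b a = c) ->
  on V (const_system a : branch_sections i).
Proof.
move=> h; split=> [Q b _|Q b c _ bc]; last by rewrite /const_system (h Q b c).
by exists (bspull (Q := u) b a); split=> // Q' h'; rewrite -bspull_cmp.
Qed.

Definition branch_system i : system (family_fib I (bK_fam u)) S :=
  fun Q b => (s : Sys) Q (@cmp X _ _ _ r b, ipull (Q := u) b i).

Lemma branch_on i : on Au (branch_system i : branch_sections i).
Proof.
have [sA1 [_ _ sA2]] := sA; split=> [Q b bA|Q b a bA ba].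
  have [a [sa aP]] := sA1 Q _ (lands_Au (ipull (Q := u) b i) bA).
  exists a; split=> // Q' h; rewrite -(aP Q' h) /branch_system /= cmp_assoc.
  by rewrite (@ipull_cmp _ _ _ u Q Q' b h).
exact: sA2 (lands_Au _ bA) ba.
Qed.

Lemma near_agr i x a b : near_eq x a b ->
  exists V, [/\ open V, V x & agr V (const_system a : branch_sections i) (const_system b)].
Proof.
by case=> V [oV Vx h]; exists V; split=> // Q c cV; rewrite /const_system h.
Qed.

Lemma branch_agr i j x : Au x -> equiv_at (Q := bK_dom u) x i j ->
  exists V, [/\ open V, V x & forall Q (b : @hom X (sval Q) (sval u)),
    (forall t, V (on_pts b t)) -> branch_system i b = branch_system j b].
Proof.
move=> Ax ij; have [sA1 [sA2 _ _]] := sA.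
have [Q1 [h1 [h1o [x1 _ hx1] h1A]]] := bK_nbhs I (q := x) (svalP (bK_fam u)) open_Au Ax.
have h1A' t : Au (on_pts h1 t) by apply: h1A; exists t.
have ij1 : equiv_at (Q := bK_dom Q1) x1 (ipull (Q := u) h1 i) (ipull (Q := u) h1 j).
  by apply/(equiv_at_pull (Q := bK_dom u) (Q' := bK_dom Q1) h1); rewrite hx1.
have [Q2 [h2 [h2o [x2 _ hx2] e]]] := sA2 Q1 (@cmp X _ _ _ r h1) _ _ x1
  (lands_Au _ h1A') ij1.
exists (range (on_pts (@cmp X _ _ _ h1 h2))); split.
- by apply: subfamily_range; exact: subfamily_comp.
- by exists x2 => //; rewrite on_pts_cmp hx2.
move=> Q b bV; have [|b' <-] := @subfamily_lift _ X (sval Q) _ _ _ b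
    (subfamily_comp h1o h2o).
  by move=> _ [t _ <-]; exact: bV.
have l k : (s : Sys) Q2 (r \c @cmp X _ _ _ h1 h2, ipull (Q := u) (@cmp X _ _ _ h1 h2) k) =
    (s : Sys) Q2 (@cmp X _ _ _ r h1 \c h2, ipull h2 (ipull (Q := u) h1 k)).
  by rewrite cmp_assoc (@ipull_cmp _ _ _ u Q1 Q2 h1 h2).
have hA t : Au (on_pts (@cmp X _ _ _ h1 h2) t) by rewrite on_pts_cmp.
have sb k : exists a, (s : Sys) Q2 (r \c @cmp X _ _ _ h1 h2, ipull (Q := u) (@cmp X _ _ _ h1 h2) k)
    = Some a /\ branch_system k (@cmp X _ _ _ (@cmp X _ _ _ h1 h2) b') = Some (bspull b' a).
  have [a [sa aP]] := sA1 Q2 _ (lands_Au (ipull (Q := u) (@cmp X _ _ _ h1 h2) k) hA).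
  exists a; split=> //; rewrite -(aP Q b') /branch_system /= cmp_assoc.
  by rewrite (@ipull_cmp _ _ _ u Q2 Q (@cmp X _ _ _ h1 h2) b').
have [a [+ ->]] := sb i; have [c [+ ->]] := sb j.
by rewrite !l e => -> [->].
Qed.

(** [soft_extend_closed] with one closed set per earlier branch j, the locus where [i0] is
    equivalent to j, and one more, indexed by [None], where s is given. Overlaps agree by
    transitivity of equivalence. *)
Lemma extend_branch P f i0 : partial_choice P f -> exists fn : S (bK_fam u),
  [/\ forall Q (b : family_fib I (bK_fam u) Q) a, ireq i0 b a -> bspull (Q := u) b fn = a,
      forall j x, j \in P -> equiv_at (Q := bK_dom u) x i0 j -> near_eq x (f j) fn &
      exists N, [/\ open N, Cu `<=` N, N `<=` Au &
        forall Q (b : @hom X (sval Q) (sval u)), (forall t, N (on_pts b t)) ->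
          (s : Sys) Q (r \c b, ipull b i0) = Some (bspull b fn)]].
Proof.
move=> [_ _ feq fnear freq].
have soft : @soft_on _ (branch_sections i0) setT.
  apply: (@family_soft _ _ _ _ Ssheaf Spatch (bK_fam u) _ (@ireq_pull i0) (s0 i0)).
  exact: ireq_s0.
have Treg : regular_space (pt (sval u)) by exact: exploded_regular.
(* Equivalence at a point implies [weqv i0 j]. Keeping this as a condition lets [ireq_weqv] transfer
   requirements on [i0] to j, where [f j] meets them. *)
pose sel j := (j \in P) && weqv i0 j.
pose Cj (o : option (I (bK_dom u))) : set (pt (sval u)) :=
  if o is Some j then if sel j then [set x | equiv_at (Q := bK_dom u) x i0 j] else set0
  else Cu.
pose Aj (o : option (I (bK_dom u))) : set (pt (sval u)) := if o is Some _ then setT else Au.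
(* An unselected j has an empty closed set; [s0 i0] is a filler that meets the requirements. *)
pose sj (o : option (I (bK_dom u))) : branch_sections i0 :=
  if o is Some j then if sel j then const_system (f j) else const_system (s0 i0)
  else branch_system i0.
have freq' j : sel j -> forall Q (b : family_fib I (bK_fam u) Q) c,
    ireq i0 b c -> bspull (Q := u) b (f j) = c.
  by move=> /andP[jP ij] Q b c /(ireq_weqv ij); exact: freq.
(* Near C, [f j] is s on branch j, and where [i0] and j are equivalent the separation condition on s
   identifies its values on the two. *)
have side j x : sel j -> Cu x -> equiv_at (Q := bK_dom u) x i0 j ->
    exists V, [/\ open V, V x & agr V (branch_system i0 : branch_sections i0) (const_system (f j))].
  move=> /andP[jP _] Cx ij; have [N [oN CN NA fN]] := fnear j jP.
  have Ax : Au x := CA Cx.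
  have [V [oV Vx sV]] := branch_agr Ax ij.
  exists (V `&` N); split; [exact: openI | by split=> //; exact: CN |].
  move=> Q b bVN; rewrite [LHS]sV => [|t]; last by have [] := bVN t.
  by rewrite /branch_system [LHS]fN// => t; have [] := bVN t.
have [k|k l x|t [tT tN]] := @soft_extend_closed _ (branch_sections i0)
    Treg (@eman_countable _ _) _ Cj Aj sj _ _ soft.
- case: k => [j|] /=; last first.
    by split; [exact: closed_Cu | exact: open_Au | move=> x; exact: CA | exact: branch_on].
  case: ifP => [sj'|_]; split=> //; try exact: openT.
  + exact: (@closed_equiv_at _ _ _ (bK_dom u) i0 j).
  + by apply: const_on; exact: freq'.
  + exact: closed0.
  + by apply: const_on; exact: ireq_s0.
- case: k l => [i|] [j|] //=.
  + case: ifP => [si|//]; case: ifP => [sjj|//] /= xi xj.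
    apply: (@near_agr i0 x (f i) (f j)); apply: (feq i j x).
    + by case/andP: si.
    + by case/andP: sjj.
    exact: equiv_at_trans (equiv_at_sym xi) xj.
  + case: ifP => [si|//] /= xi Cx; have [V [oV Vx Vs]] := side i x si Cx xi.
    by exists V; split=> //; exact: (agr_sym Vs).
  + by case: ifP => [sjj|//] /= Cx xj; exact: side.
  + by move=> _ _; exists setT; split=> //; exact: openT.
have [tT1 tT2] := tT.
have [fn [tfn fnP]] := tT1 u (idm (sval u)) (fun _ => Logic.I).
have tE Q (b : @hom X (sval Q) (sval u)) : t Q b = Some (bspull b fn).
  by have := fnP Q b; rewrite /= cmp_id_l.
exists fn; split.
- move=> Q b a ba; have := tT2 Q b a (fun _ => Logic.I) ba.
  by rewrite tE => -[].
- move=> j x jP ij; have [N [oN CN Nt]] := tN (Some j).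
  have sjj : sel j by rewrite /sel jP (equiv_at_weqv ij).
  exists N; split=> //; first by apply: CN; rewrite /= sjj.
  move=> Q c cN; have := Nt Q c cN; rewrite /= sjj tE => -[].
  by rewrite /const_system.
have [N [oN CN Nt]] := tN None; exists (N `&` Au); split.
- by apply: openI => //; exact: open_Au.
- by move=> x Cx; split; [exact: CN | exact: CA].
- by move=> x [].
move=> Q b bN; have := Nt Q b; rewrite tE; apply.
by move=> q; have [] := bN q.
Qed.

(** The section [fn] for [i0] is transported along the orbit by the automorphisms [psi g]; by
    [psi_eq] the transport depends only on the branch reached, not on g. *)
Lemma extend_orbit P f i0 : partial_choice P f -> i0 \notin P ->
  exists P' f', [/\ partial_choice P' f', P \subset P' & i0 \in P'].
Proof.
move=> pf i0P; have [fn [fn1 fn2 [N [oN CN NA fnN]]]] := extend_branch i0 pf.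
have [fstab fact feq fnear freq] := pf.
pose orb g i := `[< stable g >] && (i == ipull (Q := u) (Q' := u) (psi g) i0).
pose f' i := if i \in P then f i else
  if [pick g | orb g i] is Some g then bspull (psi g) fn else f i.
pose P' := P :|: [set i | [exists g, orb g i]].
have orbP i : reflect (exists2 g, stable g & i = ipull (Q := u) (Q' := u) (psi g) i0)
    [exists g, orb g i].
  apply: (iffP existsP) => [[g /andP[/asboolP sg /eqP ->]]|[g sg ->]]; exists g => //.
  by rewrite /orb eqxx andbT; apply/asboolP.
have inP' i : i \in P' -> i \in P \/
    exists2 g, stable g & i = ipull (Q := u) (Q' := u) (psi g) i0.
  by rewrite !inE => /orP[|/orbP]; [left | right].
have nP g : stable g -> ipull (Q := u) (Q' := u) (psi g) i0 \in P = false.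
  move=> sg; apply/negP => /(fstab g^-1%g _ (stableV sg)).
  by have := ipull_psiVK i0 (stableV sg); rewrite invgK => ->; apply/negP.
have f'P i : i \in P -> f' i = f i by move=> iP; rewrite /f' iP.
have f'orb g : stable g -> f' (ipull (Q := u) (Q' := u) (psi g) i0) = bspull (psi g) fn.
  move=> sg; rewrite /f' nP//; case: pickP => [h /andP[/asboolP sh /eqP e]|/(_ g)].
    by rewrite (@psi_eq h g i0 sh sg)// e; exact: weqv_refl.
  by rewrite /orb eqxx andbT => /asboolP.
exists P', f'; split; last 2 first.
- exact: finset.subsetUl.
- rewrite !inE; apply/orP; right; apply/orbP; exists 1%g; first exact: stable1.
  by rewrite psi1 ipull_id.
(* Translation by the inverse of g moves the comparison to [i0] and an earlier branch, where [fn]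
   was built to agree. *)
have mixed i g x : i \in P -> stable g ->
    equiv_at (Q := bK_dom u) x i (ipull (Q := u) (Q' := u) (psi g) i0) ->
    near_eq x (f i) (bspull (psi g) fn).
  move=> iP sg.
  pose i' := ipull (Q := u) (Q' := u) (psi g^-1%g) i.
  have i'P : i' \in P by apply: fstab => //; exact: stableV.
  have iE : i = ipull (Q := u) (Q' := u) (psi g) i' by rewrite ipull_psiVK.
  rewrite iE => /(equiv_at_pull (Q := bK_dom u) (Q' := bK_dom u) (psi g)) eq'.
  have [V [oV Vx hV]] := fn2 i' _ i'P (equiv_at_sym eq').
  exists (on_pts (psi g) @^-1` V); split; [exact: open_on_pts | exact: Vx |].
  move=> Q c cV; rewrite (fact g i' sg i'P) -!bspull_cmp; apply: hV => t.
  by rewrite on_pts_cmp; exact: cV.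
split.
- move=> g i sg /inP'[iP|[h sh ->]]; rewrite !inE; apply/orP.
    by left; exact: fstab.
  right; apply/orbP; exists (h * g)%g; first exact: stableM.
  by rewrite psiM// ipull_cmp.
- move=> g i sg /inP'[iP|[h sh ->]].
    by rewrite !f'P ?fact//; exact: fstab.
  rewrite -ipull_cmp -psiM// !f'orb//; last exact: stableM.
  by rewrite psiM// bspull_cmp.
- move=> i j x /inP'[iP|[g sg ->]] /inP'[jP|[h sh ->]] ij.
  + by rewrite !f'P//; exact: feq ij.
  + by rewrite f'P// f'orb//; exact: mixed.
  + by rewrite f'orb// f'P//; apply/near_eq_sym/mixed => //; exact: equiv_at_sym.
  (* Freeness: two branches of the orbit equivalent at a point come from the same automorphism, so
     nothing is to be compared. *)
  rewrite !f'orb// (psi_eq sg sh (equiv_at_weqv ij)).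
  by exists setT; split=> //; exact: openT.
- move=> i /inP'[iP|[g sg ->]]; first by rewrite f'P//; exact: fnear.
  exists ((on_pts (psi g) @^-1` N) `&` Au); split.
  + by apply: openI; [exact: open_on_pts | exact: open_Au].
  + move=> x Cx; split; last exact: CA.
    by apply: CN; rewrite /Cu /preimage /= on_psi//; exact: act_closed.
  + by move=> x [].
  move=> Q b bN; rewrite f'orb// -bspull_cmp -ipull_cmp.
  rewrite -(fnN Q (psi g \c b)); last first.
    by move=> t; rewrite on_pts_cmp; have [] := bN t.
  rewrite cmp_assoc psiE// -[in RHS]cmp_assoc.
  have [_ [_ sA2 _]] := sA; symmetry; apply: sA2; apply: lands_Au => t.
  by have [] := bN t.
move=> i Q b a /inP'[iP|[g sg ->]]; first by rewrite f'P//; exact: freq.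
rewrite f'orb// -bspull_cmp => ba; apply: (fn1 Q (@cmp X _ _ _ (psi g) b)).
case: ba => tau [ct aE]; exists tau; split=> /=.
  rewrite cmp_assoc psiE// -[X in compat X]cmp_assoc.
  exact: (compat_act g ct).
by rewrite aE /= (@ipull_cmp _ _ _ u u Q (psi g) b).
Qed.

Lemma full_choice : exists P f, partial_choice P f /\ forall i, i \in P.
Proof.
have ext n P f : partial_choice P f -> (#|~: P| <= n)%N ->
    exists P' f', partial_choice P' f' /\ forall i, i \in P'.
  elim: n P f => [|n ih] P f pf Pn.
    exists P, f; split=> // i; move: Pn; rewrite leqn0 => /eqP/card0_eq/(_ i).
    by rewrite inE => /negbFE.
  have [PT|/existsNP[i0 /negP i0P]] := pselect (forall i, i \in P); first by exists P, f.
  have [P' [f' [pf' PP' i0P']]] := extend_orbit pf i0P.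
  apply: ih pf' _; rewrite -ltnS; apply: leq_trans Pn; apply: proper_card.
  rewrite properE finset.setCS PP' /=; apply/subsetPn; exists i0; first by rewrite inE.
  by rewrite inE negbK.
have pf0 : partial_choice finset.set0 s0 by split=> [g i _|g i _|i j x|i|i Q b a]; rewrite inE.
exact: (ext _ _ _ pf0 (leqnn _)).
Qed.

(** Translates of the range of r are equal or disjoint, so their preimages split the connected
    family Q into open pieces, one of which must be all of Q. *)
Lemma lands_saturation Q (a : @hom X (sval Q) (sval y)) i :
  lands (D := cover_fib) (a, i) saturation ->
  exists g (b : @hom X (sval Q) (sval u)), r \c b = alh g \c a.
Proof.
move=> aS; have [[t0 _] Qc] := bdom_connected (proj1 (svalP Q)).
have [g0 g0t] := aS t0.
pose B g := on_pts a @^-1` (act g @^-1` range (on_pts r)).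
have oB g : open (B g).
  by apply: open_on_pts; apply: open_act; exact: subfamily_range.
have BT : B g0 = setT.
  apply: Qc; [by exists t0 | by exists (B g0); rewrite ?setTI |].
  exists (B g0); rewrite ?setTI//.
  rewrite -openC (_ : ~` B g0 = \bigcup_(h in [set h | B h `<=` ~` B g0]) B h).
    by apply: bigcup_open => h _; exact: oB.
  apply/seteqP; split=> [t nt|t [h hB Bt]]; last exact: hB.
  have [h ht] := aS t; exists h => //= z Bz Bz0; apply: nt.
  have sk : stable (g0 * h^-1)%g.
    by apply: (stableP Bz); rewrite actM actK.
  by rewrite /B /preimage /= -[X in act g0 X](actK h) -actM; exact: sk.
have [|b rb] := @subfamily_lift _ X (sval Q) _ _ r (alh g0 \c a) ro; last by exists g0, b.
move=> _ [t _ <-]; rewrite on_pts_cmp.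
by have : B g0 t by rewrite BT.
Qed.

(** A pair (a, i) is moved into u by some g, i is lifted to a branch j over u, and the value is the
    pullback of [f j]. [feqb] makes it independent of j; [shift], with the equivariance of f, of
    g. *)
Lemma choice_soft P f : partial_choice P f -> (forall i, i \in P) ->
  exists (t : equivariant_sections) N, [/\ open N, C `&` saturation `<=` N,
    N `<=` A `&` saturation, on saturation t & agr N s t].
Proof.
move=> [fstab fact feq fnear freq] PT.
pose val Q (a : @hom X (sval Q) (sval y)) (i : I (bK_dom Q)) (v : S (bK_fam Q)) :=
  exists g (b : @hom X (sval Q) (sval u)) j,
    [/\ r \c b = alh g \c a, ipull b j = i & v = bspull b (f j)].
(* Lifts with the same pullback are equivalent at every point of the image of c, so f agrees on them
   near each such point. *)
have feqb Q (c : @hom X (sval Q) (sval u)) j1 j2 : ipull c j1 = ipull c j2 ->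
    bspull c (f j1) = bspull c (f j2).
  move=> e; apply: (S_separated Ssheaf (I := I)) => t.
  have tj : equiv_at (Q := bK_dom u) (on_pts c t) j1 j2.
    apply/(equiv_at_pull (Q := bK_dom u) (Q' := bK_dom Q) c).
    by rewrite -[bpull _ j1]/(ipull c j1) e; exact: equiv_at_refl.
  have [V [oV Vt hV]] := feq _ _ _ (PT j1) (PT j2) tj.
  have [Q' [h [ho ht hV']]] := bK_nbhs I (q := t) (svalP (bK_fam Q)) (open_on_pts c oV) Vt.
  exists Q', h; split=> //; rewrite -[LHS](bspull_cmp c h) -[RHS](bspull_cmp c h).
  by apply: hV => z; rewrite on_pts_cmp; apply: hV'; exists z.
have shift Q (a : @hom X (sval Q) (sval y)) g h b c :
    r \c b = alh g \c a -> r \c c = alh h \c a ->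
    stable (g * h^-1)%g /\ b = psi (g * h^-1)%g \c c.
  move=> rb rc; have [[z _] _] := bdom_connected (proj1 (svalP Q)).
  have aE : a = alh h^-1%g \c (r \c c).
    rewrite rc cmp_assoc -[alh h^-1%g \c alh h]/(act_hom al h^-1%g \c act_hom al h).
    by rewrite -act_homM mulVg act_hom1 [RHS]cmp_id_l.
  have bE : r \c b = alh (g * h^-1)%g \c (r \c c).
    by rewrite rb {1}aE cmp_assoc act_homM.
  have sk : stable (g * h^-1)%g.
    apply: (@stableP _ (on_pts r (on_pts c z))); first by exists (on_pts c z).
    have <- : on_pts r (on_pts b z) = act (g * h^-1)%g (on_pts r (on_pts c z)).
      by rewrite -[LHS]on_pts_cmp bE !on_pts_cmp.
    by exists (on_pts b z).
  split=> //; apply: (subfamily_monic ro).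
  by rewrite bE cmp_assoc [RHS]cmp_assoc psiE.
have valuniq Q a i v w : val Q a i v -> val Q a i w -> v = w.
  move=> [g [b [j [rb bj ->]]]] [h [c [k [rc ck ->]]]].
  have [sk bE] := shift _ _ _ _ _ _ rb rc.
  rewrite bE bspull_cmp -(fact _ _ sk (PT j)); apply: feqb.
  by rewrite -ipull_cmp -bE bj ck.
have valnat Q a i v Q' (h : @hom X (sval Q') (sval Q)) : val Q a i v ->
    val Q' (a \c h) (ipull h i) (bspull h v).
  move=> [g [b [j [rb <- ->]]]]; exists g, (b \c h), j; split.
  - by rewrite cmp_assoc rb [RHS]cmp_assoc.
  - exact: ipull_cmp.
  - by rewrite bspull_cmp.
have valex Q a i : lands (D := cover_fib) (a, i) saturation -> exists v, val Q a i v.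
  move=> /lands_saturation[g [b rb]].
  have [j ji] := bpull_surj (Q := bK_dom u) (Q' := bK_dom Q) b i.
  by exists (bspull b (f j)), g, b, j.
pose t : Sys := fun Q d => if pselect (exists v, val Q d.1 d.2 v) is left e
  then Some (sval (cid e)) else None.
have tE Q a i v : val Q a i v -> t Q (a, i) = Some v.
  move=> av; rewrite /t; case: pselect => [e|[]]; last by exists v.
  by congr Some; apply: valuniq av; case: cid.
have ton : on saturation (t : equivariant_sections).
  split=> [Q [a i] aS|].
    have [v av] := valex Q a i aS; exists v; split; first exact: tE.
    by move=> Q' h; apply: tE; exact: valnat.
  split.
  - move=> Q a i j q aS ij; have [g [b rb]] := lands_saturation aS.
    have [i' i'i] := bpull_surj (Q := bK_dom u) (Q' := bK_dom Q) b i.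
    have [j' j'j] := bpull_surj (Q := bK_dom u) (Q' := bK_dom Q) b j.
    have ij' : equiv_at (Q := bK_dom u) (on_pts b q) i' j'.
      apply/(equiv_at_pull (Q := bK_dom u) (Q' := bK_dom Q) b).
      by rewrite i'i j'j.
    have [V [oV Vq hV]] := feq _ _ _ (PT i') (PT j') ij'.
    have [Q' [h [ho hq hV']]] := bK_nbhs I (q := q) (svalP (bK_fam Q)) (open_on_pts b oV) Vq.
    exists Q', h; split=> //.
    have vi : val Q a i (bspull b (f i')) by exists g, b, i'.
    have vj : val Q a j (bspull b (f j')) by exists g, b, j'.
    rewrite (tE _ _ _ _ (valnat _ _ _ _ _ h vi)) (tE _ _ _ _ (valnat _ _ _ _ _ h vj)).
    rewrite -!bspull_cmp; congr Some; apply: hV => z; rewrite on_pts_cmp.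
    by apply: hV'; exists z.
  - move=> Q a i g aS; have [v [h [b [j [rb bj vE]]]]] := valex Q a i aS.
    have av : val Q a i v by exists h, b, j.
    rewrite (tE _ _ _ _ av); apply: tE; exists (h * g^-1)%g, b, j; split=> //.
    rewrite cmp_assoc -[X in X \c a]/(act_hom al (h * g^-1)%g \c act_hom al g).
    by rewrite -act_homM mulgKV.
  move=> Q [a i] v aS [tau [ct vE]]; apply: tE.
  have [g [b rb]] := lands_saturation aS.
  have [j ji] := bpull_surj (Q := bK_dom u) (Q' := bK_dom Q) b i.
  exists g, b, j; split=> //; symmetry; apply: (freq j) => //.
  exists tau; split; last by rewrite vE /= -ji.
  by rewrite /= rb; exact: compat_act.
have /choice[M MP] i := fnear i (PT i).
(* One neighbourhood for all branches, preserved by stable elements, so that it does not matter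
   which g moves a point into u. *)
pose N1 : set (pt (sval u)) := [set x | forall g, stable g -> forall i, M i (on_pts (psi g) x)].
have oN1 : open N1.
  apply: (open_forall (V := fun g => [set x | stable g -> forall i, M i (on_pts (psi g) x)])).
  move=> g; have [sg|nsg] := pselect (stable g); last first.
    rewrite (_ : mkset _ = setT); first exact: openT.
    by apply/seteqP; split=> // x _ sg; case: (nsg sg).
  rewrite (_ : mkset _ = on_pts (psi g) @^-1` [set x | forall i, M i x]).
    by apply/open_on_pts/(open_forall (V := M)) => i; have [] := MP i.
  by apply/seteqP; split=> x; [exact | move=> ? _].
have N1M x i : N1 x -> M i x by move=> /(_ _ stable1 i); rewrite psi1 on_pts_id.
have N1stab g x : stable g -> N1 x -> N1 (on_pts (psi g) x).
  move=> sg Nx h sh i; rewrite -on_pts_cmp -psiM//; apply: Nx.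
  exact: stableM.
have [i0 _] : exists i : I (bK_dom u), True.
  have [q _] := u_point; have := wmu_sum (I (bK_dom u)).
  apply: contraPP => /forallNP n; rewrite big1; last by move=> i; case: (n i).
  by move=> /eqP; rewrite eq_sym oner_eq0.
exists t, [set z | exists g, (on_pts r @` N1) (act g z)]; split=> //.
- apply: (orbit_saturate actM act_cont).
  exact: subfamily_image.
- move=> z [Cz [g [n _ rn]]]; exists g; exists n => //.
  move=> h sh i; have [_ CM _ _] := MP i; apply: CM.
  by rewrite /Cu /preimage /= on_psi// rn; do 2!apply: act_closed.
- move=> z [g [n Nn rn]]; split; last by exists g, n.
  apply: (act_open (g := g) oA); rewrite -rn.
  by have [_ _ MA _] := MP i0; apply: MA; exact: N1M.
move=> Q [a i] aN.
have aS : lands (D := cover_fib) (a, i) (A `&` saturation).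
  move=> q; have [g [n Nn rn]] := aN q; split; last by exists g, n.
  apply: (act_open (g := g) oA); rewrite -rn.
  by have [_ _ MA _] := MP i0; apply: MA; exact: N1M.
have aS' : lands (D := cover_fib) (a, i) saturation by move=> q; have [] := aS q.
have [g [b rb]] := lands_saturation aS'.
have [j ji] := bpull_surj (Q := bK_dom u) (Q' := bK_dom Q) b i.
have av : val Q a i (bspull b (f j)) by exists g, b, j.
rewrite [RHS](tE _ _ _ _ av).
have [_ [_ sA2 _]] := sA; rewrite -(sA2 Q a i g aS) -rb.
have <- : ipull (Q := u) b j = i := ji.
have [_ _ _ hM] := MP j; apply: hM => q; apply: N1M.
have [h [n Nn rn]] := aN q.
have rbq : on_pts r (on_pts b q) = act (g * h^-1)%g (on_pts r n).
  by rewrite -on_pts_cmp rb on_pts_cmp rn actM actK.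
have sk : stable (g * h^-1)%g.
  by apply: (@stableP _ (on_pts r n)); [exists n | rewrite -rbq; exists (on_pts b q)].
by rewrite (subfamily_inj ro (etrans rbq (esym (on_psi n sk)))); exact: N1stab.
Qed.

End LocalSoftness.

Lemma equivariant_soft p : trivial_stabilizers I ->
  exists2 U, U p & @soft_on _ equivariant_sections U.
Proof.
move=> Itriv; have [u [r [s0 [[ro rp] ract rfree s0w s0c]]]] := local_structure p Itriv.
exists (saturation r); first by exists 1%g; rewrite act1.
split; first by apply: (orbit_saturate actM act_cont); exact: subfamily_range.
move=> C A s cC oA CA sA.
have [P [f [pf PT]]] := full_choice ro ract rfree s0w s0c cC oA CA sA.
by apply: choice_soft pf PT.
Qed.

Lemma equivariant_patching : trivial_stabilizers I ->
  exists t : branched_sections I S y, invariant al t /\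
    forall (x : Kfam K) (c : @hom (Kfam K) x y) (t' : branched_sections I S x),
      compat c t' -> res (branched_sections I S) c t = t'.
Proof.
move=> Itriv.
have Yreg : regular_space Y := orbit_regular act1 actM act_cont (@exploded_regular R _).
have Yc : @second_countable Y :=
  orbit_second_countable act1 actM act_cont (@eman_countable _ _).
have [s sT] := soft_section Yreg Yc (fun p => equivariant_soft p Itriv).
exact: section_of_global sT.
Qed.

End EquivariantSections.

Theorem lemma3p24 (R : realType) (K : K_category R)
    (I : weighted_branched_cover K) (S : presheaf (Kfam K)) :
  trivial_stabilizers I -> is_sheaf S -> patching S ->
  patching (branched_sections I S) /\ averaging (branched_sections I S).
Proof.
move=> Itriv Ssheaf Spatch; split.
- move=> y J o r [ro rc] th.
  (* Patching involves no group; the permutations of one point act trivially. *)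
  pose al : action_on {perm unit} y := @ActionOn _ {perm unit} y (fun _ => idm y) erefl
    (fun _ _ => esym (cmp_id_l (idm y))).
  pose compat (x : Kfam K) (c : @hom (Kst K) (sval x) (sval y)) (t : branched_section I S x) :=
    forall k (w : Kfam K) (p : hom w x) (q : hom w (o k)),
      @is_pullback (Kfam K) _ _ _ _ c (r k) p q ->
      res (branched_sections I S) p t = res (branched_sections I S) q (th k).
  have [||q|t [_ tP]] := @equivariant_patching R K I S Ssheaf Spatch y _ al compat _ _ _ Itriv;
    last by exists t.
  + move=> x x' c b t ct k w' p' q' [e univ'].
    have [w [p [q pq]]] := @Kfam_subfamily_pullback _ _ _ _ _ c (r k) (ro k).
    have [h [[ph qh] _]] := pq.2 w' (@cmp (Kfam K) _ _ _ b p') q' (etrans (cmp_assoc _ _ _) e).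
    rewrite -[LHS](@res_cmp _ (branched_sections I S) _ _ _ b p') -ph -qh !res_cmp.
    by rewrite (ct k w p q pq).
  + by move=> x c t g ct; rewrite /= [_ \c c]cmp_id_l.
  have [k [a ra]] := rc q; exists (o k), (r k), (th k); split; [exact: ro | by exists a |].
  move=> x b t ct; symmetry.
  (* [r k] is monic, so x with the identity and b is a fibre product, and compatibility on it says
     that [th k] pulls back to t. *)
  have := ct k x (idm x) b; rewrite res_id; apply; split; first exact: cmp_id_r.
  move=> w p' q' e; exists p'; split=> [|h [h1 _]]; last by rewrite -h1; exact: cmp_id_l.
  split; first exact: cmp_id_l.
  apply: (subfamily_monic (ro k)); rewrite -[RHS]e; exact: cmp_assoc.
move=> y th G al.
(* Asking every translate of c to pull [th] back to t makes the condition invariant under G; an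
   equivariant map with invariant pullback satisfies it. *)
pose compat (x : Kfam K) (c : @hom (Kst K) (sval x) (sval y)) (t : branched_section I S x) :=
  forall h, res (branched_sections I S) (@cmp (Kfam K) _ _ _ (al h) c) th = t.
have [||q|t [tinv tP]] := @equivariant_patching R K I S Ssheaf Spatch y G al compat _ _ _ Itriv.
- move=> x x' c b t ct h; rewrite -(ct h).
  apply: etrans (@res_cmp _ (branched_sections I S) _ _ _ _ b th); congr (res _ _ _).
  exact: cmp_assoc.
- move=> x c t g ct h; rewrite -(ct (h * g)%g) act_homM; congr (res _ _ _).
  exact: cmp_assoc.
- exists y, (idm (sval y)), th; split.
  + exact: subfamily_id.
  + by exists q => //; rewrite on_pts_id.
  move=> x b t /(_ 1%g) <-; rewrite act_hom1.
  have e : @cmp (Kfam K) x y y (idm y) (@cmp (Kst K) _ _ _ (idm (sval y)) b) = b.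
    by rewrite [LHS]cmp_id_l; exact: cmp_id_l.
  exact: (congr1 (fun c : @hom (Kfam K) x y => res (branched_sections I S) c th) (esym e)).
exists t; split=> // x be a abe inv; apply: tP => h.
by rewrite -abe res_cmp inv.
Qed.
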